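(* As $q\to\infty$ through primes, uniformly for $\alpha,\beta\in\mathbb C$ with $|\alpha|,|\beta|\ll(\log q)^{-1}$ we have $$\sum_{\chi \,(\mathrm{mod}\, q)}^{*} L(\tfrac12+\alpha,\chi)\,L(\tfrac12+\beta,\overline{\chi})\,|\mathcal M(\chi)|^2\ll q .$$
   Context: $q$ is a prime tending to infinity, and $\sum^*_{\chi\,(\mathrm{mod}\,q)}$ denotes summation over primitive Dirichlet characters modulo $q$, $\chi\neq\chi_0$. $L(s,\chi)$ is the Dirichlet $L$-function. Mollifier. Let $\Omega(n)=\sum_{p^a\| n}a$, let $\lambda(n)=(-1)^{\Omega(n)}$ be the Liouville function, and let $\nu$ be the multiplicative function with $\nu(p^a)=1/a!$. Let $c_0$ be a fixed, sufficiently large constant and let $\eta>0$ be a sufficiently small constant. For $0\le j\le J$ let $\theta_j=\eta\, e^j/(\log\log q)^5$ and $\ell_j=2\lfloor\theta_j^{-3/4}\rfloor$, where the integer $J$ is chosen so that $\eta\le\theta_J\le e\eta$. Let $y=q^{\theta_0}$, $x=q^{\theta_J}$, $I_0=(c_0,y]$ and $I_j=(q^{\theta_{j-1}},q^{\theta_j}]$ for $1\le j\le J$. Define $$\mathcal M_j(\chi)=\sum_{\substack{p\mid n\Rightarrow p\in I_j\\ \Omega(n)\le\ell_j}}\frac{\lambda(n)\nu(n)\chi(n)}{\sqrt n},\qquad \mathcal M(\chi)=\prod_{j=0}^J\mathcal M_j(\chi).$$ Implied constants may depend on $c_0$, $\eta$ and the implied constant in $|\alpha|,|\beta|\ll(\log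 q)^{-1}$. *)

(* Defs.v *)
From HB Require Import structures.
From mathcomp Require Import all_boot all_order all_algebra complex.
From mathcomp Require Import all_classical all_reals all_analysis.

Set Implicit Arguments.
Unset Strict Implicit.
Unset Printing Implicit Defensive.

Import Order.TTheory GRing.Theory Num.Theory.
Import numFieldNormedType.Exports.

Local Open Scope classical_set_scope.
Local Open Scope ring_scope.
Local Open Scope complex_scope.

Section DirichletCharacters.
Variable R : realType.

(* A character modulo q is represented by its values on the nonnegative
   integers, which determine it by periodicity. *)
Definition dirichlet_character (q : nat) (chi : nat -> R[i]) : Prop :=
  [/\ forall n, chi (n + q)%N = chi n,
      forall m n, chi (m * n)%N = chi m * chi n
    & forall n, (chi n != 0) = coprime n q].

Definition principal_character (q : nat) : nat -> R[i] :=
  fun n => (coprime n q)%:R.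

Definition induced_by (q d : nat) (chi psi : nat -> R[i]) : Prop :=
  dirichlet_character d psi /\ forall n, coprime n q -> chi n = psi n.

Definition primitive_character (q : nat) (chi : nat -> R[i]) : Prop :=
  dirichlet_character q chi /\
  forall d psi, (d %| q)%N -> (d < q)%N -> ~ induced_by q d chi psi.

Definition conj_character (chi : nat -> R[i]) : nat -> R[i] :=
  fun n => (chi n)^*.

End DirichletCharacters.

Section LFunction.
Variable R : realType.

Definition cexp (z : R[i]) : R[i] :=
  (expR (complex.Re z))%:C * (cos (complex.Im z) +i* sin (complex.Im z)).

(* n ^ (- s), for n > 0 *)
Definition dirichlet_power (s : R[i]) (n : nat) : R[i] :=
  cexp (- s * (ln (n%:R : R))%:C).

(* The limit of the partial sums sum_(1 <= n <= N) chi n / n ^ s. For a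
   nonprincipal character the Dirichlet series converges (conditionally if
   Re s <= 1) to L(s, chi) in the whole half-plane Re s > 0; the definition is
   only meant to be used there. The regular module R[i]^o carries the topology
   given by the complex absolute value. *)
Definition dirichlet_L (s : R[i]) (chi : nat -> R[i]) : R[i] :=
  lim ((fun N : nat =>
    \sum_(1 <= n < N.+1) chi n * dirichlet_power s n : R[i]^o) @ \oo).

End LFunction.

Definition big_Omega (n : nat) : nat := (\sum_(p <- primes n) logn p n)%N.

Section Mollifier.
Variable R : realType.

Definition liouville (n : nat) : R := (-1) ^+ big_Omega n.

Definition nu (n : nat) : R := \prod_(p <- primes n) ((logn p n)`!%:R)^-1.

Variables (c0 eta : R) (q : nat).

Definition theta (j : nat) : R :=
  eta * expR j%:R / ln (ln (q%:R : R)) ^+ 5.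

(* truncn is the integer part, as a natural number *)
Definition ell (j : nat) : nat := (2 * Num.truncn (theta j `^ (- (3 / 4))))%N.

Definition in_I (j p : nat) : bool :=
  (if j is i.+1 then (q%:R : R) `^ theta i else c0) < p%:R
    <= (q%:R : R) `^ theta j.

Definition mollifier_support (j : nat) : set nat :=
  [set n | [/\ (0 < n)%N,
               forall p, prime p -> (p %| n)%N -> in_I j p
             & (big_Omega n <= ell j)%N]].

Definition mollifier_factor (j : nat) (chi : nat -> R[i]) : R[i] :=
  \sum_(n \in mollifier_support j)
    (liouville n * nu n / Num.sqrt n%:R)%:C * chi n.

Definition mollifier (J : nat) (chi : nat -> R[i]) : R[i] :=
  \prod_(j < J.+1) mollifier_factor j chi.

End Mollifier.

(* Main.v *)
Require Import Defs.
From HB Require Import structures.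
From mathcomp Require Import all_boot all_order all_algebra complex.
From mathcomp Require Import all_classical all_reals all_analysis measurable_realfun.
From mathcomp Require Import ring lra zify.
Set Implicit Arguments.
Unset Strict Implicit.
Unset Printing Implicit Defensive.

Import Order.TTheory GRing.Theory Num.Theory.
Import numFieldNormedType.Exports.
Import ComplexField.Normc.

Local Open Scope classical_set_scope.
Local Open Scope ring_scope.
Local Open Scope complex_scope.

(* Idea.  By Cauchy-Schwarz one bounds the mollified second moment of a single
   L(1/2 + alpha, chi).  Summing Gamma(s) n^(-s) = int e^(sv) exp(- n e^v) dv
   over n gives Gamma(s) L(s, chi) = int e^(sv) K_chi(e^v) dv with K_chi an
   explicit quotient.  A smooth cutoff W at v about -(ln q) / 2 splits the
   integral: the part of large v is a sum of chi(m) over m < q^(1 - delta), and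
   in the part of small v the Gauss sum identity turns K_chi into
   sum_m conj(chi(m)) / (e^u e(- m / q) - 1), which by
   1 / (e^w - 1) = 1 / w + O(1) is a dual sum of the same shape; this is an
   approximate functional equation without any contour integral.  Because W is,
   up to O(q^(-4)), a short combination of exponentials e^(i k v), all
   coefficients are combinations of m^(-1/2 - z) with z << 1 / ln q on average.
   The mollifier has length q^delta, so the large sieve for characters modulo q
   (Bessel's inequality) has only diagonal terms, and these are the mean squares
   of the multiplicative convolutions of the mollifier blocks with n^(-z).  In
   each block the mollifier cancels n^(-z) except at the primes where
   p^(-z) differs from 1, which is rare for z << 1 / ln q; truncating Omega costs
   a factor 4^(- l_j). *)

(** * Complex exponentials *)

Section ComplexNorm.
Variable R : realType.
Implicit Types (z w : R[i]) (x y : R).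

(** The obstacle is uniformity in the number of blocks, which grows with q: a constant lost in each
    block would be fatal. So the square of main term plus truncation error is expanded with weights
    1 + 4^(-l_j) and 1 + 4^(l_j), and the losses 4^(-l_j) must be summable. For j >= 1 the
    reciprocals of the primes of a block sum to O(1), and l_j >= J - j makes the series geometric.
    Block 0 has a sum of order log log q and needs l_0 >= (log log q)^3, which the fifth power in
    theta_0 provides. About primes only Chebyshev-type upper bounds enter. The mean square for
    n^(-z) grows like a power of 1 + |z| ln q; this exponent dictates how often the cutoff is
    averaged, so that its frequencies have a bounded moment of that order. The smallness of eta
    comes from sum_j l_j theta_j <= 10 theta_J^(1/4): once the right side is at most 1/64, the
    mollifier is shorter than q^(1/64). Every other error beats its target by a spare factor
    q^(-1/32), which absorbs all constants. *)

Lemma normc_ge0 z : 0 <= normc z.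
Proof. by case: z => a b; exact: sqrtr_ge0. Qed.

Lemma normrcE z : `|z| = (normc z)%:C.
Proof. by []. Qed.

Lemma normcR x : normc x%:C = `|x|.
Proof. by rewrite /= expr0n addr0 sqrtr_sqr. Qed.

Lemma normcX z n : normc (z ^+ n) = normc z ^+ n.
Proof. by elim: n => [|n IH]; rewrite ?expr0 ?normc1// !exprS normcM IH. Qed.

Lemma normc_sum (I : Type) (r : seq I) (P : pred I) (F : I -> R[i]) :
  normc (\sum_(i <- r | P i) F i) <= \sum_(i <- r | P i) normc (F i).
Proof.
elim/big_rec2: _ => [|i y x _ h]; first by rewrite normc0.
by apply: (le_trans (le_normcD _ _)); rewrite lerD2l.
Qed.

Lemma normc_prod (I : Type) (r : seq I) (P : pred I) (F : I -> R[i]) :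
  normc (\prod_(i <- r | P i) F i) = \prod_(i <- r | P i) normc (F i).
Proof.
by elim/big_rec2: _ => [|i y x _ <-]; rewrite ?normc1 ?normcM.
Qed.

Lemma normc_conj z : normc (conjc z) = normc z.
Proof. by case: z => a b /=; rewrite sqrrN. Qed.

Lemma normc_sqr z : normc z ^+ 2 = complex.Re z ^+ 2 + complex.Im z ^+ 2.
Proof. by case: z => a b /=; rewrite sqr_sqrtr ?addr_ge0 ?sqr_ge0. Qed.

Lemma mulc_conj z : z * (conjc z) = (normc z ^+ 2)%:C.
Proof.
by rewrite normc_sqr; case: z => a b; apply/eqP; rewrite eq_complex /=; apply/andP; split; apply/eqP; ring.
Qed.

Lemma normc_subC z w : normc (z - w) = normc (w - z).
Proof. by rewrite -normcN opprB. Qed.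

Lemma le_normcB z w : normc (z - w) <= normc z + normc w.
Proof. by rewrite -(normcN w); exact: le_normcD. Qed.

Lemma Re_le_normc z : `|complex.Re z| <= normc z.
Proof.
case: z => a b /=; rewrite -sqrtr_sqr ler_wsqrtr// lerDl sqr_ge0 //.
Qed.

Lemma Im_le_normc z : `|complex.Im z| <= normc z.
Proof.
case: z => a b /=; rewrite -sqrtr_sqr ler_wsqrtr// lerDr sqr_ge0 //.
Qed.

Lemma normc_le_ReIm z : normc z <= `|complex.Re z| + `|complex.Im z|.
Proof.
have e : z = (complex.Re z)%:C + 'i * (complex.Im z)%:C by exact: complexE.
rewrite {1}e (le_trans (le_normcD _ _))// normcM !normcR lerD2l.
by rewrite /= expr0n add0r expr1n sqrtr1 mul1r.
Qed.

Lemma normc_eq0 z : (normc z == 0) = (z == 0).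
Proof. by apply/eqP/eqP => [/eq0_normc//|->]; rewrite normc0. Qed.

Lemma normc_gt0 z : (0 < normc z) = (z != 0).
Proof. by rewrite lt_def normc_ge0 normc_eq0 andbT. Qed.

Lemma ler_normcR z x : (`|z| <= x%:C) = (normc z <= x).
Proof. by rewrite normrcE lecR. Qed.

Lemma sqr_normc_le2 z w : normc (z + w) ^+ 2 <= 2 * normc z ^+ 2 + 2 * normc w ^+ 2.
Proof.
have h := le_normcD z w; have h0 := normc_ge0 (z + w).
have h1 := normc_ge0 z; have h2 := normc_ge0 w.
have h3 : normc (z + w) ^+ 2 <= (normc z + normc w) ^+ 2.
  by rewrite lerXn2r// nnegrE addr_ge0.
apply: (le_trans h3); have := sqr_ge0 (normc z - normc w); nra.
Qed.

Lemma normc_triangle z w : normc z - normc w <= normc (z - w).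
Proof.
have := le_normcD (z - w) w; rewrite subrK; lra.
Qed.

End ComplexNorm.

Section CExp.
Variable R : realType.
Implicit Types (z w : R[i]) (x y : R).

Lemma cexpD z w : cexp (z + w) = cexp z * cexp w.
Proof.
case: z => a b; case: w => c d; rewrite /cexp /= expRD sinD cosD.
by apply/eqP; rewrite eq_complex /=; apply/andP; split; apply/eqP; ring.
Qed.

Lemma cexp0 : cexp (0 : R[i]) = 1.
Proof. by rewrite /cexp /= expR0 sin0 cos0 mul1r. Qed.

Lemma normc_cexp z : normc (cexp z) = expR (complex.Re z).
Proof.
rewrite /cexp normcM normcR ger0_norm ?expR_ge0//= cos2Dsin2.
by rewrite sqrtr1 mulr1.
Qed.

Lemma cexp_neq0 z : cexp z != 0.
Proof. by rewrite -normc_gt0 normc_cexp expR_gt0. Qed.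

Lemma cexpN z : cexp (- z) = (cexp z)^-1.
Proof.
apply: (mulfI (cexp_neq0 z)).
by rewrite -cexpD subrr cexp0 divff// cexp_neq0.
Qed.

Lemma cexpR x : cexp x%:C = (expR x)%:C.
Proof. by rewrite /cexp /= sin0 cos0 mulr1. Qed.

Lemma cexp_2pi : cexp (0 +i* (pi *+ 2)) = 1 :> R[i].
Proof. by rewrite /cexp /= expR0 cos2pi sin2pi mul1r. Qed.

Lemma sin_le_id x : 0 <= x -> sin x <= x.
Proof.
rewrite le_eqVlt => /predU1P[<-|x0]; first by rewrite sin0.
have [c c_itv] : exists2 c, c \in `]0, x[%R & sin x - sin 0 = cos c * (x - 0).
  apply: MVT => //; last by apply: continuous_subspaceT; exact: continuous_sin.
rewrite sin0 !subr0 => ->; rewrite -[leRHS]mul1r ler_pM2r// ?cos_le1.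
Qed.

Lemma norm_sin_le x : `|sin x| <= `|x|.
Proof.
wlog x0 : x / 0 <= x.
  move=> h; have [/h//|x0] := leP 0 x.
  by rewrite -normrN -sinN -(normrN x) h// oppr_ge0 ltW.
rewrite (ger0_norm x0) ler_norml sin_le_id// andbT.
have [c c_itv] : exists2 c, c \in `[0, x]%R & sin x - sin 0 = cos c * (x - 0).
  apply: MVT_segment => //; last by apply: continuous_subspaceT; exact: continuous_sin.
rewrite sin0 !subr0 => ->; have := cos_geN1 c; nra.
Qed.

(** A weak Jordan inequality. Sine increases on the range, so [x] may be halved; for c in [0, x/2]
    one has c / 2 <= pi / 8 < 1/2, hence [cos c >= 1/2], and the mean value theorem gives x / 4. *)
Lemma sin_ge_quarter x : 0 <= x <= pi / 2 -> x / 4 <= sin x.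
Proof.
move=> /andP[x0 xpi].
have h1 : sin (x / 2) <= sin x.
  rewrite leNgt; apply/negP => h.
  have := h; rewrite ltr_sin ?in_itv/=; first lra.
    by apply/andP; split; [have := pi_gt0 R; lra|].
  by apply/andP; split; [have := pi_gt0 R; lra|have := pi_gt0 R; lra].
apply: le_trans h1.
have [c c_itv] : exists2 c, c \in `[0, x/2]%R & sin (x/2) - sin 0 = cos c * (x/2 - 0).
  apply: MVT_segment => //; [by lra|by apply: continuous_subspaceT; exact: continuous_sin].
rewrite sin0 !subr0 => ->.
move: c_itv; rewrite in_itv/= => /andP[c0 cx].
have : 1/2 <= cos c.
  have e : cos c = 1 - 2 * sin (c/2) ^+ 2.
    have -> : cos c = cos ((c/2) *+ 2) by congr cos; rewrite mulr2n; lra.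
    by rewrite cos_mulr2n cos2sin2 -mulr_natl; ring.
  have s1 : sin (c/2) <= 1/2.
    apply: (le_trans (sin_le_id _)); first lra.
    have := @pihalf_lt2 R; lra.
  have s0 : 0 <= sin (c/2).
    apply: sin_ge0_pi; apply/andP; split; first lra.
    have := pi_gt0 R; lra.
  rewrite e; nra.
nra.
Qed.

Lemma cosE_sin_half x : 1 - cos x = 2 * sin (x / 2) ^+ 2.
Proof.
have -> : cos x = cos ((x/2) *+ 2) by congr cos; rewrite mulr2n; lra.
by rewrite cos_mulr2n cos2sin2 -mulr_natl; ring.
Qed.

Lemma normc_cis_sub1 y : normc (cexp (0 +i* y) - 1) = 2 * `|sin (y / 2)|.
Proof.
apply/eqP; rewrite -(@eqrXn2 _ 2)// ?normc_ge0 ?mulr_ge0//.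
rewrite normc_sqr /cexp /= expR0 exprMn real_normK ?num_real//.
have := cosE_sin_half y; have := cos2Dsin2 y.
move: (sin y) (cos y) (sin (y/2)) => s c t h1 h2; apply/eqP.
by rewrite !(mul1r,mul0r,subr0,addr0,add0r,oppr0); nra.
Qed.

Lemma normc_cis_sub1_le y : normc (cexp (0 +i* y) - 1) <= `|y|.
Proof.
rewrite normc_cis_sub1; have := norm_sin_le (y/2).
rewrite normrM (ger0_norm (_ : 0 <= 2^-1 :> R))//; lra.
Qed.

Lemma cexpE x y : cexp (x +i* y) = (expR x)%:C * cexp (0 +i* y).
Proof. by rewrite /cexp /= expR0 mul1r. Qed.

Lemma expR_sub1_le x : `|x| <= 1/2 -> `|expR x - 1| <= 2 * `|x|.
Proof.
move=> x1.
have h1 : x <= expR x - 1 by have := expR_ge1Dx x; lra.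
have h2 : expR x - 1 <= x * expR x.
  have := expR_ge1Dx (-x); rewrite expRN => h.
  have e0 := expR_gt0 x.
  have : (1 - x) * expR x <= 1 by rewrite -ler_pdivlMr// mul1r.
  lra.
have [x0|x0] := leP 0 x.
- rewrite (ger0_norm x0) in x1 *; rewrite ger0_norm; last lra.
  have : expR x <= 2 by nra.
  nra.
- rewrite (ltr0_norm x0) in x1 *.
  have : expR x <= 1 by rewrite expR_le1; lra.
  by move=> ?; rewrite ler0_norm; lra.
Qed.

Lemma expR_sub1_sub_le x : `|x| <= 1/2 -> `|expR x - 1 - x| <= 2 * x ^+ 2.
Proof.
move=> x1.
have h1 : x <= expR x - 1 by have := expR_ge1Dx x; lra.
have h2 : expR x - 1 <= x * expR x.
  have := expR_ge1Dx (-x); rewrite expRN => h.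
  have e0 := expR_gt0 x.
  have : (1 - x) * expR x <= 1 by rewrite -ler_pdivlMr// mul1r.
  lra.
have h3 := expR_sub1_le x1.
rewrite ger0_norm; last by lra.
have h4 : x * (expR x - 1) <= `|x| * (2 * `|x|).
  by apply: (le_trans (ler_norm _)); rewrite normrM ler_wpM2l.
have : `|x| * `|x| = x * x by rewrite -normrM ger0_norm// -expr2 sqr_ge0.
rewrite expr2; nra.
Qed.

Lemma normc_cexp_sub1_le z : normc z <= 1/2 -> normc (cexp z - 1) <= 4 * normc z.
Proof.
case: z => a b h.
have ha : `|a| <= normc (a +i* b) by exact: (Re_le_normc (a +i* b)).
have hb : `|b| <= normc (a +i* b) by exact: (Im_le_normc (a +i* b)).
have -> : cexp (a +i* b) - 1 =
  (expR a)%:C * (cexp (0 +i* b) - 1) + ((expR a)%:C - 1) by rewrite cexpE; ring.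
apply: (le_trans (le_normcD _ _)).
rewrite normcM normcR (ger0_norm (expR_ge0 _)).
have -> : (expR a)%:C - 1 = (expR a - 1)%:C by rewrite rmorphB rmorph1.
rewrite normcR.
have h1 := normc_cis_sub1_le b.
have h2 : `|expR a - 1| <= 2 * `|a| by apply: expR_sub1_le; lra.
have h3 : expR a <= 2 by have := ler_norm (expR a - 1); lra.
have := expR_gt0 a; have := normr_ge0 b; have := normc_ge0 (cexp (0 +i* b) - 1).
nra.
Qed.

End CExp.

Section Conj.
Variable R : realType.

Lemma conjcM (z w : R[i]) : conjc (z * w) = conjc z * conjc w.
Proof. exact: rmorphM. Qed.

Lemma conjcB (z w : R[i]) : conjc (z - w) = conjc z - conjc w.
Proof. exact: rmorphB. Qed.

Lemma conjc_sum (I : Type) (r : seq I) (P : pred I) (F : I -> R[i]) :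
  conjc (\sum_(i <- r | P i) F i) = \sum_(i <- r | P i) conjc (F i).
Proof. exact: rmorph_sum. Qed.

End Conj.

#[global] Arguments conjc : simpl never.
#[global] Arguments ComplexField.Normc.normc : simpl never.
#[global] Arguments cexp : simpl never.
#[global] Arguments dirichlet_power : simpl never.
#[global] Arguments liouville : simpl never.
#[global] Arguments nu : simpl never.

(** * Sums over primes *)

Section PrimeSums.
Variable R : realType.
Implicit Types (x y w t : R).

Lemma ln_nat_ge0 n : 0 <= ln n%:R :> R.
Proof. by case: n => [|n]; [rewrite ln0|rewrite ln_ge0// ler1n]. Qed.

Lemma ln_prod_nat (I : Type) (r : seq I) (P : pred I) (F : I -> nat) :
  (forall i, P i -> (0 < F i)%N) ->
  ln (\prod_(i <- r | P i) F i)%:R = \sum_(i <- r | P i) ln (F i)%:R :> R.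
Proof.
move=> F0; suff [] : ln (\prod_(i <- r | P i) F i)%:R = \sum_(i <- r | P i) ln (F i)%:R :> R
  /\ (0 < \prod_(i <- r | P i) F i)%N by [].
elim/big_rec2: _ => [|i x y Pi [e h]]; first by rewrite ln1.
by split; rewrite ?muln_gt0 ?h ?F0// natrM lnM ?posrE ?ltr0n ?F0// e.
Qed.

Lemma ln_logn m : (0 < m)%N ->
  ln m%:R = \sum_(p < m.+1) (logn p m)%:R * ln (p : nat)%:R :> R.
Proof.
move=> m0; rewrite -{1}(partnT m0) /partn big_mkord ln_prod_nat => [|[[|i] h] _]; last first.
- by rewrite expn_gt0.
- by rewrite lognE.
apply: eq_bigr => -[[|i] h] _; first by rewrite [nat_of_ord _]/= lognE mul0r expn0 ln1.
by rewrite natrX lnXn ?ltr0n// mulr_natl.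
Qed.

Lemma ler_ln_nat m n : (m <= n)%N -> ln m%:R <= ln n%:R :> R.
Proof.
case: m => [|m] mn; first by rewrite ln0 ?ln_nat_ge0.
by rewrite ler_ln ?posrE ?ltr0n ?ler_nat// (leq_trans _ mn).
Qed.

Lemma ln_fact_le n : ln (n`!)%:R <= n%:R * ln n%:R :> R.
Proof.
elim: n => [|n IH]; first by rewrite fact0 ln1 mul0r.
rewrite factS natrM lnM ?posrE ?ltr0n ?fact_gt0//.
rewrite (_ : n.+1%:R * _ = ln n.+1%:R + n%:R * ln n.+1%:R); last by rewrite -natr1; ring.
by rewrite lerD2l (le_trans IH)// ler_wpM2l// ler_ln_nat.
Qed.

(** Mertens' upper bound up to a constant, from n! alone: ln n! <= n ln n, while p divides n! at
    least d = floor(n / p) times, and n < (d + 1) p <= 2 d p for p <= n. *)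
Lemma sum_lnp_div_le n : (0 < n)%N ->
  \sum_(p < n.+1 | prime p) ln (p : nat)%:R / (p : nat)%:R <= 2 * ln n%:R :> R.
Proof.
move=> n0.
have h1 : \sum_(p < n.+1 | prime p) (n%:R / 2) * (ln (p : nat)%:R / (p : nat)%:R)
     <= n%:R * ln n%:R :> R.
  apply: le_trans (ln_fact_le n); rewrite ln_logn ?fact_gt0//.
  have nle : (n <= n`!)%N by exact: fact_geq.
  rewrite -(big_mkord prime (fun p => n%:R / 2 * (ln p%:R / p%:R) : R)).
  rewrite -(big_mkord xpredT (fun p => (logn p n`!)%:R * ln p%:R : R)).
  rewrite [leRHS](@big_cat_nat _ _ _ n.+1)//=.
  apply: ler_wpDr; first by apply: sumr_ge0 => i _; rewrite mulr_ge0 ?ln_nat_ge0.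
  rewrite big_mkcond/= ler_sum_nat// => p /andP[_ pn].
  case: ifP => pp; last by rewrite mulr_ge0 ?ln_nat_ge0.
  rewrite mulrCA mulrC ler_wpM2r ?ln_nat_ge0//.
  have p0 := prime_gt0 pp.
  have h : (n < p * (logn p n`!).*2)%N.
    rewrite logn_fact// big_ltn// expn1.
    have := ltn_ceil n p0; have : (0 < n %/ p)%N by rewrite divn_gt0.
    by set d := (n %/ p)%N; set e := (\sum_(_ <= _ < _) _)%N; nia.
  have : n%:R <= p%:R * ((logn p n`!)%:R * 2) :> R.
    by rewrite -natrM muln2 -natrM ler_nat ltnW.
  have p0' : 0 < p%:R :> R by rewrite ltr0n.
  by move=> h'; rewrite ler_pdivrMr//; lra.
rewrite -mulr_sumr in h1.
have n0' : 0 < n%:R :> R by rewrite ltr0n.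
nra.
Qed.

Lemma ln2_ge_half : 1 / 2 <= ln 2 :> R.
Proof.
rewrite -ler_expR lnK ?posrE//.
have := @expR_sub1_le R (1/2); rewrite ger0_norm// => /(_ (lexx _)) h.
have := ler_norm (expR (1/2 : R) - 1); lra.
Qed.

Lemma ler_sum_ord_sub N M (P Q : pred nat) (F G : nat -> R) :
  (forall p, 0 <= G p) ->
  (forall p, (p < N)%N -> P p -> [/\ Q p, (p < M)%N & F p <= G p]) ->
  \sum_(p < N | P p) F p <= \sum_(p < M | Q p) G p.
Proof.
move=> G0 h.
rewrite (big_ord_widen_cond (N + M) P F) ?leq_addr//.
rewrite (big_ord_widen_cond (N + M) Q G) ?leq_addl//.
rewrite big_mkcond [leRHS]big_mkcond/=; apply: ler_sum => p _.
case: ifP => [/andP[Pp pN]|_]; last by case: ifP.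
by have [-> -> ->] := h _ pN Pp.
Qed.

(** Every such prime has ln p >= ln y, so the bound 2 ln(y^2) = 4 ln y for the sum of ln p / p may
    be divided by ln y. *)
Lemma sum_primeV_sq_le N y : 1 < y ->
  \sum_(p < N | prime p && (y < p%:R <= y ^+ 2)) (p%:R)^-1 <= 4 :> R.
Proof.
move=> y1; pose n := Num.truncn (y ^+ 2).
have ly : 0 < ln y by rewrite ln_gt0.
have y2 : 1 < y ^+ 2 by rewrite exprn_egt1.
have /andP[n1 n2] : n%:R <= y ^+ 2 < n.+1%:R by apply: truncn_itv; rewrite ltW// (lt_trans ltr01).
have n0 : (0 < n)%N by rewrite truncn_gt0 ltW.
have h : ln n%:R <= 2 * ln y.
  rewrite (_ : 2 * ln y = ln (y ^+ 2)); last by rewrite lnXn ?(lt_trans ltr01)// mulr_natl.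
  by rewrite ler_ln// posrE ?ltr0n// (lt_trans ltr01).
have h2 := sum_lnp_div_le n0.
suff : \sum_(p < N | prime p && (y < p%:R <= y ^+ 2)) ln y / p%:R
    <= \sum_(p < n.+1 | prime p) ln (p : nat)%:R / (p : nat)%:R.
  by rewrite -mulr_sumr; nra.
apply: (@ler_sum_ord_sub _ _ (fun p => prime p && (y < p%:R <= y ^+ 2)) prime
  (fun p => ln y / p%:R) (fun p => ln p%:R / p%:R)) => [p|p pN /andP[pp /andP[yp py2]]].
  by rewrite divr_ge0 ?ln_nat_ge0.
have y0 : 0 < y by rewrite (lt_trans ltr01).
have p0 := lt_trans y0 yp.
split => //; last by rewrite ler_wpM2r ?invr_ge0 ?ler_ln ?posrE ?ltW.
by rewrite ltnS truncn_ge_nat// (le_trans _ (ltW y2)).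
Qed.

Lemma sum_primeV_pow_le N y k : 1 < y ->
  \sum_(p < N | prime p && (y < p%:R <= y ^+ (2 ^ k))) (p%:R)^-1 <= 4 * k%:R :> R.
Proof.
move=> y1; elim: k => [|k IH].
  rewrite big1 ?mulr0// => p /andP[_]; rewrite expn0 expr1 => /andP[h1 h2].
  by move: (lt_le_trans h1 h2); rewrite ltxx.
set z := y ^+ (2 ^ k) in IH.
have z1 : 1 < z by rewrite exprn_egt1// -lt0n expn_gt0.
have e : y ^+ (2 ^ k.+1) = z ^+ 2 by rewrite expnSr exprM.
rewrite e -(@natr1 _ k) mulrDr mulr1 (bigID (fun p : 'I_N => p%:R <= z))/=.
apply: lerD.
  apply: le_trans IH; apply: (@ler_sum_ord_sub _ _ (fun p => prime p && (y < p%:R <= z ^+ 2) && (p%:R <= z))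
    (fun p => prime p && (y < p%:R <= z)) (fun p => (p%:R)^-1) (fun p => (p%:R)^-1)) => [p|p pN]; first by rewrite invr_ge0.
  by case/andP=> /andP[-> /andP[-> _]] ->.
apply: le_trans (sum_primeV_sq_le N z1).
apply: (@ler_sum_ord_sub _ _ (fun p => prime p && (y < p%:R <= z ^+ 2) && ~~ (p%:R <= z))
    (fun p => prime p && (z < p%:R <= z ^+ 2)) (fun p => (p%:R)^-1) (fun p => (p%:R)^-1)) => [p|p pN]; first by rewrite invr_ge0.
by case/andP=> /andP[-> /andP[_ ->]]; rewrite -ltNge => ->.
Qed.

(** Repeated squaring leads from y to w, each step costing 4. Since [ln 2 >= 1/2], some k <= 2 ln r
    + 1 squarings suffice, whence the constants 4 and 8. *)
Lemma sum_primeV_le N y w : 1 < y -> y <= w ->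
  \sum_(p < N | prime p && (y < p%:R <= w)) (p%:R)^-1 <= 4 + 8 * ln (ln w / ln y) :> R.
Proof.
move=> y1 yw; have ly : 0 < ln y by rewrite ln_gt0.
have lw : ln y <= ln w by rewrite ler_ln// posrE (lt_trans ltr01)// (lt_le_trans y1).
set r := ln w / ln y; have r1 : 1 <= r by rewrite ler_pdivlMr// mul1r.
have lr : 0 <= ln r by rewrite ln_ge0.
have [k /andP[k1 k2]] : exists k, 2 * ln r < k%:R <= 2 * ln r + 1.
  exists (Num.truncn (2 * ln r)).+1.
  have := truncn_itv (_ : 0 <= 2 * ln r); rewrite mulr_ge0// => /(_ isT)/andP[h ->].
  by rewrite -natr1 lerD2r.
have rk : r <= 2 ^+ k.
  have r0 : 0 < r by rewrite (lt_le_trans ltr01).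
  rewrite -ler_ln ?posrE ?exprn_gt0// lnXn// -(mulr_natl (ln 2)).
  have : k%:R * (1 / 2) <= k%:R * ln 2 :> R by rewrite ler_wpM2l// ln2_ge_half.
  lra.
have wk : w <= y ^+ (2 ^ k).
  have y0 : 0 < y by rewrite (lt_trans ltr01).
  rewrite -ler_ln ?posrE ?exprn_gt0 ?(lt_le_trans y0)//.
  rewrite lnXn// -(mulr_natl (ln y)) natrX -ler_pdivrMr//.
have : 4 * k%:R <= 4 + 8 * ln r by lra.
apply: le_trans; apply: le_trans (sum_primeV_pow_le N k y1).
apply: (@ler_sum_ord_sub _ _ (fun p => prime p && (y < p%:R <= w))
    (fun p => prime p && (y < p%:R <= y ^+ (2 ^ k))) (fun p => (p%:R)^-1) (fun p => (p%:R)^-1)) => [p|p pN]; first by rewrite invr_ge0.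
by case/andP=> -> /andP[-> h]; rewrite (le_trans h).
Qed.

Lemma ln_lin_le (c x : R) : 1 <= c -> 0 <= x -> ln (1 + c * x) <= c + ln (1 + x).
Proof.
move=> c1 x0.
have : ln (1 + c * x) <= ln (c * (1 + x)) by rewrite ler_ln ?posrE; nra.
rewrite lnM ?posrE; [|lra|lra].
have := @ln_sublinear R c; lra.
Qed.

(* Only Chebyshev-strength information on primes is needed: split at
   [t * ln p = 1/2]. *)
Lemma sum_prime_min_le N t A B (f : nat -> R) : 0 <= t -> 0 <= A -> 0 <= B ->
  (1 < N)%N -> (forall p, prime p -> (p < N)%N -> f p <= A) ->
  (forall p, prime p -> t * ln p%:R <= 1 / 2 -> f p <= B * (t * ln p%:R) ^+ 2) ->
  \sum_(p < N | prime p) f p / p%:R <= B / 2 + A * (28 + 8 * ln (1 + t * ln N%:R)).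
Proof.
move=> t0 A0 B0 N1 hA hB.
have lN := ln_nat_ge0 N.
have hR : 0 <= ln (1 + t * ln N%:R).
  by rewrite ln_ge0// lerDl mulr_ge0.
have [t00|tn0] := eqVneq t 0.
  apply: (@le_trans _ _ 0); last by rewrite addr_ge0// ?mulr_ge0//; lra.
  rewrite big_mkcond/=; apply: sumr_le0 => p _; case: ifP => // pp.
  rewrite pmulr_lle0 ?invr_gt0 ?ltr0n ?prime_gt0//.
  have := hB p pp; by rewrite t00 !mul0r expr0n mulr0; apply; lra.
have {}t0 : 0 < t by rewrite lt_def tn0.
rewrite (bigID (fun p : 'I_N => t * ln (p%:R : R) <= 1 / 2))/=; apply: lerD.
  (* [P0] is the point where t ln p = 1/2. Below it one factor t ln p of the quadratic bound is
     replaced by 1/2, and the bound for ln p / p summed up to [P0] leaves B / 2. *)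
  pose P0 : R := expR (1 / (2 * t)); pose n := Num.truncn P0.
  have P1 : 1 <= P0 by rewrite -expR0 ler_expR divr_ge0// mulr_ge0// ltW.
  have /andP[n1 _] : n%:R <= P0 < n.+1%:R by apply: truncn_itv; rewrite (le_trans ler01).
  have n0 : (0 < n)%N by rewrite truncn_gt0.
  have ln_n : ln n%:R <= 1 / (2 * t).
    by rewrite -(expRK (1 / (2 * t))) ler_ln// posrE ?expR_gt0// ltr0n.
  have h := sum_lnp_div_le n0.
  have Bt : 0 <= B * t / 2 by rewrite divr_ge0// mulr_ge0// ltW.
  apply: (@le_trans _ _ (B * t / 2 * (2 * (1 / (2 * t))))); last first.
    by rewrite le_eqVlt; apply/orP; left; apply/eqP; field; rewrite gt_eqF.
  apply: (@le_trans _ _ (B * t / 2 * (2 * ln n%:R))); last first.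
    by rewrite (ler_wpM2l Bt)// ler_wpM2l.
  apply: (@le_trans _ _ (B * t / 2 * (\sum_(p < n.+1 | prime p) ln (p : nat)%:R / (p : nat)%:R))); last first.
    by rewrite (ler_wpM2l Bt).
  rewrite mulr_sumr.
  apply: (@ler_sum_ord_sub _ _ (fun p => prime p && (t * ln (p%:R : R) <= 1 / 2)) prime (fun p => f p / p%:R)
    (fun p => B * t / 2 * (ln p%:R / p%:R))) => [p|p pN /andP[pp tp]].
    by rewrite mulr_ge0// divr_ge0// ln_nat_ge0.
  have p0 : 0 < p%:R :> R by rewrite ltr0n prime_gt0.
  split => //.
    rewrite ltnS truncn_ge_nat ?(le_trans ler01)// -(lnK p0) ler_expR.
    by rewrite ler_pdivlMr ?mulr_gt0//; lra.
  rewrite mulrA ler_wpM2r ?invr_ge0 ?(ltW p0)//.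
  apply: (le_trans (hB _ pp tp)); have := ln_nat_ge0 p; move: (ln _) tp => l tp l0.
  have : t * l * l <= 1 / 2 * l by rewrite ler_wpM2r.
  have : 0 <= B * t by rewrite mulr_ge0// ltW.
  nra.
(* The maximum with 3/2, which lies below every prime, keeps [y > 1] when t is large. *)
pose y : R := Num.max (expR (1 / (2 * t))) (3 / 2).
have y1 : 1 < y by rewrite lt_max; apply/orP; right; lra.
have T0 : 0 <= t * ln N%:R by rewrite mulr_ge0// ltW.
have [yN|yN] := leP y N%:R; last first.
  rewrite big1 => [|p /andP[pp]].
    by rewrite mulr_ge0// addr_ge0// mulr_ge0.
  rewrite -ltNge => h; exfalso.
  have p0 : 0 < (p : nat)%:R :> R by rewrite ltr0n prime_gt0.
  have : (p : nat)%:R < N%:R :> R by rewrite ltr_nat.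
  apply/negP; rewrite -leNgt; apply: (le_trans (ltW yN)).
  rewrite ge_max; apply/andP; split.
    by rewrite -(lnK p0) ler_expR ler_pdivrMr ?mulr_gt0//; lra.
  have : 2%:R <= (p : nat)%:R :> R by rewrite ler_nat prime_gt1.
  lra.
(* 28 = 4 + 8 * 3: since 3 t ln y >= 1, the quotient of logarithms is at most 1 + 3 t ln N, and
   pulling the 3 out of the logarithm costs at most 3. *)
apply: (@le_trans _ _ (A * (4 + 8 * ln (ln N%:R / ln y)))); last first.
  rewrite ler_wpM2l//; have := ln_lin_le (_ : 1 <= 3) T0.
  have ly : 0 < ln y by rewrite ln_gt0.
  have : ln (ln N%:R / ln y) <= ln (1 + 3 * (t * ln N%:R)); last by move=> h /(_ _); lra.
  have lN0 : 0 < ln N%:R :> R by rewrite ln_gt0// ltr1n.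
  rewrite ler_ln ?posrE ?divr_gt0//; last by apply: ltr_wpDr => //; rewrite mulr_ge0.
  apply: (@le_trans _ _ (3 * (t * ln N%:R))); last by lra.
  rewrite ler_pdivrMr//.
  have h1 : 1 / (2 * t) <= ln y.
    by rewrite -ler_expR lnK ?posrE ?(lt_trans ltr01)// le_max lexx.
  have {}h1 : 1 <= 3 * t * ln y.
    rewrite ler_pdivrMr ?mulr_gt0// in h1; have : 0 <= t * ln y by rewrite mulr_ge0// ltW.
    lra.
  have : 0 <= ln N%:R * (3 * t * ln y - 1) :> R by rewrite mulr_ge0// subr_ge0.
  lra.
apply: (@le_trans _ _ (A * (\sum_(p < N | prime p && (y < p%:R <= N%:R)) (p%:R)^-1))); last first.
  by apply: ler_wpM2l => //; exact: sum_primeV_le.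
rewrite mulr_sumr.
apply: (@ler_sum_ord_sub _ _ (fun p => prime p && ~~ (t * ln (p%:R : R) <= 1 / 2))
  (fun p => prime p && (y < p%:R <= N%:R)) (fun p => f p / p%:R)
    (fun p => A * (p%:R)^-1)) => [p|p pN /andP[pp]].
  by rewrite divr_ge0.
rewrite -ltNge => tp.
have p0 : 0 < p%:R :> R by rewrite ltr0n prime_gt0.
split => //; last by rewrite ler_wpM2r ?invr_ge0 ?(ltW p0)// hA.
rewrite pp/= ler_nat (ltnW pN) andbT gt_max; apply/andP; split.
  by rewrite -(lnK p0) ltr_expR ltr_pdivrMr ?mulr_gt0//; lra.
have : 2%:R <= p%:R :> R by rewrite ler_nat prime_gt1.
lra.
Qed.

End PrimeSums.

(** * Euler products and convolutions *)

Section Multiplicative.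

Lemma big_divisors (V : nmodType) (F : nat -> V) N m : (0 < m < N)%N ->
  \sum_(d <- divisors m) F d = \sum_(d < N | (d %| m)%N) F d.
Proof.
case/andP=> m0 mN.
rewrite -(big_mkord (fun d => (d %| m)%N) F) -[RHS]big_filter.
apply: perm_big; apply: uniq_perm; rewrite ?filter_uniq ?iota_uniq ?divisors_uniq//.
move=> d; rewrite -dvdn_divisors// mem_filter mem_index_iota leq0n/=.
by case: (boolP (d %| m)%N) => //= /dvdn_leq -/(_ m0) /leq_ltn_trans ->.
Qed.

Lemma prod_logn N n : (0 < n < N)%N -> (\prod_(p < N | prime p) p ^ logn p n)%N = n.
Proof.
case/andP=> n0 nN.
rewrite -[RHS](partnT n0) /partn big_mkord.
rewrite (big_ord_widen_cond N predT (fun p => p ^ logn p n)%N)//.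
rewrite big_mkcond [RHS]big_mkcond/=; apply: eq_bigr => p _.
case: ifP => [pp|/negbT pp]; case: ifP => //; last by rewrite lognE (negPf pp).
by move=> /negbT; rewrite -leqNgt => np; rewrite lognE pp n0/= gtnNdvd.
Qed.

Lemma logn_prod_pow N (e : nat -> nat) (q : 'I_N) : prime q ->
  logn q (\prod_(p < N | prime p) p ^ e p)%N = e q.
Proof.
move=> pq.
have -> : logn q (\prod_(p < N | prime p) p ^ e p)%N = (\sum_(p < N | prime p) logn q (p ^ e p))%N.
  pose K a b := logn q a = b /\ (0 < a)%N.
  suff [] : K (\prod_(p < N | prime p) p ^ e p)%N (\sum_(p < N | prime p) logn q (p ^ e p))%N by [].
  apply: (big_rec2 K) => [|p a b pp [ab a0]]; first by rewrite /K logn1.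
  have pe0 : (0 < p ^ e p)%N by rewrite expn_gt0 prime_gt0.
  by rewrite /K lognM// ab muln_gt0 a0 pe0.
rewrite (bigD1 q)//= lognX logn_prime// eqxx muln1 big1 ?addn0// => p /andP[pp pq'].
by rewrite lognX logn_prime// eq_sym (_ : (p == q :> nat) = false) ?muln0//; apply/negbTE.
Qed.

Variable N : nat.

(** Exponent vectors form a finite function type, so that a product of sums over primes can be
    expanded over them. For 0 < n < N each exponent is below N, so the default of [insub] never
    occurs; non-primes carry exponent 0. *)
Definition exponents (n : nat) : {ffun 'I_N -> 'I_N} :=
  [ffun p : 'I_N => odflt p (insub (if prime p then logn p n else 0%N))].

Lemma exponentsE n (p : 'I_N) : (0 < n < N)%N ->
  exponents n p = (if prime p then logn p n else 0%N) :> nat.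
Proof.
case/andP=> n0 nN; rewrite ffunE insubT//=.
by case: ifP => _; [rewrite (leq_ltn_trans (ltnW (ltn_logl _ n0)))|rewrite (leq_ltn_trans _ nN)].
Qed.

Lemma exponents_inj : {in [pred n | (0 < n < N)%N] &, injective exponents}.
Proof.
move=> m n mN nN e; rewrite -(prod_logn mN) -(prod_logn nN).
apply: eq_bigr => p pp; congr (_ ^ _)%N.
by have := congr1 (fun f : {ffun _ -> _} => nat_of_ord (f p)) e; rewrite !exponentsE// pp.
Qed.

End Multiplicative.

Section EulerProduct.
Variable R : realType.

(** By distributivity the right side is a sum over all exponent vectors. Those of integers below N
    are distinct, and the others contribute nonnegative terms. *)
Lemma euler_product_le N (G : nat -> nat -> R) : (forall p v, 0 <= G p v) ->
  \sum_(n < N | (0 < n)%N) \prod_(p < N | prime p) G p (logn p n)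
  <= \prod_(p < N | prime p) \sum_(v < N) G p v.
Proof.
move=> G0; case: N => [|N]; first by rewrite !big_ord0.
(* A non-prime index gets the indicator of exponent 0, so that its sum is the factor 1. *)
pose F (p v : 'I_N.+1) := if prime p then G p v else (v == ord0)%:R.
have F0 p v : 0 <= F p v by rewrite /F; case: ifP.
have -> : \prod_(p < N.+1 | prime p) \sum_(v < N.+1) G p v = \prod_(p < N.+1) \sum_(v < N.+1) F p v.
  rewrite big_mkcond/=; apply: eq_bigr => p _; rewrite /F; case: ifP => // _.
  by rewrite (bigD1 ord0)//= big1 ?addr0// => v /negPf ->.
rewrite bigA_distr_bigA/=.
have -> : \sum_(n < N.+1 | (0 < n)%N) \prod_(p < N.+1 | prime p) G p (logn p n) =
    \sum_(n < N.+1 | (0 < n)%N) \prod_(p < N.+1) F p (exponents N.+1 n p).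
  apply: eq_bigr => n n0; rewrite big_mkcond/=; apply: eq_bigr => p _.
  have nN : (0 < n < N.+1)%N by rewrite n0 ltn_ord.
  have := exponentsE p nN; rewrite /F; case: ifP => [_ ->//|_ e].
  by rewrite (_ : exponents N.+1 n p == ord0)//; apply/eqP/val_inj.
rewrite -(big_imset (h := fun n : 'I_N.+1 => exponents N.+1 n) (fun f => \prod_p F p (f p)))/=; last first.
  by move=> m n m0 n0 /exponents_inj e; apply: val_inj; apply: e; rewrite inE ltn_ord andbT; [exact: m0|exact: n0].
rewrite big_mkcond/=; apply: ler_sum => f _; case: ifP => // _; exact: prodr_ge0.
Qed.

(** The summand is not multiplicative, since each block contributes a main product plus an error
    product. Expanding over the choices [f] of one of the two in every block gives multiplicative
    functions, each bounded by its Euler product; the same expansion read backwards is the right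
    side. *)
Lemma block_euler_product_le N (O : finType) (blk : nat -> O) (A : O -> bool -> R)
    (G : O -> bool -> nat -> nat -> R) :
  (forall o b, 0 <= A o b) -> (forall o b p v, 0 <= G o b p v) ->
  \sum_(n < N | (0 < n)%N) \prod_(o : O) \sum_(b : bool)
     A o b * \prod_(p < N | prime p && (blk p == o)) G o b p (logn p n)
  <= \prod_(o : O) \sum_(b : bool)
     A o b * \prod_(p < N | prime p && (blk p == o)) \sum_(v < N) G o b p v.
Proof.
move=> A0 G0; rewrite bigA_distr_bigA/=.
under eq_bigr do rewrite bigA_distr_bigA/=.
rewrite exchange_big/=; apply: ler_sum => f _.
under eq_bigr do rewrite big_split/=.
rewrite big_split/= -mulr_sumr ler_wpM2l ?prodr_ge0//.
pose H p v := G (blk p) (f (blk p)) p v.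
have e (K : O -> nat -> R) :
    \prod_o \prod_(p < N | prime p && (blk p == o)) K o p =
    \prod_(p < N | prime p) K (blk p) p.
  rewrite [RHS](partition_big (fun p : 'I_N => blk p) xpredT)//=.
  by apply: eq_bigr => o _; apply: eq_bigr => p /andP[_ /eqP ->].
rewrite (e (fun o p => \sum_(v < N) G o (f o) p v)).
under eq_bigr => n _ do rewrite (e (fun o p => G o (f o) p (logn p n))).
apply: (@euler_product_le N H) => p v; exact: G0.
Qed.

End EulerProduct.

Section DivisorSums.
Variable A : comNzRingType.

(** Divisors of m are the exponent vectors bounded by that of m. As [phi] is arbitrary, it may
    depend on m itself, which covers summands involving the cofactor m / d. *)
Lemma divisor_sum_prod N m (phi : nat -> nat -> A) : (0 < m < N)%N ->
  \sum_(d <- divisors m) \prod_(p < N | prime p) phi p (logn p d) =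
  \prod_(p < N | prime p) \sum_(v < (logn p m).+1) phi p v.
Proof.
move=> mN; rewrite (big_divisors _ mN); case: N mN => [|N]; first by rewrite ltn0 andbF.
move=> mN; have [m0 mlN] := andP mN.
pose F (p v : 'I_N.+1) : A := if prime p then phi p v else 1.
pose Q (p v : 'I_N.+1) := (v <= (if prime p then logn p m else 0))%N.
have -> : \prod_(p < N.+1 | prime p) \sum_(v < (logn p m).+1) phi p v =
    \prod_(p < N.+1) \sum_(v < N.+1 | Q p v) F p v.
  rewrite big_mkcond/=; apply: eq_bigr => p _; rewrite /F /Q; case: ifP => pp.
    have lN : ((logn p m).+1 <= N.+1)%N by rewrite (leq_trans _ mlN)// ltnS ltnW// ltn_logl.
    by rewrite (big_ord_widen _ (phi p) lN); apply: eq_bigl => v; rewrite ltnS.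
  by rewrite (bigD1 ord0)//= big1 ?addr0// => v; rewrite leqn0 => /andP[/eqP h /negP[]]; apply/eqP/val_inj.
rewrite bigA_distr_big_dep/=.
pose h (d : 'I_N.+1) := exponents N.+1 d.
(* [g] multiplies a vector back to an integer; it inverts [h] on the vectors bounded by that of
   m. *)
pose g (f : {ffun 'I_N.+1 -> 'I_N.+1}) : 'I_N.+1 := inord (\prod_(p < N.+1 | prime p) p ^ f p)%N.
have dvE (d : nat) : (d %| m)%N -> (0 < d < N.+1)%N.
  by move=> dm; rewrite (dvdn_gt0 m0 dm)/= (leq_ltn_trans (dvdn_leq m0 dm)).
rewrite (reindex_onto g h)/=; last first.
  move=> d dm; have dN := dvE _ dm; apply: val_inj => /=.
  have e : (\prod_(p < N.+1 | prime p) p ^ h d p = d)%N.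
    rewrite -[RHS](prod_logn dN); apply: eq_bigr => p pp.
    by rewrite exponentsE// pp.
  by rewrite /g e inord_val.
apply: eq_big => [f|f /andP[fm /eqP hg]].
- apply/andP/familyP => [[fm /eqP hg] p|fQ].
    rewrite -hg /Q unfold_in/= exponentsE ?dvE//; case: ifP => // pp.
    by apply: dvdn_leq_log.
  have gE : val (g f) = (\prod_(p < N.+1 | prime p) p ^ f p)%N.
    rewrite /g/= inordK// (leq_ltn_trans _ mlN)// dvdn_leq//.
    rewrite -[X in (_ %| X)%N](prod_logn mN); elim/big_rec2: _ => // p x y pp; apply: dvdn_mul.
    by rewrite dvdn_exp2l//; have := fQ p; rewrite unfold_in/= pp.
  have gm : (g f %| m)%N.
    rewrite gE -[X in (_ %| X)%N](prod_logn mN); elim/big_rec2: _ => // p x y pp; apply: dvdn_mul.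
    by rewrite dvdn_exp2l//; have := fQ p; rewrite unfold_in/= pp.
  split => //; apply/eqP/ffunP => p; apply: val_inj; rewrite /h/= exponentsE ?dvE//.
  case: ifP => [pp|pp]; last by have := fQ p; rewrite unfold_in/= pp leqn0 => /eqP ->.
  pose ee (q : nat) := oapp (fun r : 'I_N.+1 => nat_of_ord (f r)) 0%N (insub q).
  have eeE (r : 'I_N.+1) : ee r = f r by rewrite /ee valK.
  rewrite gE -(eeE p) -(logn_prod_pow ee pp); congr (logn _ _).
  by apply: eq_bigr => q _; rewrite eeE.
- rewrite big_mkcond/=; apply: eq_bigr => p _; rewrite /F; case: ifP => // pp.
  by congr (phi _ _); rewrite -[in RHS]hg exponentsE ?dvE// pp.
Qed.

End DivisorSums.

(** * Dirichlet convolution with functions supported on disjoint sets of primes *)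

Section Convolution.
Variable A : comNzRingType.
Implicit Types (f g : nat -> A) (xs : nat -> nat -> A).

Definition conv f g n := \sum_(d <- divisors n) f d * g (n %/ d)%N.

Fixpoint iconv xs g k := if k is k'.+1 then conv (xs k') (iconv xs g k') else g.

Lemma conv_part f g n (pi : nat_pred) : (0 < n)%N ->
  (forall a, f a != 0 -> pi.-nat a) ->
  conv f g n = \sum_(d <- divisors n`_pi) f d * g (n %/ d)%N.
Proof.
move=> n0 fpi; have h1 : (0 < n < n.+1)%N by rewrite n0/=.
have h2 : (0 < n`_pi < n.+1)%N by rewrite part_gt0 ltnS dvdn_leq ?dvdn_part.
rewrite /conv (big_divisors _ h1) (big_divisors _ h2).
rewrite big_mkcond [RHS]big_mkcond/=; apply: eq_bigr => d _.
have [->|fd] := eqVneq (f d) 0; first by rewrite !mul0r !if_same.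
have dpi := fpi _ fd.
case: (boolP (d %| n`_pi)%N) => [dn|dn].
  by rewrite (dvdn_trans dn) ?dvdn_part.
case: ifP => // dn'; case/negP: dn.
by rewrite -(part_pnat_id dpi) partn_dvd.
Qed.

Variables (pi : nat -> nat_pred).
Definition outside k : nat_pred := [pred p | all (fun i => p \notin pi i) (iota 0 k)].
Hypothesis pi_disj : forall i j p, p \in pi i -> p \in pi j -> i = j.

Lemma outsideP k p : reflect (forall i, (i < k)%N -> p \notin pi i) (p \in outside k).
Proof.
apply: (iffP allP) => h i; first by move=> ik; apply: h; rewrite mem_iota.
by rewrite mem_iota => /andP[_ ik]; exact: h.
Qed.

(** A divisor taken from the part of n in block k leaves the parts of n in the other blocks
    unchanged. Hence each convolution acts on its own part only, and that part splits off the value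
    of [g] on the primes not yet treated by multiplicativity. *)
Lemma iconv_blocks xs g k n : (0 < n)%N ->
  (forall i a, xs i a != 0 -> (pi i).-nat a) ->
  (forall a b, (0 < a)%N -> (0 < b)%N -> g (a * b)%N = g a * g b) ->
  iconv xs g k n =
  (\prod_(i < k) conv (xs i) g (n`_(pi i))%N) * g (n`_(outside k))%N.
Proof.
move=> n0 xpi gM; elim: k n n0 => [|k IH] n n0.
  by rewrite big_ord0 mul1r /= -{1}(partnT n0); congr g; apply: eq_partn => p.
rewrite /= (conv_part _ n0 (xpi k)) big_ord_recr/=.
have piS : outside k.+1 =i [predI outside k & negn (pi k)].
  move=> p; rewrite [RHS]inE/=; apply/idP/andP.
    move/outsideP => h; split; last by exact: h.
    by apply/outsideP => i ik; apply: h; rewrite ltnS ltnW.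
  case=> /outsideP h1 h2; apply/outsideP => i; rewrite ltnS leq_eqVlt => /predU1P[->//|]; exact: h1.
have pik_out p : p \in pi k -> p \in outside k.
  by move=> pk; apply/outsideP => i ik; apply/negP => /(pi_disj pk) ki; rewrite ki ltnn in ik.
transitivity (\sum_(d <- divisors n`_(pi k)) (xs k d * g (n`_(pi k) %/ d)%N) *
   ((\prod_(i < k) conv (xs i) g (n`_(pi i))%N) * g (n`_(outside k.+1))%N)); last first.
  by rewrite -mulr_suml -/(conv _ _ _) mulrCA mulrA mulrAC.
rewrite big_seq [RHS]big_seq; apply: eq_bigr => d; rewrite -dvdn_divisors ?part_gt0// => dn.
have d0 : (0 < d)%N := dvdn_gt0 (part_gt0 _ _) dn.
have dpi : (pi k).-nat d by apply: pnat_dvd dn _; exact: part_pnat.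
have dn' : (d %| n)%N := dvdn_trans dn (dvdn_part _ _).
set b := (n %/ d)%N; have nE : n = (d * b)%N by rewrite mulnC divnK.
have b0 : (0 < b)%N by rewrite divn_gt0// dvdn_leq.
rewrite IH// -mulrA; congr (_ * _).
have e1 i : (i < k)%N -> (b`_(pi i) = n`_(pi i))%N.
  move=> ik; rewrite nE partnM// (@part_p'nat (pi i) d) ?mul1n//.
  apply: sub_in_pnat dpi => p _ pk; rewrite inE/=; apply/negP => /(pi_disj pk) ki.
  by rewrite ki ltnn in ik.
have e2 : (b`_(outside k.+1) = n`_(outside k.+1))%N.
  rewrite nE partnM// (@part_p'nat (outside k.+1) d) ?mul1n//.
  apply: sub_in_pnat dpi => p _ pk; rewrite inE/=; apply/negP => /outsideP /(_ k (ltnSn _)).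
  by rewrite pk.
have e3 : (b`_(pi k) = n`_(pi k) %/ d)%N.
  by rewrite [in RHS]nE partnM// (part_pnat_id dpi) mulKn.
have -> : \prod_(i < k) conv (xs i) g (b`_(pi i))%N = \prod_(i < k) conv (xs i) g (n`_(pi i))%N.
  by apply: eq_bigr => i _; rewrite e1.
have -> : g (b`_(outside k))%N = g (n`_(pi k) %/ d)%N * g (n`_(outside k.+1))%N.
  rewrite -e2 -e3 -gM ?part_gt0//; congr g.
  rewrite -{1}(partnC (pi k) (part_gt0 (outside k) b)); congr (_ * _)%N.
    by rewrite partn_part.
  by rewrite -partnI; apply: eq_partn => p; rewrite piS !inE andbC.
by rewrite mulrCA.
Qed.

Lemma logn_nonprime p n : ~~ prime p -> logn p n = 0%N.
Proof. by move=> /negPf np; rewrite lognE np. Qed.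

Lemma logn_partn0 p (rho : nat_pred) n : p \notin rho -> logn p (n`_rho)%N = 0%N.
Proof.
move=> prho; have [pp|np] := boolP (prime p); last exact: logn_nonprime.
apply/eqP; rewrite -leqn0 leqNgt logn_gt0 mem_primes pp part_gt0/=; apply/negP => /pnat_dvd h.
by move: (h _ (part_pnat rho n)); rewrite pnatE// (negPf prho).
Qed.

Lemma logn_partn p (rho : nat_pred) n : (0 < n)%N -> p \in rho -> logn p (n`_rho)%N = logn p n.
Proof.
move=> n0 prho; rewrite -{2}(partnC rho n0) lognM ?part_gt0//.
by rewrite (@logn_partn0 p (negn rho)) ?addn0// inE/= prho.
Qed.

End Convolution.

Section ArithmeticFunctions.
Variable R : realType.
Implicit Types (z : R[i]).

Lemma big_primes (V : Type) (idx : V) (op : Monoid.com_law idx) (F : nat -> V) N n :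
  (0 < n < N)%N -> (forall p, logn p n = 0%N -> F p = idx) ->
  \big[op/idx]_(p <- primes n) F p = \big[op/idx]_(p < N | prime p) F p.
Proof.
case/andP=> n0 nN F0; rewrite -(big_mkord prime F) -[RHS]big_filter.
have -> : \big[op/idx]_(p <- [seq p <- index_iota 0 N | prime p]) F p =
   \big[op/idx]_(p <- [seq p <- index_iota 0 N | prime p] | p \in primes n) F p.
  rewrite [RHS]big_mkcond/= big_seq [RHS]big_seq; apply: eq_bigr => p; rewrite mem_filter => /andP[pp _].
  case: ifP => // /negbT; rewrite -logn_gt0 -eqn0Ngt => /eqP; exact: F0.
rewrite -[RHS]big_filter; apply: perm_big; apply: uniq_perm; rewrite ?primes_uniq ?filter_uniq ?iota_uniq//.
move=> p; rewrite !mem_filter mem_index_iota/= mem_primes.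
case: (boolP (prime p)) => //= pp; rewrite n0/=; case: (boolP (p %| n)%N) => //= /dvdn_leq -/(_ n0) pn.
by rewrite (leq_ltn_trans pn).
Qed.

Lemma nu_prod N n : (0 < n < N)%N ->
  nu R n = \prod_(p < N | prime p) ((logn p n)`!%:R)^-1.
Proof.
move=> nN; rewrite /nu (@big_primes _ _ _ (fun p => ((logn p n)`!%:R)^-1) N)//.
by move=> p ->; rewrite fact0 invr1.
Qed.

Lemma big_Omega_sum N n : (0 < n < N)%N ->
  big_Omega n = (\sum_(p < N | prime p) logn p n)%N.
Proof. by move=> nN; rewrite /big_Omega (@big_primes _ _ _ (fun p => logn p n) N). Qed.

Lemma exp_big_Omega (x : R) N n : (0 < n < N)%N ->
  x ^+ big_Omega n = \prod_(p < N | prime p) x ^+ logn p n.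
Proof. by move=> nN; rewrite (big_Omega_sum nN) -prodrXr. Qed.

Lemma natr_prod_logn N n : (0 < n < N)%N ->
  n%:R = \prod_(p < N | prime p) (p : nat)%:R ^+ logn p n :> R.
Proof.
move=> nN; rewrite -[in LHS](prod_logn nN) natr_prod; apply: eq_bigr => p _.
by rewrite natrX.
Qed.

Lemma dirichlet_powerM z a b : (0 < a)%N -> (0 < b)%N ->
  dirichlet_power z (a * b) = dirichlet_power z a * dirichlet_power z b.
Proof.
move=> a0 b0; rewrite /dirichlet_power natrM lnM ?posrE ?ltr0n// rmorphD/= -cexpD.
by congr cexp; ring.
Qed.

Lemma dirichlet_power1 z : dirichlet_power z 1 = 1.
Proof. by rewrite /dirichlet_power ln1 mulr0 cexp0. Qed.

Lemma dirichlet_powerX z a v : (0 < a)%N ->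
  dirichlet_power z (a ^ v) = dirichlet_power z a ^+ v.
Proof.
move=> a0; elim: v => [|v IH]; first by rewrite expn0 dirichlet_power1.
by rewrite expnS dirichlet_powerM ?expn_gt0 ?a0// IH exprS.
Qed.

Lemma dirichlet_power_prod z N n : (0 < n < N)%N ->
  dirichlet_power z n = \prod_(p < N | prime p) dirichlet_power z p ^+ logn p n.
Proof.
move=> nN; rewrite -[in LHS](prod_logn nN).
pose K (a : nat) (b : R[i]) := (0 < a)%N /\ dirichlet_power z a = b.
suff [] : K (\prod_(p < N | prime p) p ^ logn p n)%N
  (\prod_(p < N | prime p) dirichlet_power z p ^+ logn p n) by [].
apply: (big_rec2 K) => [|p b a pp [a0 ab]]; first by split; rewrite ?dirichlet_power1.
have p0 : (0 < p ^ logn p n)%N by rewrite expn_gt0 prime_gt0.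
by split; rewrite ?muln_gt0 ?p0// dirichlet_powerM// ab dirichlet_powerX// prime_gt0.
Qed.

Lemma normc_dirichlet_power z n :
  normc (dirichlet_power z n) = expR (- complex.Re z * ln n%:R).
Proof.
by rewrite /dirichlet_power normc_cexp; case: z => a b /=; congr expR; ring.
Qed.

Lemma sum_invpow_le (p N k : nat) : (1 < p)%N ->
  \sum_(v < N | (k <= v)%N) ((p%:R : R) ^+ v)^-1 <= 2 / p%:R ^+ k.
Proof.
move=> p1; set x : R := p%:R^-1.
have p0 : 0 < p%:R :> R by rewrite ltr0n ltnW.
have x0 : 0 < x by rewrite invr_gt0.
have x2 : x <= 1 / 2.
  rewrite /x -[X in _ <= X]invf_div divr1 lef_pV2 ?posrE//.
  by rewrite -[leLHS]/(2%:R) ler_nat.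
have -> : \sum_(v < N | (k <= v)%N) ((p%:R : R) ^+ v)^-1 = \sum_(v < N | (k <= v)%N) x ^+ v.
  by apply: eq_bigr => v _; rewrite exprVn.
rewrite -[X in _ <= 2 * X]exprVn -/x.
(* The induction carries the missing tail along; [maxn] makes the bound 0 while N <= k and the sum
   is empty. *)
suff : \sum_(v < N | (k <= v)%N) x ^+ v <= 2 * x ^+ k - 2 * x ^+ maxn N k.
  have : 0 <= x ^+ maxn N k by rewrite exprn_ge0// ltW.
  lra.
elim: N => [|N IH]; first by rewrite big_ord0 max0n; lra.
rewrite big_mkcond big_ord_recr/= -big_mkcond/=.
case: leqP => kN.
  rewrite (maxn_idPl (leqW kN)) (maxn_idPl kN) in IH *.
  have : 0 <= x ^+ N by rewrite exprn_ge0// ltW.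
  rewrite exprS; nra.
by rewrite addr0 (maxn_idPr kN); rewrite (maxn_idPr (ltnW kN)) in IH.
Qed.

Lemma prod1D_le_expR (I : Type) (r : seq I) (P : pred I) (F : I -> R) :
  (forall i, P i -> 0 <= F i) ->
  \prod_(i <- r | P i) (1 + F i) <= expR (\sum_(i <- r | P i) F i).
Proof.
move=> F0; rewrite expR_sum; apply: ler_prod => i Pi.
by rewrite expR_ge1Dx addr_ge0// F0.
Qed.

Lemma sum_inv_sqr_le N : \sum_(n < N | (0 < n)%N) ((n%:R : R) ^+ 2)^-1 <= 2.
Proof.
(* Telescopes through 1 / (m + 2)^2 <= 1 / (m + 1) - 1 / (m + 2). *)
suff h m : \sum_(n < m.+2 | (0 < n)%N) ((n%:R : R) ^+ 2)^-1 <= 2 - m.+1%:R^-1.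
  case: N => [|[|N]]; first by rewrite big_ord0.
    by rewrite big1// => -[[]].
  by apply: (le_trans (h N)); rewrite gerBl invr_ge0.
elim: m => [|m IH].
  by rewrite big_mkcond !big_ord_recr big_ord0/= add0r add0r expr1n invr1; lra.
rewrite big_mkcond big_ord_recr/= -big_mkcond/=.
have x0 : 0 < m.+1%:R :> R by rewrite ltr0n.
suff h : (m.+2%:R ^+ 2)^-1 <= m.+1%:R^-1 - m.+2%:R^-1 :> R.
  by apply: (le_trans (lerD IH (lexx _))); move: h; move: (m.+2%:R ^- 2) (m.+1%:R^-1) (m.+2%:R^-1) => a b c; lra.
rewrite -(@natr1 _ m.+1); move: (m.+1%:R) x0 => x x0.
have -> : x^-1 - (x + 1)^-1 = (x * (x + 1))^-1 by field; apply/andP; split; lra.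
by rewrite lef_pV2 ?posrE ?exprn_gt0 ?mulr_gt0//; nra.
Qed.

Lemma sum_invfact_le (t : R) n : 0 <= t ->
  \sum_(i < n) t ^+ i / i`!%:R <= expR t.
Proof.
move=> t0.
have h : \sum_(i < n) t ^+ i / i`!%:R = series (exp_coeff t) n.
  by rewrite /series/= big_mkord.
rewrite h; apply: nondecreasing_cvgn_le; last exact: is_cvg_series_exp_coeff.
by apply: nondecreasing_series => k _ _; exact: exp_coeff_ge0.
Qed.

End ArithmeticFunctions.

(** * Mean squares of mollified Dirichlet powers *)

Section BlockEstimates.
Variable R : realType.
Variables (N : nat) (z : R[i]) (E : R).
Hypothesis E1 : 1 <= E.
Hypothesis powE : forall m, (0 < m < N)%N -> normc (dirichlet_power z m) <= E.
Variables (pi : nat -> nat_pred) (ell : nat -> nat).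
Hypothesis pi_disj : forall i j p, p \in pi i -> p \in pi j -> i = j.

(** The mollifier coefficient of one block without n^(-1/2) and without the character, so that it
    can be convolved with n^(-z). It vanishes at [a = 0], because 0 is not a [pi]-number. *)
Definition block_coef i a : R :=
  if (pi i).-nat a && (big_Omega a <= ell i)%N then liouville R a * nu R a else 0.

(** The coefficient of T^v in exp(- T) / (1 - p^(-z) T), that is, the value at p^v of the
    untruncated convolution of lambda nu with n^(-z). *)
Definition local_coef p v : R[i] :=
  \sum_(i < v.+1) ((-1) ^+ i / i`!%:R)%:C * dirichlet_power z p ^+ (v - i).

(** A majorant of the partial sums of exp(4), kept equal to 1 at v = 0 so that only primes dividing
    the argument count. *)
Let tau (v : nat) : R := if v == 0%N then 1 else expR 4.

Lemma conv_full m : (0 < m < N)%N ->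
  \sum_(d <- divisors m) (liouville R d * nu R d)%:C * dirichlet_power z (m %/ d)
  = \prod_(p < N | prime p) local_coef p (logn p m).
Proof.
move=> mN; have [m0 mlN] := andP mN.
rewrite -(divisor_sum_prod (fun p v => ((-1) ^+ v / v`!%:R)%:C * dirichlet_power z p ^+ (logn p m - v)) mN).
rewrite big_seq [RHS]big_seq; apply: eq_bigr => d; rewrite -dvdn_divisors// => dm.
have d0 := dvdn_gt0 m0 dm.
have dN : (0 < d < N)%N by rewrite d0 (leq_ltn_trans (dvdn_leq m0 dm)).
have mdN : (0 < m %/ d < N)%N by rewrite divn_gt0// dvdn_leq//= (leq_ltn_trans (leq_div _ _)).
rewrite big_split/= (dirichlet_power_prod z mdN); congr (_ * _); last first.
  by apply: eq_bigr => p _; rewrite logn_div.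
rewrite -rmorph_prod big_split/= /liouville (exp_big_Omega (-1) dN) (nu_prod R dN).
by [].
Qed.

Lemma tau_prod_ge0 m (P : pred nat) : 0 <= \prod_(p < N | P p) tau (logn p m).
Proof. by apply: prodr_ge0 => p _; rewrite /tau; case: ifP => // _; exact: expR_ge0. Qed.

Lemma conv_weight m : (0 < m < N)%N ->
  \sum_(d <- divisors m) 4 ^+ big_Omega d * nu R d
  <= \prod_(p < N | prime p) tau (logn p m).
Proof.
move=> mN; have [m0 mlN] := andP mN.
have -> : \sum_(d <- divisors m) 4 ^+ big_Omega d * nu R d =
  \sum_(d <- divisors m) \prod_(p < N | prime p) (4 ^+ logn p d / (logn p d)`!%:R).
  rewrite big_seq [RHS]big_seq; apply: eq_bigr => d; rewrite -dvdn_divisors// => dm.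
  have dN : (0 < d < N)%N by rewrite (dvdn_gt0 m0 dm) (leq_ltn_trans (dvdn_leq m0 dm)).
  by rewrite big_split/= (exp_big_Omega 4 dN) (nu_prod R dN).
rewrite (divisor_sum_prod (fun p v => 4 ^+ v / v`!%:R) mN).
apply: ler_prod => p _; apply/andP; split.
  by apply: sumr_ge0 => i _; rewrite divr_ge0// exprn_ge0.
rewrite /tau; case: eqP => [->|_]; last exact: sum_invfact_le.
by rewrite big_ord_recr big_ord0/= fact0 expr0 divr1 add0r.
Qed.

Lemma nu_ge0 n : 0 <= nu R n.
Proof. by rewrite /nu; apply: prodr_ge0 => p _; rewrite invr_ge0. Qed.

Lemma norm_liouville n : `|liouville R n| = 1.
Proof. by rewrite /liouville normrX normrN1 expr1n. Qed.

(** Rankin's trick: the divisors removed by the truncation have Omega(d) > l_i, so 1 <= 4^(Omega(d)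
    - l_i), and summing 4^Omega(d) nu(d) over all divisors of m gives at most the product of
    [tau]. *)
Lemma block_conv_approx i m : (0 < m < N)%N -> (pi i).-nat m ->
  normc (conv (fun a => (block_coef i a)%:C) (dirichlet_power z) m
         - \prod_(p < N | prime p) local_coef p (logn p m))
  <= E / 4 ^+ ell i * \prod_(p < N | prime p) tau (logn p m).
Proof.
move=> mN mpi; have [m0 mlN] := andP mN.
rewrite -conv_full// /conv -sumrB.
apply: (le_trans (normc_sum _ _ _)).
apply: (@le_trans _ _ (\sum_(d <- divisors m) (E / 4 ^+ ell i) * (4 ^+ big_Omega d * nu R d))); last first.
  rewrite -mulr_sumr ler_wpM2l ?conv_weight// divr_ge0 ?exprn_ge0//.
  by rewrite (le_trans ler01).
rewrite big_seq [leRHS]big_seq; apply: ler_sum => d; rewrite -dvdn_divisors// => dm.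
have d0 := dvdn_gt0 m0 dm.
have mdN : (0 < m %/ d < N)%N by rewrite divn_gt0// dvdn_leq//= (leq_ltn_trans (leq_div _ _)).
rewrite /block_coef (pnat_dvd dm mpi)/=.
have E0 : 0 <= E by rewrite (le_trans ler01).
case: leqP => dl.
  rewrite subrr normc0 mulr_ge0 ?divr_ge0 ?exprn_ge0 ?nu_ge0//.
  by rewrite mulr_ge0 ?exprn_ge0 ?nu_ge0.
rewrite mul0r sub0r normcN normcM normcR normrM norm_liouville mul1r (ger0_norm (nu_ge0 _)).
have h4 : 1 <= (4 ^+ ell i)^-1 * 4 ^+ big_Omega d :> R.
  by rewrite mulrC ler_pdivlMr ?exprn_gt0// mul1r ler_eXn2l ?ltr1n// ltnW.
have -> : E / 4 ^+ ell i * (4 ^+ big_Omega d * nu R d)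
  = (E * nu R d) * ((4 ^+ ell i)^-1 * 4 ^+ big_Omega d) by ring.
rewrite mulrC -[leLHS]mulr1; apply: ler_pM => //; rewrite ?mulr_ge0 ?normc_ge0 ?nu_ge0//.
by rewrite ler_wpM2r ?nu_ge0 ?powE.
Qed.

Lemma local_coef0 p : local_coef p 0 = 1.
Proof. by rewrite /local_coef big_ord_recr big_ord0/= expr0 fact0 divr1 mulr1 add0r. Qed.

Lemma local_coef1 p : local_coef p 1 = dirichlet_power z p - 1.
Proof.
rewrite /local_coef !big_ord_recr big_ord0/= expr0 !fact0 expr1 !divr1.
by rewrite fact_smonotone || rewrite !expr0 !expr1 add0r mul1r mulr1 rmorphN rmorph1.
Qed.

Lemma normc_local_coef_le p v : (0 < p)%N -> (p ^ v < N)%N ->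
  normc (local_coef p v) <= expR 1 * E.
Proof.
move=> p0 pvN; apply: (le_trans (normc_sum _ _ _)).
have E0 : 0 <= E by rewrite (le_trans ler01).
apply: (@le_trans _ _ (\sum_(i < v.+1) 1 ^+ i / i`!%:R * E)); last first.
  by rewrite -mulr_suml ler_wpM2r// sum_invfact_le.
apply: ler_sum => i _; rewrite normcM normcR normrM normrX normrN1 expr1n.
rewrite ger0_norm ?invr_ge0// ler_wpM2l ?mulr_ge0 ?invr_ge0//.
rewrite -dirichlet_powerX// powE// expn_gt0 p0/= (leq_ltn_trans _ pvN)//.
by rewrite leq_pexp2l// leq_subr.
Qed.

Lemma sum_split2_le (f : nat -> R) M : (forall v, 0 <= f v) ->
  \sum_(v < M) f v <= f 0%N + f 1%N + \sum_(v < M | (2 <= v)%N) f v.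
Proof.
move=> f0; rewrite (bigID (fun v : 'I_M => (2 <= v)%N))/= addrC lerD2r.
case: M => [|[|M]]; first by rewrite big_ord0 addr_ge0.
  by rewrite big_mkcond big_ord_recl big_ord0/= addr0 lerDl.
rewrite big_mkcond !big_ord_recl/= big1 => [|i _]; first by rewrite addr0.
by [].
Qed.

Lemma sum_split1_le (f : nat -> R) M : (forall v, 0 <= f v) ->
  \sum_(v < M) f v <= f 0%N + \sum_(v < M | (1 <= v)%N) f v.
Proof.
move=> f0; rewrite (bigID (fun v : 'I_M => (1 <= v)%N))/= addrC lerD2r.
case: M => [|M]; first by rewrite big_ord0.
rewrite big_mkcond !big_ord_recl/= big1 => [|i _]; first by rewrite addr0.
by [].
Qed.

(** Set to 0 from p^v >= N on, where [powE] gives no control of [local_coef]; no n < N has such an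
    exponent. *)
Let Kt p v : R := if (p ^ v < N)%N then normc (local_coef p v) else 0.
(** The excess of the local factor at p over 1: the first part is the term v = 1, the second bounds
    all v >= 2 trivially. *)
Let defect p : R := normc (dirichlet_power z p - 1) ^+ 2 / p%:R + 2 * (expR 1 * E) ^+ 2 / p%:R ^+ 2.

(** This is where the mollifier acts: the coefficient at v = 1 is p^(-z) - 1 instead of p^(-z), so
    the term of order 1 / p is small as long as p^(-z) is near 1. *)
Lemma sum_Kt_le p : prime p -> (p < N)%N ->
  \sum_(v < N) Kt p v ^+ 2 / p%:R ^+ v <= 1 + defect p.
Proof.
move=> pp pN; have p1 := prime_gt1 pp; have p0 := prime_gt0 pp.
apply: (le_trans (sum_split2_le (f := fun v => Kt p v ^+ 2 / p%:R ^+ v) N _)) => [v|].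
  by rewrite divr_ge0 ?exprn_ge0// /Kt; case: ifP => // _; exact: normc_ge0.
rewrite /Kt expn0 (ltn_trans p1 pN) expn1 pN local_coef0 local_coef1 normc1 expr1n divr1 expr1.
rewrite -addrA lerD2l lerD2l.
apply: (@le_trans _ _ (\sum_(v < N | (2 <= v)%N) (expR 1 * E) ^+ 2 * (p%:R ^+ v)^-1)).
  apply: ler_sum => v _; rewrite ler_wpM2r ?invr_ge0 ?exprn_ge0//.
  case: ifP => pv; last by rewrite expr0n/= sqr_ge0.
  by rewrite lerXn2r ?nnegrE ?normc_ge0 ?normc_local_coef_le// mulr_ge0 ?expR_ge0// (le_trans ler01).
rewrite -mulr_sumr -mulrA mulrCA ler_wpM2l ?sqr_ge0//.
exact: sum_invpow_le.
Qed.

Lemma sum_tau_le p : prime p ->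
  \sum_(v < N) tau v ^+ 2 / p%:R ^+ v <= 1 + 2 * expR 8 / p%:R.
Proof.
move=> pp; have p1 := prime_gt1 pp.
apply: (le_trans (sum_split1_le (f := fun v => tau v ^+ 2 / p%:R ^+ v) N _)) => [v|].
  by rewrite divr_ge0 ?sqr_ge0 ?exprn_ge0.
rewrite {1}/tau/= expr1n divr1 lerD2l.
apply: (@le_trans _ _ (\sum_(v < N | (1 <= v)%N) expR 8 * (p%:R ^+ v)^-1)).
  apply: ler_sum => -[[|v] ?]//= _; rewrite /tau/= -expRM_natl ler_wpM2r ?invr_ge0 ?exprn_ge0//.
  by rewrite ler_expR -natrM.
rewrite -mulr_sumr -mulrA mulrCA ler_wpM2l ?expR_ge0//.
by have := @sum_invpow_le R p N 1 p1; rewrite expr1.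
Qed.

Lemma sum_geom_le p : prime p ->
  \sum_(v < N) 1 / (p%:R : R) ^+ v <= 1 + 2 / p%:R.
Proof.
move=> pp; have p1 := prime_gt1 pp.
apply: (le_trans (sum_split1_le (f := fun v => 1 / p%:R ^+ v) N _)) => [v|].
  by rewrite divr_ge0 ?exprn_ge0.
rewrite expr0 divr1 lerD2l; under eq_bigr do rewrite mul1r.
by have := @sum_invpow_le R p N 1 p1; rewrite expr1.
Qed.

Variable k : nat.

(** [find] returns k when no block contains p, so the primes outside all blocks form a block of
    their own with index k. *)
Let idx (p : nat) : nat := find (fun i => p \in pi i) (iota 0 k).

Lemma idx_le p : (idx p <= k)%N.
Proof. by rewrite -[X in (_ <= X)%N](size_iota 0 k) find_size. Qed.

Lemma idx_eq p i : (i < k)%N -> (idx p == i) = (p \in pi i).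
Proof.
move=> ik; apply/eqP/idP => [e|pi_i].
  have h : has (fun i => p \in pi i) (iota 0 k) by rewrite has_find size_iota -/(idx p) e.
  by move: (nth_find 0 h); rewrite -/(idx p) e nth_iota.
have h : has (fun i => p \in pi i) (iota 0 k) by apply/hasP; exists i; rewrite ?mem_iota.
have := nth_find 0 h; rewrite -/(idx p) nth_iota ?add0n; last first.
  by rewrite -[X in (_ < X)%N](size_iota 0 k) -has_find.
by move/pi_disj; apply.
Qed.

Lemma idx_eq_out p : (idx p == k) = (p \in outside pi k).
Proof.
apply/eqP/outsideP => [e i ik|h].
  by rewrite -idx_eq// e neq_ltn ik orbT.
apply/eqP; rewrite eqn_leq idx_le leqNgt; apply/negP => lk.
by have := h _ lk; rewrite -idx_eq// eqxx.
Qed.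

(** The inequality (a + b)^2 <= (1 + 1/x) a^2 + (1 + x) b^2 with x = 4^(l_i): the error b carries
    1/x, so its term keeps a factor of order 1/x, while the main term loses only 1 + 1/x. A factor 2
    here would be multiplied over all blocks. *)
Lemma normc_block_conv_sq_le i n : (0 < n < N)%N -> (i < k)%N ->
  normc (conv (fun a => (block_coef i a)%:C) (dirichlet_power z) (n`_(pi i))%N) ^+ 2
  <= (1 + (4 ^+ ell i)^-1) * \prod_(p < N | prime p && (idx p == i)) Kt p (logn p n) ^+ 2
   + (1 + 4 ^+ ell i) * (E / 4 ^+ ell i) ^+ 2 * \prod_(p < N | prime p && (idx p == i)) tau (logn p n) ^+ 2.
Proof.
move=> nN ik; have [n0 nlN] := andP nN; set m := (n`_(pi i))%N.
have mN : (0 < m < N)%N by rewrite part_gt0 (leq_ltn_trans _ nlN)// dvdn_leq// dvdn_part.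
have prodE (f : nat -> nat -> R) : (forall p, f p 0 = 1) ->
    \prod_(p < N | prime p && (idx p == i)) f p (logn p n) = \prod_(p < N | prime p) f p (logn p m).
  move=> f1; rewrite big_mkcondr/=; apply: eq_bigr => p pp; rewrite idx_eq//.
  case: ifP => [h|/negbT h]; first by rewrite /m logn_partn.
  by rewrite /m (logn_partn0 _ h) f1.
have h := block_conv_approx mN (part_pnat (pi i) n).
set c := conv _ _ _ in h *; set P := \prod_(p < N | prime p) _ in h.
set T := \prod_(p < N | prime p) _ in h.
have eP : normc P ^+ 2 = \prod_(p < N | prime p && (idx p == i)) Kt p (logn p n) ^+ 2.
  rewrite /P normc_prod -prodrXl (prodE (fun p v => Kt p v ^+ 2)).
    apply: eq_bigr => p pp; rewrite /Kt ifT//.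
    have [m0 mlN] := andP mN; apply: leq_ltn_trans mlN; rewrite dvdn_leq//.
    exact: pfactor_dvdnn.
  move=> p; rewrite /Kt expn0 local_coef0 normc1.
  by rewrite ifT ?expr1n// (leq_ltn_trans n0).
have eT : T ^+ 2 = \prod_(p < N | prime p && (idx p == i)) tau (logn p n) ^+ 2.
  by rewrite /T -prodrXl (prodE (fun p v => tau v ^+ 2))// => p; rewrite /tau expr1n.
rewrite -eP -eT.
have hc : normc c <= normc P + E / 4 ^+ ell i * T.
  by have := le_normcD (c - P) P; rewrite subrK => h'; lra.
have e0 : 0 < 4 ^+ ell i :> R by rewrite exprn_gt0.
have T0 : 0 <= T by exact: tau_prod_ge0.
have E0 : 0 <= E by rewrite (le_trans ler01).
have : normc c ^+ 2 <= (normc P + E / 4 ^+ ell i * T) ^+ 2.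
  have Q0 : 0 <= E / 4 ^+ ell i * T by rewrite mulr_ge0// divr_ge0// ltW.
  by rewrite lerXn2r ?nnegrE ?addr_ge0 ?normc_ge0.
move/le_trans; apply.
have -> : (1 + 4 ^+ ell i) * (E / 4 ^+ ell i) ^+ 2 * T ^+ 2 = (1 + 4 ^+ ell i) * (E / 4 ^+ ell i * T) ^+ 2.
  by rewrite -mulrA -[in LHS]exprMn.
move: (4 ^+ ell i) e0 (E / _ * T) => x x0 b; move: (normc P) => a.
rewrite -subr_ge0.
have -> : (1 + x^-1) * a ^+ 2 + (1 + x) * b ^+ 2 - (a + b) ^+ 2 = x * (b - x^-1 * a) ^+ 2.
  by field; rewrite gt_eqF.
by rewrite mulr_ge0 ?sqr_ge0 ?ltW.
Qed.

(** [b = true] selects the main product of a block and [b = false] its truncation error. The extra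
    index k stands for the primes outside the blocks, which have no error term and where n^(-z) is
    bounded by E. *)
Let A (j : 'I_k.+1) (b : bool) : R :=
  if (j < k)%N then (if b then 1 + (4 ^+ ell j)^-1 else (1 + 4 ^+ ell j) * (E / 4 ^+ ell j) ^+ 2)
  else (if b then E ^+ 2 else 0).
Let G (j : 'I_k.+1) (b : bool) (p v : nat) : R :=
  (if (j < k)%N then (if b then Kt p v ^+ 2 else tau v ^+ 2) else 1) / p%:R ^+ v.
Let blk (p : nat) : 'I_k.+1 := inord (idx p).

Lemma blk_eq p (j : 'I_k.+1) : (blk p == j) = (idx p == j).
Proof. by rewrite -val_eqE/= inordK// ltnS idx_le. Qed.

Lemma iconv_sq_le n : (0 < n < N)%N ->
  normc (iconv (fun i a => (block_coef i a)%:C) (dirichlet_power z) k n) ^+ 2 / n%:R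
  <= \prod_(j < k.+1) \sum_(b : bool) A j b * \prod_(p < N | prime p && (blk p == j)) G j b p (logn p n).
Proof.
move=> nN; have [n0 nlN] := andP nN.
have xpi i a : (block_coef i a)%:C != 0 -> (pi i).-nat a.
  by rewrite /block_coef; case: ifP => [/andP[]//|]; rewrite eqxx.
rewrite (iconv_blocks pi_disj k n0 xpi (@dirichlet_powerM R z)) normcM normc_prod exprMn.
rewrite (natr_prod_logn R nN).
rewrite (partition_big (fun p : 'I_N => blk p) xpredT)//= -prodfV.
rewrite !big_ord_recr/= -prodrXl mulrACA -big_split/=.
have p0 (j : 'I_k.+1) : 0 <= (\prod_(p < N | prime p && (blk p == j)) (p : nat)%:R ^+ logn p n)^-1 :> R.
  by rewrite invr_ge0; apply: prodr_ge0 => p _; rewrite exprn_ge0.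
apply: ler_pM.
- by apply: prodr_ge0 => j _; rewrite mulr_ge0 ?sqr_ge0.
- by rewrite mulr_ge0 ?sqr_ge0.
- apply: ler_prod => j _; rewrite mulr_ge0 ?sqr_ge0//= big_bool/=.
  set w := widen_ord _ j.
  pose H (b : bool) p v : R := if b then Kt p v ^+ 2 else tau v ^+ 2.
  have GE b : \prod_(p < N | prime p && (blk p == w)) G w b p (logn p n) =
     \prod_(p < N | prime p && (idx p == j)) H b p (logn p n) *
     (\prod_(p < N | prime p && (blk p == w)) (p : nat)%:R ^+ logn p n)^-1.
    have Hb : \prod_(p < N | prime p && (idx p == j)) H b p (logn p n) =
       \prod_(p < N | prime p && (blk p == w)) H b p (logn p n).
      by apply: eq_bigl => p; rewrite blk_eq.
    by rewrite Hb -prodfV -big_split/=; apply: eq_bigr => p _; rewrite /G /= ltn_ord.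
  rewrite (GE true) (GE false) (mulrA (A w true)) (mulrA (A w false)) -mulrDl.
  apply: ler_wpM2r; first exact: p0.
  by apply: (le_trans (normc_block_conv_sq_le nN (ltn_ord j))); rewrite /A /= ltn_ord.
- rewrite big_bool/= /A /= ltnn mul0r addr0.
  have -> : \prod_(p < N | prime p && (blk p == ord_max)) G ord_max true p (logn p n) =
     (\prod_(p < N | prime p && (blk p == ord_max)) (p : nat)%:R ^+ logn p n)^-1.
    by rewrite -prodfV; apply: eq_bigr => p _; rewrite /G /= ltnn mul1r.
  apply: ler_wpM2r; first exact: p0.
  rewrite lerXn2r ?nnegrE ?normc_ge0 ?(le_trans ler01)// powE// part_gt0.
  by rewrite (leq_ltn_trans _ nlN)// dvdn_leq// dvdn_part.
Qed.

Lemma defect_ge0 p : 0 <= defect p.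
Proof. by rewrite addr_ge0// divr_ge0 ?sqr_ge0 ?exprn_ge0// mulr_ge0 ?sqr_ge0. Qed.

(** As exp(D), E^2 and the exponential V of the error sum are at least 1, both the 1/x of the main
    term and the 2 E^2 V / x of the error fit into exp(D) times 3 E^2 V / x. Then 1 + t <= exp(t)
    makes the bound fit for a product over blocks. *)
Lemma block_factor_le i : (i < k)%N ->
  forall S, S = \sum_(p < N | prime p && ((p : nat) \in pi i)) (p%:R : R)^-1 ->
  (1 + (4 ^+ ell i)^-1) * (\prod_(p < N | prime p && (idx p == i)) \sum_(v < N) Kt p v ^+ 2 / p%:R ^+ v)
   + (1 + 4 ^+ ell i) * (E / 4 ^+ ell i) ^+ 2 * (\prod_(p < N | prime p && (idx p == i)) \sum_(v < N) tau v ^+ 2 / p%:R ^+ v)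
  <= expR (\sum_(p < N | prime p && (idx p == i)) defect p)
     * expR (3 * E ^+ 2 / 4 ^+ ell i * expR (2 * expR 8 * S)).
Proof.
move=> ik S SE.
set X := \prod_(p < N | _) _; set Y := \prod_(p < N | _) _.
set D := \sum_(p < N | _) _; set x := 4 ^+ ell i.
have x1 : 1 <= x by rewrite exprn_ege1//; lra.
have XD : X <= expR D.
  apply: le_trans (@prod1D_le_expR R 'I_N _ _ (fun p : 'I_N => defect p) _) => [|p _]; last exact: defect_ge0.
  apply: ler_prod => p /andP[pp _]; rewrite sum_Kt_le ?ltn_ord// andbT.
  by apply: sumr_ge0 => v _; rewrite divr_ge0 ?sqr_ge0 ?exprn_ge0.
have YS : Y <= expR (2 * expR 8 * S).
  have -> : S = \sum_(p < N | prime p && (idx p == i)) (p%:R : R)^-1.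
    by rewrite SE; apply: eq_bigl => p; rewrite idx_eq.
  rewrite mulr_sumr.
  apply: le_trans (@prod1D_le_expR R 'I_N _ _ (fun p : 'I_N => 2 * expR 8 * (p%:R)^-1) _) => [|p _].
    apply: ler_prod => p /andP[pp _]; rewrite sum_tau_le// andbT.
    by apply: sumr_ge0 => v _; rewrite divr_ge0 ?sqr_ge0 ?exprn_ge0.
  by rewrite mulr_ge0 ?invr_ge0// mulr_ge0 ?expR_ge0.
have D1 : 1 <= expR D.
  by rewrite -expR0 ler_expR; apply: sumr_ge0 => p _; exact: defect_ge0.
have S1 : 1 <= expR (2 * expR 8 * S).
  rewrite SE -expR0 ler_expR mulr_ge0 ?mulr_ge0 ?expR_ge0//.
  by apply: sumr_ge0 => p _; rewrite invr_ge0.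
have Y0 : 0 <= Y.
  by apply: prodr_ge0 => p _; apply: sumr_ge0 => v _; rewrite divr_ge0 ?sqr_ge0 ?exprn_ge0.
set V := expR (2 * expR 8 * S) in YS S1 *.
apply: (@le_trans _ _ (expR D * (1 + 3 * E ^+ 2 / x * V))); last first.
  by rewrite ler_wpM2l ?expR_ge0// expR_ge1Dx.
have x0 : 0 < x by rewrite (lt_le_trans ltr01).
have xi0 : 0 < x^-1 by rewrite invr_gt0.
have xx : x * x^-1 = 1 by rewrite divff// gt_eqF.
have E2 : 1 <= E ^+ 2 by rewrite exprn_ege1.
have h1 : (1 + x^-1) * X <= (1 + x^-1) * expR D by rewrite ler_wpM2l// addr_ge0// ltW.
have h2 : (1 + x) * (E / x) ^+ 2 <= 2 * E ^+ 2 * x^-1.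
  rewrite exprMn; have -> : (1 + x) * (E ^+ 2 * x^-1 ^+ 2) = (E ^+ 2 * x^-1) * (x^-1 + x * x^-1) by ring.
  have -> : 2 * E ^+ 2 * x^-1 = (E ^+ 2 * x^-1) * (1 + 1) by ring.
  rewrite xx; apply: ler_wpM2l; first by rewrite mulr_ge0 ?sqr_ge0 ?(ltW xi0).
  by rewrite lerD2r invf_le1.
have h3 : (1 + x) * (E / x) ^+ 2 * Y <= 2 * E ^+ 2 * x^-1 * V.
  apply: ler_pM => //; rewrite mulr_ge0 ?sqr_ge0//; lra.
have h4 : 2 * E ^+ 2 * x^-1 * V <= 2 * E ^+ 2 * x^-1 * V * expR D.
  by rewrite ler_peMr// mulr_ge0 ?mulr_ge0 ?sqr_ge0 ?(ltW xi0)// (le_trans ler01).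
have h5 : x^-1 * expR D <= E ^+ 2 * x^-1 * V * expR D.
  apply: ler_wpM2r; first exact: expR_ge0.
  have -> : E ^+ 2 * x^-1 * V = (E ^+ 2 * V) * x^-1 by ring.
  rewrite -[leLHS]mul1r; apply: ler_wpM2r; first exact: ltW.
  by rewrite mulr_ege1.
apply: (le_trans (lerD h1 h3)).
apply: (le_trans (lerD (lexx _) h4)).
have -> : expR D * (1 + 3 * E ^+ 2 / x * V) = expR D + 2 * E ^+ 2 * x^-1 * V * expR D
   + E ^+ 2 * x^-1 * V * expR D by ring.
by rewrite mulrDl mul1r addrAC lerD2l.
Qed.

(** The three exponentials come from the primes outside the blocks, from the local defects, summed
    over all primes at once, and from the truncations of Omega. Only the last one remembers the
    individual blocks. *)
Theorem block_mean_square_le :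
  \sum_(n < N | (0 < n)%N)
     normc (iconv (fun i a => (block_coef i a)%:C) (dirichlet_power z) k n) ^+ 2 / n%:R
  <= E ^+ 2 * expR (2 * \sum_(p < N | prime p && ((p : nat) \in outside pi k)) (p%:R : R)^-1)
     * expR (\sum_(p < N | prime p) defect p)
     * expR (\sum_(i < k) 3 * E ^+ 2 / 4 ^+ ell i *
          expR (2 * expR 8 * \sum_(p < N | prime p && ((p : nat) \in pi i)) (p%:R : R)^-1)).
Proof.
apply: (@le_trans _ _ (\sum_(n < N | (0 < n)%N)
   \prod_(j < k.+1) \sum_(b : bool) A j b * \prod_(p < N | prime p && (blk p == j)) G j b p (logn p n))).
  by apply: ler_sum => n n0; apply: iconv_sq_le; rewrite n0 ltn_ord.
have A0 j b : 0 <= A j b.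
  rewrite /A; case: ifP => _; case: b => //; last by rewrite sqr_ge0.
  by rewrite mulr_ge0 ?sqr_ge0// addr_ge0// exprn_ge0.
have G0 j b p v : 0 <= G j b p v.
  by rewrite /G divr_ge0 ?exprn_ge0//; case: ifP => _//; case: b; rewrite sqr_ge0.
apply: (le_trans (block_euler_product_le N blk A0 G0)).
rewrite big_ord_recr/= mulrC -mulrA.
apply: ler_pM.
- by apply: sumr_ge0 => b _; rewrite mulr_ge0//; apply: prodr_ge0 => p _; apply: sumr_ge0.
- by apply: prodr_ge0 => j _; apply: sumr_ge0 => b _; rewrite mulr_ge0//; apply: prodr_ge0 => p _; apply: sumr_ge0.
- rewrite big_bool/= /A/= ltnn mul0r addr0; apply: ler_wpM2l; first exact: sqr_ge0.
rewrite mulr_sumr; have -> : \sum_(p < N | prime p && ((p : nat) \in outside pi k)) 2 * (p%:R : R)^-1 =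
     \sum_(p < N | prime p && (blk p == ord_max)) 2 / p%:R.
    by apply: eq_bigl => p; rewrite blk_eq/= idx_eq_out.
  apply: le_trans (@prod1D_le_expR R 'I_N _ _ (fun p : 'I_N => 2 / p%:R) _) => [|p _]; last by rewrite divr_ge0.
  apply: ler_prod => p /andP[pp _]; apply/andP; split; first by apply: sumr_ge0.
  by rewrite /G/= ltnn; exact: sum_geom_le.
rewrite -expRD; set SD := \sum_(p < N | _) _.
have SDE : \sum_(i < k) \sum_(p < N | prime p && (idx p == i)) defect p <= SD.
  rewrite /SD (partition_big (fun p : 'I_N => blk p) xpredT)//= big_ord_recr/=.
  rewrite (eq_bigr (fun i : 'I_k => \sum_(p < N | prime p && (blk p == widen_ord (leqnSn k) i)) defect p)).
    by rewrite lerDl; apply: sumr_ge0 => p _; exact: defect_ge0.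
  by move=> i _; apply: eq_bigl => p; rewrite blk_eq.
apply: (@le_trans _ _ (expR (\sum_(i < k) (\sum_(p < N | prime p && (idx p == i)) defect p) + \sum_(i < k) 3 * E ^+ 2 / 4 ^+ ell i *
          expR (2 * expR 8 * \sum_(p < N | prime p && ((p : nat) \in pi i)) (p%:R : R)^-1)))); last first.
  by rewrite ler_expR lerD2r.
rewrite -big_split/= expR_sum; apply: ler_prod => j _; apply/andP; split.
  by apply: sumr_ge0 => b _; rewrite mulr_ge0//; apply: prodr_ge0 => p _; apply: sumr_ge0.
rewrite expRD big_bool/= /A /G /= ltn_ord.
apply: le_trans (block_factor_le (ltn_ord j) (erefl _)).
rewrite (eq_bigl (fun p : 'I_N => prime p && (idx p == j))); last by move=> p; rewrite blk_eq.
by rewrite [in X in _ + X](eq_bigl (fun p : 'I_N => prime p && (idx p == j)))// => p; rewrite blk_eq.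
Qed.

End BlockEstimates.

(** * Sizes of the mollifier parameters and prime sums over its blocks *)

Section MollifierBlocks.
Variable R : realType.
Implicit Types (c eta x y : R) (q i j : nat).

Definition prime_block c eta q i : nat_pred := [pred p | in_I c eta q i p].

Lemma theta_gt0 eta q i : 0 < eta -> 1 < ln (q%:R : R) -> 0 < theta eta q i.
Proof.
by move=> e0 l1; rewrite /theta divr_gt0 ?exprn_gt0 ?ln_gt0// mulr_gt0 ?expR_gt0.
Qed.

Lemma theta_add eta q i j : theta eta q (i + j) = expR j%:R * theta eta q i.
Proof. by rewrite /theta natrD expRD; ring. Qed.

Lemma theta_le eta q i j : 0 < eta -> 1 < ln (q%:R : R) -> (i <= j)%N ->
  theta eta q i <= theta eta q j.
Proof.
move=> e0 l1 ij; rewrite -(subnKC ij) theta_add.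
apply: ler_peMl; first exact/ltW/theta_gt0.
by rewrite -[leLHS]expR0 ler_expR.
Qed.

Lemma ln_gt1_gt1 q : 1 < ln (q%:R : R) -> 1 < q%:R :> R.
Proof.
case: q => [|q] h; first by rewrite ln0// ltNge ler01 in h.
rewrite ltNge; apply/negP => q1; have := ln_le0 q1; lra.
Qed.

Lemma prime_block_disj c eta q i j p : 0 < eta -> 1 < ln (q%:R : R) ->
  p \in prime_block c eta q i -> p \in prime_block c eta q j -> i = j.
Proof.
move=> e0 l1.
suff h a b : (a < b)%N -> p \in prime_block c eta q a -> p \notin prime_block c eta q b.
  move=> pi pj; case: (ltngtP i j) => // ij; first by have := h _ _ ij pi; rewrite pj.
  by have := h _ _ ij pj; rewrite pi.
case: b => // b; rewrite ltnS => ab; rewrite !inE /in_I => /andP[_ pa]; apply/negP => /andP[pb _].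
have : (q%:R : R) `^ theta eta q a <= q%:R `^ theta eta q b.
  by apply: ler_powR; [exact/ltW/ln_gt1_gt1|exact: theta_le].
by move=> /(le_trans pa) /(lt_le_trans pb); rewrite ltxx.
Qed.

Lemma outside_blocksP c eta q k p : p \in outside (prime_block c eta q) k.+1 ->
  (p%:R <= c) || (q%:R `^ theta eta q k < p%:R).
Proof.
rewrite leNgt -implybE; move=> /outsideP h; apply/implyP => c0p.
elim: k h => [|k IH] h.
  by have := h 0%N isT; rewrite inE /in_I c0p/= -ltNge.
have h1 := IH (fun i ik => h i (leqW ik)).
by have := h k.+1 (ltnSn _); rewrite inE /in_I h1/= -ltNge.
Qed.

Lemma ln32_ge : 1 / 3 <= ln (3 / 2) :> R.
Proof.
have := @le_ln1Dx R (- (1 / 3)).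
have -> : 1 + - (1 / 3) = (3 / 2)^-1 :> R by field.
rewrite lnV ?posrE//; lra.
Qed.

(** Meant for block 0, which starts at a constant and whose reciprocals therefore sum to the order
    of log log q. The constant is 4 + 8 * 3, with 3 bounding - ln ln(3/2). *)
Lemma sum_primeV_all_le q : 1 < ln (q%:R : R) ->
  \sum_(p < q | prime p) (p%:R : R)^-1 <= 28 + 8 * ln (ln q%:R).
Proof.
move=> l1.
have q1 := ln_gt1_gt1 l1.
have q2 : 3 / 2 <= q%:R :> R.
  have : 2%:R <= q%:R :> R by rewrite ler_nat -(ltr_nat R).
  lra.
have h1 : 1 < 3 / 2 :> R by lra.
have h := @sum_primeV_le R q (3 / 2) q%:R h1 q2.
have hl : 4 + 8 * ln (ln q%:R / ln (3 / 2)) <= 28 + 8 * ln (ln q%:R) :> R.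
  have l32 := ln32_ge; have l32' : 0 < ln (3 / 2) :> R by lra.
  rewrite ln_div ?posrE//; last lra.
  have : - ln (ln (3 / 2)) <= 3 :> R; last by lra.
  rewrite -lnV ?posrE//; apply: (@le_trans _ _ (ln 3)); last first.
    by have := @ln_sublinear R 3; lra.
  rewrite ler_ln ?posrE ?invr_gt0// -[leLHS]div1r ler_pdivrMr//; lra.
apply: le_trans hl; apply: le_trans h.
apply: (@ler_sum_ord_sub R q q prime (fun p => prime p && (3 / 2 < p%:R <= q%:R))
   (fun p => p%:R^-1) (fun p => p%:R^-1)) => [p|p pq pp]; first by rewrite invr_ge0.
split => //; rewrite pp ler_nat (ltnW pq) andbT/=.
have : 2%:R <= p%:R :> R by rewrite ler_nat prime_gt1.
lra.
Qed.

Lemma powR_gt1_ln q x : 1 < ln (q%:R : R) -> 0 < x -> 1 < (q%:R : R) `^ x.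
Proof.
move=> l1 x0; have q0 : 0 < (q%:R : R) by have := ln_gt1_gt1 l1; lra.
rewrite -ltr_ln ?posrE ?powR_gt0// ln1 ln_powR; apply: mulr_gt0 => //; lra.
Qed.

(** The logarithms of the endpoints have ratio e, by which theta grows in each step; hence 4 + 8 *
    1. *)
Lemma sum_primeV_block_le c eta q i : 0 < eta -> 1 < ln (q%:R : R) ->
  \sum_(p < q | prime p && ((p : nat) \in prime_block c eta q i.+1)) (p%:R : R)^-1 <= 12.
Proof.
move=> e0 l1; have q1 := ln_gt1_gt1 l1; have t0 := theta_gt0 i e0 l1.
have y1 := powR_gt1_ln l1 t0.
have yw : (q%:R : R) `^ theta eta q i <= q%:R `^ theta eta q i.+1.
  by apply: ler_powR; [exact/ltW|exact: theta_le].
apply: (le_trans (sum_primeV_le q y1 yw)).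
rewrite !ln_powR -mulf_div divff ?mulr1; last by rewrite gt_eqF// (lt_trans ltr01).
rewrite -(addn1 i) theta_add mulfK ?gt_eqF// expRK; lra.
Qed.

(** Primes up to [c] are counted trivially. The others lie between q^theta_k and q, and the
    logarithms of these endpoints have ratio 1 / theta_k <= 1 / eta. *)
Lemma sum_primeV_outside_le c eta q k : 0 < eta -> 1 < ln (q%:R : R) ->
  eta <= theta eta q k -> theta eta q k <= 1 ->
  \sum_(p < q | prime p && ((p : nat) \in outside (prime_block c eta q) k.+1)) (p%:R : R)^-1
  <= `|c| + 5 + 8 * ln (eta^-1).
Proof.
move=> e0 l1 et t1; have q1 := ln_gt1_gt1 l1; have t0 := theta_gt0 k e0 l1.
have y1 := powR_gt1_ln l1 t0.
have yw : (q%:R : R) `^ theta eta q k <= q%:R.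
  by rewrite -[leRHS]powRr1 ?(ltW (lt_trans ltr01 q1))//; apply: ler_powR => //; exact: ltW.
rewrite (bigID (fun p : 'I_q => (p%:R : R) <= c))/=.
have -> : `|c| + 5 + 8 * ln eta^-1 = (`|c| + 1) + (4 + 8 * ln eta^-1) by ring.
apply: lerD.
  pose n := Num.truncn `|c|.
  have /andP[n1 n2] : n%:R <= `|c| < n.+1%:R by apply: truncn_itv.
  apply: (@le_trans _ _ (\sum_(p < n.+1 | (0 < p)%N) (1 : R))).
    apply: (@ler_sum_ord_sub R q n.+1
      (fun p => prime p && (p \in outside (prime_block c eta q) k.+1) && (p%:R <= c))
      (fun p => 0 < p)%N (fun p => p%:R^-1) (fun=> 1)) => // p pq /andP[/andP[pp _] pc].
    split; [exact: prime_gt0| |by rewrite invf_le1 ?ler1n ?ltr0n prime_gt0].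
    by rewrite ltnS truncn_ge_nat// (le_trans pc)// ler_norm.
  rewrite big_mkcond big_ord_recl/= add0r sumr_const card_ord; lra.
apply: (@le_trans _ _ (4 + 8 * ln (ln q%:R / ln (q%:R `^ theta eta q k)))); last first.
  rewrite ln_powR invfM mulrCA mulfV ?mulr1 ?gt_eqF ?(lt_trans ltr01)//.
  by rewrite lerD2l ler_wpM2l// ler_ln ?posrE ?invr_gt0// lef_pV2.
apply: le_trans (sum_primeV_le q y1 yw).
apply: (@ler_sum_ord_sub R q q (fun p => prime p && (p \in outside (prime_block c eta q) k.+1) && ~~ (p%:R <= c))
   (fun p => prime p && ((q%:R : R) `^ theta eta q k < p%:R <= q%:R)) (fun p => p%:R^-1) (fun p => p%:R^-1)) => [p|p pq].
  by rewrite invr_ge0.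
case/andP=> /andP[-> /outside_blocksP] /orP[->//|->] _; split => //.
by rewrite ler_nat ltnW.
Qed.

Lemma expR1_le4 : expR 1 <= 4 :> R.
Proof.
have h : expR (1 / 2) <= 2 :> R.
  have := @expR_sub1_le R (1/2); rewrite ger0_norm// => /(_ (lexx _)) h.
  have := ler_norm (expR (1/2 : R) - 1); lra.
have -> : expR 1 = expR (1 / 2) * expR (1 / 2) :> R by rewrite -expRD; congr expR; lra.
have := expR_gt0 (1 / 2 : R); nra.
Qed.

(** The base 4 of the truncation loss exceeds e, so that exp(l) / 4^l stays bounded. *)
Lemma expR_le_pow4 n : expR n%:R <= 4 ^+ n :> R.
Proof.
rewrite -[n%:R]mulr1 expRM_natl; apply: lerXn2r; rewrite ?nnegrE ?expR_ge0//.
exact: expR1_le4.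
Qed.

Lemma ell_ge eta q i : 2 * (theta eta q i `^ (- (3 / 4)) - 1) <= (ell eta q i)%:R :> R.
Proof.
rewrite /ell natrM ler_wpM2l//; set x := _ `^ _.
have /andP[_] := truncn_itv (powR_ge0 (theta eta q i) (- (3 / 4))).
by rewrite -/x -natr1; lra.
Qed.

(** theta_0^(-3/4) is at least (log log q)^(15/4), more than the cube, which in turn beats the
    exponent of order log log q produced by block 0. *)
Lemma ell0_ge eta q : 0 < eta -> eta <= 1 -> 2 <= ln (ln (q%:R : R)) ->
  ln (ln q%:R) ^+ 3 <= (ell eta q 0)%:R :> R.
Proof.
move=> e0 e1; set L := ln (ln _) => L2.
have L0 : 0 < L by lra.
apply: le_trans (ell_ge eta q 0).
suff : L ^+ 3 <= theta eta q 0 `^ (- (3 / 4)).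
  have : 2 <= L ^+ 3 by rewrite !exprS expr0 mulr1; nra.
  lra.
have t0 : 0 < theta eta q 0 by rewrite /theta -/L divr_gt0 ?exprn_gt0 ?mulr_gt0 ?expR_gt0.
rewrite -ler_ln ?posrE ?exprn_gt0 ?powR_gt0// ln_powR lnXn//.
rewrite /theta -/L expR0 mulr1 ln_div ?posrE ?exprn_gt0// lnXn//.
have := ln_le0 e1; have : 0 <= ln L by rewrite ln_ge0//; lra.
rewrite -!(mulr_natl (ln L)); lra.
Qed.

(** theta_i = e^(-d) theta_J with d = J - i, so theta_i^(-3/4) >= 1 + 3 d / 4. This makes the losses
    4^(-l_i) a geometric series, uniformly in J. *)
Lemma ell_ge_sub eta q J i : 0 < eta -> 1 < ln (q%:R : R) -> theta eta q J <= 1 ->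
  (i <= J)%N -> (J - i <= ell eta q i)%N.
Proof.
move=> e0 l1 t1 iJ; set d := (J - i)%N.
have [->//|d0] := posnP d.
have t0 := theta_gt0 i e0 l1.
have tE : theta eta q J = expR d%:R * theta eta q i by rewrite -theta_add subnKC.
have hln : ln (theta eta q i) <= - d%:R.
  have : ln (theta eta q J) <= 0 by exact: ln_le0.
  by rewrite tE lnM ?posrE ?expR_gt0// expRK; lra.
have h : 1 + 3 / 4 * d%:R <= theta eta q i `^ (- (3 / 4)).
  rewrite /powR gt_eqF//; apply: le_trans (expR_ge1Dx _); lra.
have := ell_ge eta q i.
have d1 : 1 <= d%:R :> R by rewrite ler1n.
rewrite -(ler_nat R); lra.
Qed.

Lemma sum_pow4V_le J : \sum_(i < J.+1) ((4 : R) ^+ (J - i))^-1 <= 2.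
Proof.
have -> : \sum_(i < J.+1) ((4 : R) ^+ (J - i))^-1 = \sum_(i < J.+1) ((4 : R) ^+ i)^-1.
  by rewrite (reindex_inj rev_ord_inj)/=; apply: eq_bigr => i _; rewrite subSS subKn// -ltnS.
suff : \sum_(i < J.+1) ((4 : R) ^+ i)^-1 <= 2 - ((4 : R) ^+ J)^-1.
  have : 0 <= ((4 : R) ^+ J)^-1 by rewrite invr_ge0 exprn_ge0.
  lra.
elim: J => [|J IH]; first by rewrite big_ord_recr big_ord0/= expr0 invr1; lra.
rewrite big_ord_recr/=; apply: (le_trans (lerD IH (lexx _))).
rewrite exprS invfM; have : 0 <= ((4 : R) ^+ J)^-1 by rewrite invr_ge0 exprn_ge0.
lra.
Qed.

(** Inserts the prime sums in the block bound. The defects sum to O(1 + ln(1 + |z| ln q)), so their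
    exponential is a power of 1 + |z| ln q; this polynomial growth in z is what the moments of the
    cutoff have to pay for. *)
Lemma block_conv_mean_square c eta K : 0 < eta -> eta <= expR (-1) -> 0 <= K ->
  exists (A : R) (B Q0 : nat), forall (q J : nat) (z : R[i]), (Q0 <= q)%N ->
    eta <= theta eta q J -> theta eta q J <= expR 1 * eta ->
    `|complex.Re z| <= K / ln q%:R ->
    \sum_(n < q | (0 < n)%N)
      normc (iconv (fun i a => (block_coef R (prime_block c eta q) (ell eta q) i a)%:C)
         (dirichlet_power z) J.+1 n) ^+ 2 / n%:R
    <= A * (1 + normc z * ln q%:R) ^+ B.
Proof.
move=> e0 e1 K0; pose E : R := expR K.
have E1 : 1 <= E by rewrite -[leLHS]expR0 ler_expR.
have E0 : 0 <= E by rewrite (le_trans ler01).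
pose C8 : R := expR 8.
(* With L = ln ln q > [L0], the exponent of block 0, at most 2 C8 (28 + 8 L) <= 72 C8 L, is at most
   L^3 and hence at most l_0. *)
pose L0 : R := 2 + 72 * C8.
pose B := Num.bound (8 * (1 + E) ^+ 2).
(* The prime sum with bounds (1 + E)^2 and 16 gives 16 / 2 and 28 (1 + E)^2, the inverse squares
   give 2 * 2; the remaining 8 (1 + E)^2 ln(1 + |z| ln q) becomes the power [B]. *)
pose A1 : R := 8 + (1 + E) ^+ 2 * 28 + 4 * (expR 1 * E) ^+ 2.
(* 1 for block 0; for the other blocks the exponent is 2 * 12 * C8, and the geometric series sums to
   at most 2. *)
pose A2 : R := 3 * E ^+ 2 * (1 + 2 * expR (24 * C8)).
pose A : R := E ^+ 2 * expR (2 * (`|c| + 5 + 8 * ln eta^-1)) * expR A1 * expR A2.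
exists A, B, (Num.bound (expR (expR L0))) => q J z qQ et1 et2 zK.
have C81 : 1 <= C8 by rewrite -[leLHS]expR0 ler_expR.
have q0 : expR (expR L0) < q%:R.
  have := Num.Theory.archi_boundP (expR_ge0 (expR L0)); move/lt_le_trans; apply.
  by rewrite ler_nat.
have L2 : 2 <= L0 by rewrite /L0; lra.
have lq : expR L0 < ln q%:R by rewrite -ltr_expR lnK// posrE (lt_trans (expR_gt0 _) q0).
have lnl : L0 < ln (ln q%:R) by rewrite -ltr_expR lnK// posrE (lt_trans (expR_gt0 _) lq).
have l1 : 1 < ln q%:R :> R.
  by apply: le_lt_trans lq; rewrite -[leLHS]expR0 ler_expR; lra.
have l0 : 0 < ln q%:R :> R by rewrite (lt_trans ltr01).
have q1 := ln_gt1_gt1 l1.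
have eta1 : eta <= 1 by apply: (le_trans e1); rewrite -[leRHS]expR0 ler_expR.
have t1 : theta eta q J <= 1.
  apply: (le_trans et2); apply: (@le_trans _ _ (expR 1 * expR (-1))).
    by rewrite ler_wpM2l ?expR_ge0.
  by rewrite -expRD subrr expR0.
have powE m : (0 < m < q)%N -> normc (dirichlet_power z m) <= E.
  case/andP=> m0 mq; rewrite normc_dirichlet_power ler_expR.
  apply: (le_trans (ler_norm _)); rewrite normrM normrN.
  rewrite (ger0_norm (ln_nat_ge0 _ _)).
  apply: (@le_trans _ _ (K / ln q%:R * ln q%:R)); last by rewrite divfK// gt_eqF.
  by apply: ler_pM => //; rewrite ?ln_nat_ge0// ler_ln_nat// ltnW.
have h := block_mean_square_le E1 powE (ell eta q) (fun i j p => @prime_block_disj c eta q i j p e0 l1) J.+1.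
apply: (le_trans h); set S1 := \sum_(p < q | _ && _) _; set S2 := \sum_(p < q | _) _.
set S3 := \sum_(i < _) _.
have h1 : S1 <= `|c| + 5 + 8 * ln eta^-1 by exact: sum_primeV_outside_le.
have h2 : S2 <= A1 + 8 * (1 + E) ^+ 2 * ln (1 + normc z * ln q%:R).
  rewrite /S2 big_split/=.
  have -> : A1 + 8 * (1 + E) ^+ 2 * ln (1 + normc z * ln q%:R)
     = (16 / 2 + (1 + E) ^+ 2 * (28 + 8 * ln (1 + normc z * ln q%:R))) + 4 * (expR 1 * E) ^+ 2.
    rewrite /A1; lra.
  apply: lerD.
    apply: (@sum_prime_min_le R q (normc z) ((1 + E) ^+ 2) 16
       (fun p => normc (dirichlet_power z p - 1) ^+ 2)); rewrite ?normc_ge0 ?sqr_ge0//.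
    - by rewrite -(ltr_nat R).
    - move=> p pp pq; rewrite lerXn2r ?nnegrE ?normc_ge0 ?addr_ge0//.
      apply: (le_trans (le_normcB _ _)); rewrite normc1 addrC lerD2l.
      by apply: powE; rewrite prime_gt0.
    - move=> p pp tp; set t := normc z * ln p%:R in tp *.
      have e : normc (- z * (ln (p%:R : R))%:C) = t.
        by rewrite normcM normcN normcR ger0_norm ?ln_nat_ge0.
      have := @normc_cexp_sub1_le R (- z * (ln (p%:R : R))%:C); rewrite e => /(_ tp) h3.
      have -> : 16 * t ^+ 2 = (4 * t) ^+ 2 by ring.
      rewrite lerXn2r ?nnegrE ?normc_ge0 ?mulr_ge0 ?ln_nat_ge0 ?normc_ge0//.
  have -> : 4 * (expR 1 * E) ^+ 2 = 2 * (expR 1 * E) ^+ 2 * 2 by ring.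
  apply: (@le_trans _ _ (2 * (expR 1 * E) ^+ 2 * \sum_(n < q | (0 < n)%N) ((n%:R : R) ^+ 2)^-1)); last first.
    by rewrite ler_wpM2l ?sum_inv_sqr_le// mulr_ge0 ?sqr_ge0.
  rewrite -mulr_sumr ler_wpM2l ?mulr_ge0 ?sqr_ge0//.
  apply: (@ler_sum_ord_sub R q q prime (fun p => 0 < p)%N (fun p => (p%:R ^+ 2)^-1) (fun p => (p%:R ^+ 2)^-1)) => [p|p pq pp].
    by rewrite invr_ge0 sqr_ge0.
  by split => //; exact: prime_gt0.
have h3 : S3 <= A2.
  apply: (@le_trans _ _ (\sum_(i < J.+1) (3 * E ^+ 2 * (i == 0%N :> nat)%:R
     + 3 * E ^+ 2 * expR (24 * C8) * ((4 : R) ^+ (J - i))^-1))).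
    apply: ler_sum => i _; case: i => -[|i] iJ /=; last first.
      rewrite mulr0 add0r.
      have -> : 3 * E ^+ 2 * expR (24 * C8) * ((4 : R) ^+ (J - i.+1))^-1 =
        3 * E ^+ 2 * ((4 : R) ^+ (J - i.+1))^-1 * expR (24 * C8) by ring.
      apply: ler_pM; rewrite ?expR_ge0 ?divr_ge0 ?mulr_ge0 ?sqr_ge0 ?exprn_ge0//.
        rewrite ler_wpM2l ?mulr_ge0 ?sqr_ge0// lef_pV2 ?posrE ?exprn_gt0//.
        by rewrite ler_weXn2l ?ell_ge_sub//; lra.
      rewrite ler_expR; have := sum_primeV_block_le c i e0 l1.
      set S := \sum_(p < q | _) _ => hS; rewrite -/C8; nra.
    apply: ler_wpDr; first by rewrite ?mulr_ge0 ?sqr_ge0 ?expR_ge0 ?invr_ge0 ?exprn_ge0.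
    rewrite mulr1 -[leRHS]mulr1 -mulrA ler_wpM2l ?mulr_ge0 ?sqr_ge0//.
    rewrite mulrC ler_pdivrMr ?exprn_gt0// mul1r.
    apply: le_trans (expR_le_pow4 _); rewrite ler_expR.
    have hS := sum_primeV_all_le l1.
    have hS' : \sum_(p < q | prime p && ((p : nat) \in prime_block c eta q 0)) (p%:R : R)^-1 <= 28 + 8 * ln (ln q%:R).
      apply: le_trans hS.
      apply: (@ler_sum_ord_sub R q q (fun p => prime p && (p \in prime_block c eta q 0)) prime
         (fun p => p%:R^-1) (fun p => p%:R^-1)) => [p|p pq /andP[pp _]]; first by rewrite invr_ge0.
      by split.
    have hl : 2 <= ln (ln q%:R) :> R by lra.
    apply: le_trans (ell0_ge e0 eta1 hl).
    move: hS'; set S := \sum_(p < q | _) _ => hS'; rewrite -/C8.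
    move: (ln (ln q%:R)) lnl hl hS' => L lnl hl hS'.
    have a1 : 72 * C8 <= L ^+ 2 by rewrite expr2; rewrite /L0 in lnl; nra.
    have a2 : 72 * C8 * L <= L ^+ 3 by rewrite exprSr ler_wpM2r//; lra.
    have a3 : 2 * C8 * S <= 2 * C8 * (28 + 8 * L) by rewrite ler_wpM2l//; lra.
    have a4 : C8 * 1 <= C8 * L by rewrite ler_wpM2l//; lra.
    lra.
  rewrite big_split/= -!mulr_sumr big_ord_recl/= big1 ?addr0 ?mulr1//.
  rewrite /A2 mulrDr mulr1 lerD2l -mulrA; apply: ler_wpM2l; first by rewrite mulr_ge0 ?sqr_ge0.
  by rewrite mulrC; apply: ler_wpM2r; [exact: expR_ge0|exact: sum_pow4V_le].
have T1 : 1 <= 1 + normc z * ln q%:R.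
  by rewrite lerDl mulr_ge0 ?normc_ge0 ?ltW.
have lT : 0 <= ln (1 + normc z * ln q%:R) by exact: ln_ge0.
have eB : expR (8 * (1 + E) ^+ 2 * ln (1 + normc z * ln q%:R)) <= (1 + normc z * ln q%:R) ^+ B.
  rewrite -[leRHS]lnK ?posrE ?exprn_gt0 ?(lt_le_trans ltr01)// ler_expR lnXn ?(lt_le_trans ltr01)//.
  rewrite -[leRHS]mulr_natl ler_wpM2r//; apply/ltW/Num.Theory.archi_boundP.
  by rewrite mulr_ge0 ?sqr_ge0.
rewrite /A.
have -> : E ^+ 2 * expR (2 * (`|c| + 5 + 8 * ln eta^-1)) * expR A1 * expR A2 *
  (1 + normc z * ln q%:R) ^+ B = E ^+ 2 * expR (2 * (`|c| + 5 + 8 * ln eta^-1)) *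
   (expR A1 * (1 + normc z * ln q%:R) ^+ B) * expR A2 by ring.
have e2 : expR S2 <= expR A1 * (1 + normc z * ln q%:R) ^+ B.
  apply: (@le_trans _ _ (expR A1 * expR (8 * (1 + E) ^+ 2 * ln (1 + normc z * ln q%:R)))).
    by rewrite -expRD ler_expR.
  by rewrite ler_wpM2l ?expR_ge0.
apply: ler_pM; rewrite ?mulr_ge0 ?sqr_ge0 ?expR_ge0 ?ler_expR//.
apply: ler_pM; rewrite ?mulr_ge0 ?sqr_ge0 ?expR_ge0//.
by rewrite ler_wpM2l ?sqr_ge0// ler_expR ler_wpM2l.
Qed.

End MollifierBlocks.

(** * Dirichlet characters and Gauss sums *)

Section Characters.
Variables (R : realType) (q : nat).
Hypothesis q_prime : prime q.
Local Notation C := R[i].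
Implicit Types (chi psi : nat -> C).

Let q0 : (0 < q)%N := prime_gt0 q_prime.
Let q1 : (1 < q)%N := prime_gt1 q_prime.

Lemma char_add_mul chi n k : dirichlet_character q chi -> chi (n + k * q)%N = chi n.
Proof. by case=> per _ _; elim: k => [|k IH]; rewrite ?addn0// mulSnr addnA per. Qed.

Lemma char_mod chi n : dirichlet_character q chi -> chi (n %% q)%N = chi n.
Proof. by move=> h; rewrite {2}(divn_eq n q) addnC char_add_mul. Qed.

Lemma char1 chi : dirichlet_character q chi -> chi 1%N = 1.
Proof.
case=> _ mul supp; have h : chi 1%N != 0 by rewrite supp coprime1n.
by apply: (mulfI h); rewrite -mul muln1 mulr1.
Qed.

Lemma coprime_small n : (0 < n < q)%N -> coprime n q.
Proof.
case/andP=> n0 nq; rewrite coprime_sym prime_coprime//; apply/negP => /dvdn_leq.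
by rewrite n0 leqNgt nq => /(_ isT).
Qed.

Lemma char_eq0 chi n : dirichlet_character q chi -> (q %| n)%N -> chi n = 0.
Proof.
by case=> _ _ supp qn; apply/eqP; rewrite -[_ == _]negbK supp coprime_sym prime_coprime// qn.
Qed.

Lemma charX chi n k : dirichlet_character q chi -> chi (n ^ k)%N = chi n ^+ k.
Proof.
move=> h; have [_ mul _] := h.
by elim: k => [|k IH]; rewrite ?expn0 ?char1// expnS mul IH exprS.
Qed.

(** Fermat's little theorem gives chi(n)^q = chi(n), so chi(n) is a root of unity. *)
Lemma normc_char chi n : dirichlet_character q chi -> coprime n q -> normc (chi n) = 1.
Proof.
move=> h cn; have e : chi n ^+ q = chi n.
  by rewrite -charX// -char_mod// fermat_little// char_mod.
have n0 : chi n != 0 by have [_ _ ->] := h.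
have e1 : chi n ^+ q.-1 = 1.
  by apply: (mulfI n0); rewrite -exprS prednK// e mulr1.
apply/eqP; rewrite -(@pexpr_eq1 _ _ q.-1) ?normc_ge0//; last by rewrite -ltnS prednK.
by rewrite -normcX e1 normc1.
Qed.

Lemma normc_char_le1 chi n : dirichlet_character q chi -> normc (chi n) <= 1.
Proof.
move=> h; case: (boolP (coprime n q)) => cn; first by rewrite normc_char.
have [_ _ supp] := h; move/negbTE: cn; rewrite -supp => /negbFE/eqP ->.
by rewrite normc0.
Qed.

Lemma conj_char chi : dirichlet_character q chi -> dirichlet_character q (conj_character chi).
Proof.
case=> per mul supp; split=> [n|m n|n]; rewrite /conj_character ?per//.
  by rewrite mul conjcM.
by rewrite conjc_eq0 supp.
Qed.

Lemma conj_characterK chi : conj_character (conj_character chi) = chi.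
Proof. by apply/funext => n; rewrite /conj_character conjcK. Qed.

Lemma principal_char : dirichlet_character q (principal_character R q).
Proof.
rewrite /principal_character; split=> [n|m n|n].
- by rewrite /coprime gcdnC gcdnDr gcdnC.
- by rewrite coprimeMl -mulnb natrM.
- by case: coprime; rewrite ?oner_eq0 ?eqxx.
Qed.

Lemma conj_principal : conj_character (principal_character R q) = principal_character R q.
Proof. by apply/funext => n; rewrite /conj_character conjc_nat. Qed.

Lemma mulmod_inj a : coprime a q ->
  injective (fun r : 'I_q => Ordinal (ltn_pmod (a * r) q0)).
Proof.
move=> ca.
suff h (r s : 'I_q) : (s <= r)%N -> (a * r = a * s %[mod q])%N -> r = s.
  move=> r s /(congr1 (fun x : 'I_q => nat_of_ord x))/= e.
  by case: (leqP s r) => [|/ltnW] sr; [exact: h|apply/esym/h].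
move=> sr /eqP; rewrite eqn_mod_dvd ?leq_mul2l ?sr ?orbT// -mulnBr Gauss_dvdr 1?coprime_sym//.
move=> qrs; apply/val_inj/eqP; rewrite eqn_leq sr andbT -subn_eq0.
apply: contraTT qrs => rs; rewrite gtnNdvd// ?lt0n//.
by rewrite (leq_ltn_trans (leq_subr _ _)).
Qed.

Lemma sum_mulmod (F : nat -> C) a : coprime a q ->
  \sum_(r < q) F r = \sum_(r < q) F (a * r %% q)%N.
Proof. by move=> ca; rewrite (reindex_inj (mulmod_inj ca)). Qed.

(** Multiplying the summation variable by an [a] with chi(a) different from psi(a) multiplies the
    sum by a factor other than 1. *)
Lemma char_ortho chi psi : dirichlet_character q chi -> dirichlet_character q psi ->
  chi <> psi -> \sum_(r < q) chi r * (conjc (psi r)) = 0.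
Proof.
move=> hc hp cp.
have [a ca] : exists a, chi a <> psi a.
  by apply/existsNP => h; apply: cp; apply/funext.
have [_ mulc suppc] := hc; have [_ mulp suppp] := hp.
have cop : coprime a q.
  apply/negP => /negP na; apply: ca; move: (na); rewrite -suppc negbK => /eqP ->.
  by move: na; rewrite -suppp negbK => /eqP ->.
set T := \sum_(r < q) _.
have e : T = chi a * (conjc (psi a)) * T.
  rewrite {1}/T (sum_mulmod (fun r => chi r * (conjc (psi r))) cop) mulr_sumr.
  apply: eq_bigr => r _; rewrite !char_mod// mulc mulp conjcM; ring.
have : (1 - chi a * (conjc (psi a))) * T = 0 by rewrite mulrBl mul1r -e subrr.
move/eqP; rewrite mulf_eq0 => /orP[|/eqP//]; rewrite subr_eq0 => /eqP h1.
exfalso; apply: ca.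
have h2 : (conjc (psi a)) * psi a = 1.
  by rewrite mulrC mulc_conj normc_char// expr1n.
by rewrite -[LHS]mulr1 -h2 mulrA -h1 mul1r.
Qed.

Lemma char_sum0 chi : dirichlet_character q chi -> chi <> principal_character R q ->
  \sum_(r < q) chi r = 0.
Proof.
move=> hc np; rewrite -[RHS](char_ortho hc principal_char np).
apply: eq_bigr => r _; have -> : (conjc (principal_character R q r)) = principal_character R q r.
  by rewrite conjc_nat.
have [_ _ supp] := hc; rewrite /principal_character.
case: (boolP (coprime r q)) => cr; first by rewrite mulr1.
by move: cr; rewrite -supp negbK => /eqP ->; rewrite mul0r.
Qed.

Lemma sum_normc_char_sqr chi : dirichlet_character q chi ->
  \sum_(r < q) chi r * (conjc (chi r)) = (q.-1)%:R.
Proof.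
move=> hc; rewrite (bigD1 (Ordinal q0))//= char_eq0// mul0r add0r.
rewrite (eq_bigr (fun=> 1)) => [|r r0]; last first.
  rewrite mulc_conj normc_char ?expr1n// coprime_small// ltn_ord andbT lt0n.
  by apply: contra r0 => /eqP r0; apply/eqP/val_inj.
rewrite sumr_const; congr (_%:R).
by have := cardC1 (Ordinal q0); rewrite card_ord => <-; apply: eq_card => i; rewrite !inE.
Qed.

(** Bessel's inequality for the characters as orthogonal vectors of squared norm q - 1. The index 0
    is left out on the right because chi(0) = 0. *)
Lemma char_bessel (S : seq (nat -> C)) (c : nat -> C) : uniq S ->
  (forall chi, chi \in S -> dirichlet_character q chi) ->
  \sum_(chi <- S) normc (\sum_(n < q) c n * chi n) ^+ 2
  <= (q.-1)%:R * \sum_(n < q | (0 < n)%N) normc (c n) ^+ 2.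
Proof.
move=> uS hS.
wlog c0 : c / c 0%N = 0.
  move=> h; pose c' n := if n == 0%N then 0 else c n.
  have -> : \sum_(chi <- S) normc (\sum_(n < q) c n * chi n) ^+ 2 =
            \sum_(chi <- S) normc (\sum_(n < q) c' n * chi n) ^+ 2.
    rewrite big_seq [RHS]big_seq; apply: eq_bigr => chi chiS; congr (normc _ ^+ 2).
    apply: eq_bigr => n _; rewrite /c'; case: eqP => // ->.
    by rewrite (char_eq0 (hS _ chiS) (dvdn0 q)) !mulr0.
  have -> : \sum_(n < q | (0 < n)%N) normc (c n) ^+ 2 = \sum_(n < q | (0 < n)%N) normc (c' n) ^+ 2.
    by apply: eq_bigr => n; rewrite lt0n /c' => /negbTE ->.
  by apply: h; rewrite /c' eqxx.
have p0 : 0 < (q.-1)%:R :> R by rewrite ltr0n -ltnS prednK.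
pose x chi := \sum_(n < q) c n * chi n.
pose P : C := ((q.-1)%:R^-1 : R)%:C.
(* [w] is the orthogonal projection of [c] on the span of the conjugate characters; the claim is
   that the sum of |c - w|^2 is nonnegative. *)
pose w n := P * \sum_(chi <- S) x chi * (conjc (chi n)).
have Pc : (conjc P) = P by exact: conjc_real.
pose X : C := \sum_(chi <- S) x chi * (conjc (x chi)).
have cw : \sum_(n < q) c n * (conjc (w n)) = P * X.
  rewrite /X mulr_sumr.
  transitivity (\sum_(n < q) \sum_(chi <- S) P * (conjc (x chi)) * (c n * chi n)).
    apply: eq_bigr => n _; rewrite /w conjcM Pc conjc_sum !mulr_sumr.
    by apply: eq_bigr => chi _; rewrite conjcM conjcK; ring.
  rewrite exchange_big/=; apply: eq_bigr => chi _; rewrite -mulr_sumr -/(x chi); ring.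
have XE : X = (\sum_(chi <- S) normc (x chi) ^+ 2)%:C.
  by rewrite /X rmorph_sum; apply: eq_bigr => chi _; exact: mulc_conj.
have wc : \sum_(n < q) w n * (conjc (c n)) = P * X.
  transitivity ((conjc (\sum_(n < q) c n * (conjc (w n))))).
    by rewrite conjc_sum; apply: eq_bigr => n _; rewrite conjcM conjcK mulrC.
  by rewrite cw conjcM Pc XE conjc_real.
have PP : P * (q.-1)%:R = 1.
  by rewrite /P -(rmorph_nat (real_complex R)) -rmorphM/= mulVf ?gt_eqF// rmorph1.
have ww : \sum_(n < q) w n * (conjc (w n)) = P * X.
  clear cw XE wc; clearbody x.
  transitivity (\sum_(n < q) \sum_(chi <- S) \sum_(psi <- S)
      P * P * x chi * (conjc (x psi)) * (psi n * (conjc (chi n)))).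
    apply: eq_bigr => n _; rewrite {2}/w conjcM Pc conjc_sum /w mulr_sumr mulr_suml.
    apply: eq_bigr => chi _; rewrite !mulr_sumr.
    by apply: eq_bigr => psi _; rewrite conjcM conjcK; ring.
  rewrite exchange_big/= /X mulr_sumr big_seq [RHS]big_seq; apply: eq_bigr => chi chiS.
  rewrite exchange_big/= (bigD1_seq chi)//= [X in _ + X]big1_seq ?addr0 => [|psi /andP[pc psiS]].
    rewrite -mulr_sumr (sum_normc_char_sqr (hS _ chiS)).
    have -> : P * P * x chi * conjc (x chi) * (q.-1)%:R = (P * (q.-1)%:R) * (P * (x chi * conjc (x chi))) by ring.
    by rewrite PP mul1r.
  by rewrite -mulr_sumr (char_ortho (hS _ psiS) (hS _ chiS)) ?mulr0//; apply/eqP.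
have cc : \sum_(n < q) c n * (conjc (c n)) = (\sum_(n < q | (0 < n)%N) normc (c n) ^+ 2)%:C.
  rewrite rmorph_sum/= [RHS]big_mkcond/=; apply: eq_bigr => n _.
  by case: posnP => [->|_]; rewrite ?c0 ?mul0r// mulc_conj.
have : 0 <= \sum_(n < q) normc (c n - w n) ^+ 2 by apply: sumr_ge0 => n _; exact: sqr_ge0.
have -> : \sum_(n < q) normc (c n - w n) ^+ 2 = \sum_(n < q | (0 < n)%N) normc (c n) ^+ 2
   - (q.-1)%:R^-1 * \sum_(chi <- S) normc (x chi) ^+ 2.
  apply: (@complexI R); rewrite rmorph_sum/= rmorphB rmorphM/= -cc -XE -/P.
  transitivity (\sum_(n < q) (c n * (conjc (c n)) - c n * (conjc (w n)) - w n * (conjc (c n)) + w n * (conjc (w n)))).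
    by apply: eq_bigr => n _; rewrite -mulc_conj conjcB; ring.
  by rewrite big_split/= sumrB sumrB cw wc ww; ring.
by rewrite subr_ge0 mulrC ler_pdivrMr// mulrC.
Qed.

Definition ee (n : nat) : C := cexp (0 +i* (pi *+ 2 * n%:R / q%:R)).

Lemma eeD m n : ee (m + n) = ee m * ee n.
Proof.
rewrite /ee -cexpD; congr cexp; apply/eqP; rewrite eq_complex/= addr0 eqxx/=.
by apply/eqP; rewrite natrD; ring.
Qed.

Lemma ee0 : ee 0 = 1.
Proof. by rewrite /ee mulr0 mul0r cexp0. Qed.

Lemma eeM m n : ee (m * n) = ee m ^+ n.
Proof. by elim: n => [|n IH]; rewrite ?muln0 ?ee0// mulnS eeD IH exprS. Qed.

Lemma eeq : ee q = 1.
Proof.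
by rewrite /ee mulfK ?pnatr_eq0 -?lt0n// cexp_2pi.
Qed.

Lemma ee_mod n : ee (n %% q) = ee n.
Proof. by rewrite {2}(divn_eq n q) mulnC eeD eeM eeq expr1n mul1r. Qed.

Lemma normc_ee n : normc (ee n) = 1.
Proof. by rewrite normc_cexp/= expR0. Qed.

Lemma ee_conj n : ee n * (conjc (ee n)) = 1.
Proof. by rewrite mulc_conj normc_ee expr1n. Qed.

Lemma ee_neq1 d : (0 < d < q)%N -> ee d != 1.
Proof.
case/andP=> d0 dq; rewrite -subr_eq0 -normc_eq0 normc_cis_sub1 mulf_eq0 negb_or pnatr_eq0/=.
have q0' : 0 < q%:R :> R by rewrite ltr0n.
rewrite normr_eq0 gt_eqF// sin_gt0_pi//.
have -> : pi *+ 2 * d%:R / q%:R / 2 = pi * (d%:R / q%:R) :> R by rewrite -mulr_natr; field; rewrite gt_eqF.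
have p0 := pi_gt0 R.
apply/andP; split; first by rewrite mulr_gt0// divr_gt0// ltr0n.
by rewrite gtr_pMr// ltr_pdivrMr// mul1r ltr_nat.
Qed.

Lemma sum_ee m m' : (m < q)%N -> (m' < q)%N ->
  \sum_(r < q) ee (m * r) * (conjc (ee (m' * r))) = (if m == m' then q else 0)%:R.
Proof.
wlog mm : m m' / (m' <= m)%N.
  move=> h mq m'q; case: (leqP m' m) => [|/ltnW] mm; first exact: h.
  have := h _ _ mm m'q mq; rewrite eq_sym => e.
  have <- : conjc ((if m == m' then q else 0)%:R : C) = (if m == m' then q else 0)%:R by exact: conjc_nat.
  rewrite -e conjc_sum; apply: eq_bigr => r _.
  by rewrite [RHS]conjcM conjcK mulrC.
move=> mq m'q.
transitivity (\sum_(r < q) ee (m - m') ^+ r).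
  apply: eq_bigr => r _; rewrite -eeM -{1}(subnK mm) mulnDl eeD -mulrA.
  by rewrite ee_conj mulr1.
case: eqP => [->|/eqP ne].
  rewrite subnn ee0 (eq_bigr (fun=> 1)) => [|r _]; last by rewrite expr1n.
  by rewrite sumr_const card_ord.
have d1 : (0 < m - m' < q)%N.
  by rewrite subn_gt0 ltn_neqAle eq_sym ne mm (leq_ltn_trans (leq_subr _ _)).
have := ee_neq1 d1; rewrite -subr_eq0 => h; apply: (mulfI h).
by rewrite mulr0 -subrX1 -eeM mulnC eeM eeq expr1n subrr.
Qed.

Definition gauss_sum chi : C := \sum_(m < q) chi m * ee m.

(** For r prime to q, substitute m r for m in the Gauss sum. If q divides r, the left side is the
    sum of chi, which vanishes as chi is not principal. *)
Lemma gauss_sum_twist chi r : dirichlet_character q chi ->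
  chi <> principal_character R q ->
  \sum_(m < q) chi m * ee (m * r) = (conjc (chi r)) * gauss_sum chi.
Proof.
move=> hc np; have [_ mul supp] := hc.
case: (boolP (coprime r q)) => cr; last first.
  have cr0 : chi r = 0 by apply/eqP; rewrite -[_ == _]negbK supp.
  rewrite cr0 conjc0 mul0r -[RHS](char_sum0 hc np); apply: eq_bigr => m _.
  move: cr; rewrite coprime_sym prime_coprime// negbK => /dvdnP[k ->].
  by rewrite mulnA -ee_mod modnMl ee0 mulr1.
rewrite /gauss_sum mulr_sumr (sum_mulmod (fun m => (conjc (chi r)) * (chi m * ee m)) cr).
apply: eq_bigr => m _; rewrite char_mod// ee_mod mul mulnC.
have h : (conjc (chi r)) * chi r = 1 by rewrite mulrC mulc_conj normc_char// expr1n.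
by rewrite !mulrA h mul1r.
Qed.

(** The sum over r of the squared twisted Gauss sums is computed twice: as (q - 1) |tau|^2 by
    twisting and as q (q - 1) by orthogonality of the additive characters. *)
Lemma normc_gauss_sum chi : dirichlet_character q chi ->
  chi <> principal_character R q -> normc (gauss_sum chi) ^+ 2 = q%:R.
Proof.
move=> hc np.
have p0 : 0 < (q.-1)%:R :> R by rewrite ltr0n -ltnS prednK.
have h1 : \sum_(r < q) ((conjc (chi r)) * gauss_sum chi) * (conjc ((conjc (chi r)) * gauss_sum chi))
   = ((q.-1)%:R * normc (gauss_sum chi) ^+ 2)%:C.
  rewrite rmorphM/= rmorph_nat -mulc_conj -(sum_normc_char_sqr hc) mulr_suml.
  by apply: eq_bigr => r _; rewrite conjcM conjcK; ring.
have h2 : \sum_(r < q) ((conjc (chi r)) * gauss_sum chi) * (conjc ((conjc (chi r)) * gauss_sum chi))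
   = (q.-1)%:R * q%:R.
  transitivity (\sum_(r < q) \sum_(m < q) \sum_(m' < q)
    chi m * (conjc (chi m')) * (ee (m * r) * (conjc (ee (m' * r))))).
    apply: eq_bigr => r _; rewrite -gauss_sum_twist// mulr_suml; apply: eq_bigr => m _.
    rewrite conjc_sum mulr_sumr; apply: eq_bigr => m' _; rewrite conjcM; ring.
  rewrite exchange_big/= -(sum_normc_char_sqr hc) mulr_suml; apply: eq_bigr => m _.
  rewrite exchange_big/= (bigD1 m)//= [X in _ + X]big1 ?addr0 => [|m' mm'].
    by rewrite -mulr_sumr sum_ee// eqxx.
  by rewrite -mulr_sumr sum_ee// eq_sym (negbTE (mm' : nat_of_ord m' != m)) mulr0.
move: h1; rewrite h2 -natrM -(rmorph_nat (real_complex R)) natrM => /(@complexI R).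
by move/(mulfI (lt0r_neq0 p0)).
Qed.

(** The twist formula for the conjugate character, read as an expansion of chi in additive
    characters; this is the source of the duality. *)
Lemma char_gauss chi r : dirichlet_character q chi ->
  chi <> principal_character R q ->
  chi r * gauss_sum (conj_character chi) = \sum_(m < q) (conjc (chi m)) * ee (m * r).
Proof.
move=> hc np; have np' : conj_character chi <> principal_character R q.
  by move=> e; apply: np; rewrite -(conj_characterK chi) e conj_principal.
by rewrite -[X in X * _]conjcK -(gauss_sum_twist r (conj_char hc) np').
Qed.

End Characters.

(** * Integrals with exponential decay *)

Section ComplexIntegral.
Variable R : realType.
Local Notation C := R[i].
Local Notation mu := (@lebesgue_measure R).
Implicit Types (f g : R -> C) (a b u v : R).

Definition cmeas f := measurable_fun setT (fun v => complex.Re (f v)) /\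
  measurable_fun setT (fun v => complex.Im (f v)).

Lemma cmeas_ext f g : f =1 g -> cmeas f -> cmeas g.
Proof. by move=> /funext ->. Qed.

Lemma cmeas_cst (z : C) : cmeas (fun=> z).
Proof. by split; exact: measurable_cst. Qed.

Lemma cmeas_real (h : R -> R) : measurable_fun setT h -> cmeas (fun v => (h v)%:C).
Proof. by move=> mh; split => //=; exact: measurable_cst. Qed.

Lemma cmeasD f g : cmeas f -> cmeas g -> cmeas (fun v => f v + g v).
Proof.
move=> [f1 f2] [g1 g2]; split.
- rewrite (_ : (fun v => _) = (fun v => complex.Re (f v) + complex.Re (g v))).
    exact: measurable_funD.
  by apply/funext => v; case: (f v); case: (g v).
- rewrite (_ : (fun v => _) = (fun v => complex.Im (f v) + complex.Im (g v))).
    exact: measurable_funD.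
  by apply/funext => v; case: (f v); case: (g v).
Qed.

Lemma cmeasM f g : cmeas f -> cmeas g -> cmeas (fun v => f v * g v).
Proof.
move=> [f1 f2] [g1 g2]; split.
- rewrite (_ : (fun v => _) = (fun v => complex.Re (f v) * complex.Re (g v) - complex.Im (f v) * complex.Im (g v))).
    by apply: measurable_funB; apply: measurable_funM.
  by apply/funext => v; case: (f v); case: (g v).
- rewrite (_ : (fun v => _) = (fun v => complex.Re (f v) * complex.Im (g v) + complex.Im (f v) * complex.Re (g v))).
    by apply: measurable_funD; apply: measurable_funM.
  by apply/funext => v; case: (f v); case: (g v).
Qed.

Lemma cmeasB f g : cmeas f -> cmeas g -> cmeas (fun v => f v - g v).
Proof.
move=> mf mg; apply: (cmeas_ext (f := fun v => f v + (-1) * g v)).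
  by move=> v; rewrite mulN1r.
by apply: cmeasD => //; apply: cmeasM => //; exact: cmeas_cst.
Qed.

Lemma cmeas_sum (I : Type) (r : seq I) (P : pred I) (F : I -> R -> C) :
  (forall i, P i -> cmeas (F i)) -> cmeas (fun v => \sum_(i <- r | P i) F i v).
Proof.
move=> mF; elim: r => [|i r IH].
  by apply: (cmeas_ext (f := fun=> 0)); [move=> v; rewrite big_nil|exact: cmeas_cst].
case: (boolP (P i)) => Pi.
  apply: (cmeas_ext (f := fun v => F i v + \sum_(j <- r | P j) F j v)).
    by move=> v; rewrite big_cons Pi.
  by apply: cmeasD => //; exact: mF.
by apply: cmeas_ext IH => v; rewrite big_cons (negbTE Pi).
Qed.

Lemma cmeas_if (b : R -> bool) f g : measurable_fun setT b -> cmeas f -> cmeas g ->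
  cmeas (fun v => if b v then f v else g v).
Proof.
move=> mb [f1 f2] [g1 g2]; split.
- rewrite (_ : (fun v => _) = (fun v => if b v then complex.Re (f v) else complex.Re (g v))).
    by apply: measurable_fun_ifT.
  by apply/funext => v; case: (b v).
- rewrite (_ : (fun v => _) = (fun v => if b v then complex.Im (f v) else complex.Im (g v))).
    by apply: measurable_fun_ifT.
  by apply/funext => v; case: (b v).
Qed.

Lemma cmeas_inv f : (forall v, f v != 0) -> cmeas f -> cmeas (fun v => (f v)^-1).
Proof.
move=> f0 [f1 f2].
pose N v := complex.Re (f v) ^+ 2 + complex.Im (f v) ^+ 2.
have N0 v : 0 < N v by rewrite /N -normc_sqr exprn_gt0// normc_gt0.
have mN : measurable_fun setT (fun v => (N v)^-1).
  (* The inverse of the positive [N] is written exp(- ln N), a composition of measurable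
     functions. *)
  rewrite (_ : (fun v => _) = (fun v => expR (- ln (N v)))).
    apply: measurableT_comp; first exact: measurable_expR.
    apply: measurable_funN; apply: measurableT_comp; first exact: measurable_ln.
    by apply: measurable_funD; apply: measurable_funX.
  by apply/funext => v; rewrite expRN lnK// posrE.
have e v : (f v)^-1 = (complex.Re (f v) * (N v)^-1) +i* (- complex.Im (f v) * (N v)^-1).
  by rewrite /N; case: (f v) => x y; apply/eqP; rewrite eq_complex/= mulNr !eqxx.
split.
- rewrite (_ : (fun v => _) = (fun v => complex.Re (f v) * (N v)^-1)).
    exact: measurable_funM.
  by apply/funext => v; rewrite e.
- rewrite (_ : (fun v => _) = (fun v => - complex.Im (f v) * (N v)^-1)).
    by apply: measurable_funM => //; exact: measurable_funN.
  by apply/funext => v; rewrite e.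
Qed.

Lemma cmeas_cexp (z : C) : cmeas (fun v => cexp (z * v%:C)).
Proof.
case: z => x y.
have me k : measurable_fun setT (fun v : R => k * v) by exact: mulrl_measurable.
have mx : measurable_fun setT (fun v : R => expR (x * v)).
  by apply: measurableT_comp; [exact: measurable_expR|exact: me].
split.
- rewrite (_ : (fun v => _) = (fun v => expR (x * v) * cos (y * v))).
    apply: measurable_funM => //; apply: measurableT_comp; last exact: me.
    by apply: continuous_measurable_fun; exact: continuous_cos.
  by apply/funext => v; rewrite /cexp/= !(mulr0,mul0r,subr0,add0r,addr0).
- rewrite (_ : (fun v => _) = (fun v => expR (x * v) * sin (y * v))).
    apply: measurable_funM => //; apply: measurableT_comp; last exact: me.
    by apply: continuous_measurable_fun; exact: continuous_sin.
  by apply/funext => v; rewrite /cexp/= !(mulr0,mul0r,subr0,add0r,addr0).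
Qed.

(** One majorant for all integrands. For Re s in [3/8, 5/8] they decay like exp(- 3 |v| / 8); the
    slower rate 1/8 leaves room to absorb translations, small changes of s and the gain from a
    restricted support. *)
Definition weight v : R := expR (- (`|v| / 8)).

Lemma weight_ge0 v : 0 <= weight v. Proof. exact: expR_ge0. Qed.

Lemma continuous_weight : continuous weight.
Proof.
move=> v; apply: continuous_comp; last exact: continuous_expR.
apply: (@continuousN _ R^o); apply: (@continuousM _ R^o (fun v => `|v|) (fun=> 8^-1)); last exact: cst_continuous.
exact: norm_continuous.
Qed.

Lemma integrable_weight : mu.-integrable setT (EFin \o weight).
Proof.
have mw : measurable_fun setT weight by exact: continuous_measurable_fun continuous_weight.
apply/integrableP; split; first exact/measurable_EFinP.
under eq_integral do rewrite /= ger0_norm ?weight_ge0//.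
rewrite ge0_symfun_integralT; last 3 first.
- exact: weight_ge0.
- exact: continuous_weight.
- by move=> v; rewrite /= /weight normrN.
rewrite lte_mul_pinfty//.
have h8 : 0 < 8^-1 :> R by rewrite invr_gt0.
have mp : measurable_fun setT (EFin \o exponential_pdf (8^-1 : R)).
  by apply/measurable_EFinP; exact: measurable_exponential_pdf.
have p0 (x : R) : (0 <= (exponential_pdf 8^-1 x)%:E)%E.
  by rewrite lee_fin exponential_pdf_ge0// ltW.
rewrite -set_itvcy.
have -> : (\int[mu]_(x in `[0%R, +oo[) (weight x)%:E =
    \int[mu]_(x in `[0%R, +oo[) (8%:E * (exponential_pdf 8^-1 x)%:E))%E.
  apply: eq_integral => x; rewrite inE/= in_itv/= andbT => x0.
  rewrite exponential_pdfE// -EFinM mulrA mulfV// mul1r /weight ger0_norm//.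
  by congr (expR _)%:E; lra.
rewrite ge0_integralZl_EFin//; last exact: measurable_funS mp.
rewrite lte_mul_pinfty//.
apply: (@le_lt_trans _ _ (\int[mu]_x (exponential_pdf 8^-1 x)%:E)%E).
  exact: ge0_subset_integral.
by rewrite integral_exponential_pdf// ltry.
Qed.

Definition dominated (B : R) f := forall v, normc (f v) <= B * weight v.

Lemma integrable_dominated B f : cmeas f -> dominated B f ->
  mu.-integrable setT (EFin \o (fun v => complex.Re (f v))) /\
  mu.-integrable setT (EFin \o (fun v => complex.Im (f v))).
Proof.
move=> [m1 m2] dB.
have iB : mu.-integrable setT (fun v => B%:E * (EFin \o weight) v)%E.
  by apply: integrableZl => //; exact: integrable_weight.
split.
- apply: le_integrable iB => //; first exact/measurable_EFinP.
  move=> v _; rewrite /= lee_fin; apply: (le_trans (Re_le_normc _)).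
  exact: le_trans (dB v) (ler_norm _).
- apply: le_integrable iB => //; first exact/measurable_EFinP.
  move=> v _; rewrite /= lee_fin; apply: (le_trans (Im_le_normc _)).
  exact: le_trans (dB v) (ler_norm _).
Qed.

Definition cint f : C := (\int[mu]_v complex.Re (f v)) +i* (\int[mu]_v complex.Im (f v)).

Lemma eq_cint f g : f =1 g -> cint f = cint g.
Proof. by move=> /funext ->. Qed.

Definition weight_mass : R := \int[mu]_v weight v.

Lemma weight_mass_ge0 : 0 <= weight_mass.
Proof. by apply: Rintegral_ge0 => v _; exact: weight_ge0. Qed.

Lemma cintD Bf Bg f g : cmeas f -> cmeas g -> dominated Bf f -> dominated Bg g ->
  cint (fun v => f v + g v) = cint f + cint g.
Proof.
move=> mf mg df dg.
have [f1 f2] := integrable_dominated mf df; have [g1 g2] := integrable_dominated mg dg.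
apply/eqP; rewrite eq_complex/= -RintegralD// -RintegralD//.
by apply/andP; split; apply/eqP; apply: eq_Rintegral => v _; case: (f v); case: (g v).
Qed.

Lemma cintZ B (z : C) f : cmeas f -> dominated B f -> cint (fun v => z * f v) = z * cint f.
Proof.
move=> mf df; have [f1 f2] := integrable_dominated mf df.
have iZ (k : R) (h : R -> R) : mu.-integrable setT (EFin \o h) ->
    mu.-integrable setT (EFin \o (fun v => k * h v)).
  move=> ih; have := @integrableZl _ _ _ mu setT measurableT k _ ih.
  by apply: eq_integrable => // v _; rewrite /= EFinM.
case: z => x y; apply/eqP; rewrite eq_complex/= -!RintegralZl//.
rewrite -RintegralB; [|by []|exact: iZ|exact: iZ].
rewrite -RintegralD; [|by []|exact: iZ|exact: iZ].
by apply/andP; split; apply/eqP; apply: eq_Rintegral => v _; case: (f v).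
Qed.

Lemma dominatedD Bf Bg f g : dominated Bf f -> dominated Bg g ->
  dominated (Bf + Bg) (fun v => f v + g v).
Proof.
by move=> df dg v; apply: (le_trans (le_normcD _ _)); rewrite mulrDl lerD.
Qed.

Lemma dominatedZ B (z : C) f : dominated B f -> dominated (normc z * B) (fun v => z * f v).
Proof. by move=> df v; rewrite normcM -mulrA ler_wpM2l ?normc_ge0. Qed.

Lemma cintB Bf Bg f g : cmeas f -> cmeas g -> dominated Bf f -> dominated Bg g ->
  cint (fun v => f v - g v) = cint f - cint g.
Proof.
move=> mf mg df dg.
rewrite (eq_cint (g := fun v => f v + (-1) * g v)) => [|v]; last by rewrite mulN1r.
have mN : cmeas (fun v => -1 * g v) by apply: cmeasM => //; exact: cmeas_cst.
by rewrite (cintD mf mN df (dominatedZ (-1) dg)) (cintZ _ mg dg) mulN1r.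
Qed.

Lemma cint0 : cint (fun=> 0) = 0.
Proof.
rewrite (eq_cint (g := fun v => 0 * 0)) => [|v]; last by rewrite mul0r.
rewrite (@cintZ 0 0 (fun=> 0)); [by rewrite mul0r|exact: cmeas_cst|].
by move=> v; rewrite normc0 mul0r.
Qed.

Lemma cint_sum (I : finType) (B : I -> R) (F : I -> R -> C) :
  (forall i, cmeas (F i)) -> (forall i, dominated (B i) (F i)) ->
  cint (fun v => \sum_i F i v) = \sum_i cint (F i).
Proof.
move=> mF dF; rewrite -!big_enum/=.
suff h (r : seq I) : dominated (\sum_(i <- r) B i) (fun v => \sum_(i <- r) F i v) /\
    cint (fun v => \sum_(i <- r) F i v) = \sum_(i <- r) cint (F i).
  have [_] := h (enum I); rewrite !big_enum/= => <-.
  by apply: eq_cint => v; rewrite big_enum.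
elim: r => [|i r [IH1 IH2]].
  split; first by move=> v; rewrite !big_nil normc0 mul0r.
  by rewrite big_nil (eq_cint (g := fun=> 0)) ?cint0// => v; rewrite big_nil.
split.
  by move=> v; rewrite !big_cons; exact: (dominatedD (dF i) IH1).
rewrite big_cons (eq_cint (g := fun v => F i v + \sum_(j <- r) F j v)) => [|v]; last by rewrite big_cons.
rewrite (cintD (mF i) _ (dF i) IH1) ?IH2//.
exact: cmeas_sum.
Qed.

Lemma shift_integral (h : R -> R) a : continuous h -> (forall v, 0 <= h v) ->
  (\int[mu]_v (h (v + a))%:E = \int[mu]_v (h v)%:E)%E.
Proof.
move=> ch h0.
pose F (x : R^o) := x + a.
have dF : F^`()%classic = cst 1.
  by apply/funext => x; rewrite /F derive1E deriveD// derive_id derive_cst addr0.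
rewrite [RHS](@increasing_ge0_integration_by_substitutionT _ F)//.
- by apply: eq_integral => v _; rewrite fctE dF /cst/= mulr1.
- by move=> x y xy; rewrite /= ltrD2r.
- by rewrite dF => x; exact: cst_continuous.
- by rewrite dF; exact: is_cvg_cst.
- by rewrite dF; exact: is_cvg_cst.
- exact: cvg_addrr_Ny.
- exact: cvg_addrr.
Qed.

Lemma integrable_shift_weight a : mu.-integrable setT (EFin \o (fun v => weight (v + a))).
Proof.
have ca : continuous (fun v => weight (v + a)).
  move=> v; apply: continuous_comp; last exact: continuous_weight.
  by apply: (@continuousD _ R^o _ id (fun=> a)); [exact: cvg_id|exact: cst_continuous].
have /integrableP[_ h] := integrable_weight.
apply/integrableP; split.
  by apply/measurable_EFinP; exact: continuous_measurable_fun.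
move: h; under eq_integral do rewrite /= ger0_norm ?weight_ge0//.
move=> h; under eq_integral do rewrite /= ger0_norm ?weight_ge0//.
by rewrite (shift_integral a continuous_weight weight_ge0).
Qed.

Lemma shift_weight_mass a : \int[mu]_v weight (v + a) = weight_mass.
Proof.
by rewrite /weight_mass /Rintegral (shift_integral a continuous_weight weight_ge0).
Qed.

(** The factor 2 comes from bounding real and imaginary part separately. The mass of a translated
    weight does not depend on [a], which saves the factor exp(|a| / 8) of a pointwise comparison. *)
Lemma cint_norm_le B a f : cmeas f -> (forall v, normc (f v) <= B * weight (v + a)) ->
  normc (cint f) <= 2 * B * weight_mass.
Proof.
move=> mf df; have [m1 m2] := mf.
have iB : mu.-integrable setT (EFin \o (fun v => B * weight (v + a))).
  have := @integrableZl _ _ _ mu setT measurableT B _ (integrable_shift_weight a).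
  by apply: eq_integrable => // v _; rewrite /= EFinM.
have eB : \int[mu]_v (B * weight (v + a)) = B * weight_mass.
  by rewrite RintegralZl ?shift_weight_mass//; exact: integrable_shift_weight.
have h (k : R -> R) : measurable_fun setT k -> (forall v, `|k v| <= B * weight (v + a)) ->
    `|\int[mu]_v k v| <= B * weight_mass.
  move=> mk kB.
  have ik : mu.-integrable setT (EFin \o k).
    apply: le_integrable iB => //; first exact/measurable_EFinP.
    by move=> v _; rewrite /= lee_fin (le_trans (kB v))// ler_norm.
  apply: (le_trans (le_normr_Rintegral measurableT ik)); rewrite -eB.
  apply: le_Rintegral => //; exact: integrable_norm.
apply: (le_trans (normc_le_ReIm _)); rewrite -mulrA mulr_natl mulr2n.
apply: lerD; apply: h => // v; apply: le_trans (df v).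
  exact: Re_le_normc.
exact: Im_le_normc.
Qed.

Lemma cint_norm_le0 B f : cmeas f -> dominated B f ->
  normc (cint f) <= 2 * B * weight_mass.
Proof. by move=> mf df; apply: (@cint_norm_le B 0) => // v; rewrite addr0; exact: df. Qed.

(** The substitution rule is applied to nonnegative functions, so [B * weight] is added first and
    its translation invariant integral subtracted afterwards. *)
Lemma shift_Rintegral B (h : R -> R) a : continuous h -> (forall v, `|h v| <= B * weight v) ->
  \int[mu]_v h (v + a) = \int[mu]_v h v.
Proof.
move=> ch hB.
have ca : continuous (fun v : R => v + a).
  by move=> v; apply: (@continuousD _ R^o _ id (fun=> a)); [exact: cvg_id|exact: cst_continuous].
have B0 v : 0 <= h v + B * weight v.
  by have := hB v; rewrite ler_norml => /andP[]; lra.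
have cB : continuous (fun v => B * weight v).
  move=> v; apply: (@continuousM _ R^o (fun=> B) weight); first exact: cst_continuous.
  exact: continuous_weight.
have chB : continuous (fun v => h v + B * weight v).
  by move=> v; apply: (@continuousD _ R^o _ h (fun v => B * weight v)); [exact: ch|exact: cB].
have iw b : mu.-integrable setT (EFin \o (fun v => B * weight (v + b))).
  have := @integrableZl _ _ _ mu setT measurableT B _ (integrable_shift_weight b).
  by apply: eq_integrable => // v _; rewrite /= EFinM.
have ih b : mu.-integrable setT (EFin \o (fun v => h (v + b))).
  apply: le_integrable (iw b) => //.
    apply/measurable_EFinP; apply: continuous_measurable_fun => v.
    apply: continuous_comp; last exact: ch.
    by apply: (@continuousD _ R^o _ id (fun=> b)); [exact: cvg_id|exact: cst_continuous].
  by move=> v _; rewrite /= lee_fin (le_trans (hB _))// ler_norm.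
have e b : \int[mu]_v h (v + b) = \int[mu]_v (h v + B * weight v) - B * weight_mass.
  have -> : \int[mu]_v (h v + B * weight v) = \int[mu]_v (h (v + b) + B * weight (v + b)).
    by rewrite /Rintegral (shift_integral b chB B0).
  rewrite RintegralD// RintegralZl// ?shift_weight_mass; last exact: integrable_shift_weight.
  by rewrite addrK.
rewrite e; have := e 0.
have -> : \int[mu]_v h (v + 0) = \int[mu]_v h v by apply: eq_Rintegral => v _; rewrite addr0.
by move=> ->.
Qed.

Lemma cint_shift B f a : continuous (fun v => complex.Re (f v)) ->
  continuous (fun v => complex.Im (f v)) -> dominated B f ->
  cint (fun v => f (v + a)) = cint f.
Proof.
move=> c1 c2 df; apply/eqP; rewrite eq_complex/=.
rewrite (@shift_Rintegral B (fun v => complex.Re (f v)) a c1); last first.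
  by move=> v; exact: le_trans (Re_le_normc _) (df v).
rewrite (@shift_Rintegral B (fun v => complex.Im (f v)) a c2) ?eqxx//.
by move=> v; exact: le_trans (Im_le_normc _) (df v).
Qed.

End ComplexIntegral.

(** * A smooth cutoff that is a short exponential polynomial *)

Section TrigCutoff.
Variable R : realType.
Local Notation C := R[i].

Definition cis (t : R) : C := cexp (0 +i* t).

Lemma cisD s t : cis (s + t) = cis s * cis t.
Proof. by rewrite /cis -cexpD; congr cexp; apply/eqP; rewrite eq_complex/= addr0 !eqxx. Qed.

Lemma cis0 : cis 0 = 1. Proof. exact: cexp0. Qed.

Lemma normc_cis t : normc (cis t) = 1.
Proof. by rewrite normc_cexp/= expR0. Qed.

Lemma cisN t : cis (- t) = (cis t)^-1.
Proof. by rewrite /cis -cexpN; congr cexp; apply/eqP; rewrite eq_complex/= oppr0 !eqxx. Qed.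

Lemma cisM t n : cis (t * n%:R) = cis t ^+ n.
Proof.
elim: n => [|n IH]; first by rewrite mulr0 cis0.
by rewrite -(@natr1 _ n) mulrDr mulr1 cisD IH exprSr.
Qed.

Lemma cis_lip s t : normc (cis s - cis t) <= `|s - t|.
Proof.
have -> : cis s - cis t = cis t * (cis (s - t) - 1).
  by rewrite mulrBr mulr1 -cisD (addrC t) subrK.
by rewrite normcM normc_cis mul1r; exact: normc_cis_sub1_le.
Qed.

Variables (r L : nat) (X : R).
Hypotheses (r0 : (0 < r)%N) (L0 : (0 < L)%N) (X0 : 0 < X).

(** The nodes are [period] equally spaced points of [- 64 X, 64 X) at distance [mesh], and the
    exponentials of frequency [freq k] have period 128 X. An average over L shifts spreads by less
    than L mesh steps, so r of them spread by less than r L mesh = X / 4. *)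
Definition half_period : nat := (256 * r * L)%N.
Definition period : nat := (half_period + half_period)%N.
Local Notation E := half_period.
Local Notation D := period.
Definition mesh : R := X / (4 * r%:R * L%:R).
Definition freq (k : nat) : R := pi *+ 2 * (k%:R - E%:R) / (128 * X).
Definition node (n : nat) : R := (n%:R - E%:R) * mesh.
(** Nodes 0 to 254 r L, that is, from - 64 X to - X / 2. *)
Let M := (254 * r * L + 1)%N.

(** The discrete Fourier coefficients of the indicator of the first M nodes; [avg_coef] is the
    multiplier of the average over shifts by 0, ..., L - 1 mesh steps to the right. *)
Definition box_coef (k : nat) : C := (D%:R^-1 : R)%:C * \sum_(i < M) cis (- (freq k * node i)).
Definition avg_coef (k : nat) : C := (L%:R^-1 : R)%:C * \sum_(l < L) cis (- (freq k * (l%:R * mesh))).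
Definition weight_coef rho k : C := box_coef k * avg_coef k ^+ rho.
Definition trig_poly rho v : C := \sum_(k < D) weight_coef rho k * cis (freq k * v).

Let r0' : 0 < r%:R :> R. Proof. by rewrite ltr0n. Qed.
Let L0' : 0 < L%:R :> R. Proof. by rewrite ltr0n. Qed.
Let E0 : (0 < E)%N. Proof. by rewrite /E !muln_gt0 r0. Qed.
Let D0 : (0 < D)%N. Proof. by rewrite /D addn_gt0 E0. Qed.
Let D0' : 0 < D%:R :> R. Proof. by rewrite ltr0n. Qed.
Let DE : D%:R = 512 * r%:R * L%:R :> R.
Proof. by rewrite /D natrD /E !natrM; ring. Qed.

Lemma freq_mesh k : freq k * mesh = pi *+ 2 * (k%:R - E%:R) / D%:R.
Proof. by rewrite /freq /mesh DE -mulr_natr; field; rewrite !gt_eqF. Qed.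

Lemma cis_2pi_nat n : cis (pi *+ 2 * n%:R) = 1.
Proof. by rewrite cisM /cis cexp_2pi expr1n. Qed.

Lemma sum_freq_eq0 n i : (n < D)%N -> (i < D)%N -> n != i ->
  \sum_(k < D) cis (freq k * (node n - node i)) = 0.
Proof.
move=> nD iD ni.
pose w := cis (pi *+ 2 * (n%:R - i%:R) / D%:R).
have e (k : nat) : cis (freq k * (node n - node i)) =
    cis (- (pi *+ 2 * E%:R * (n%:R - i%:R) / D%:R)) * w ^+ k.
  rewrite /w -cisM -cisD; congr cis.
  have -> : node n - node i = (n%:R - i%:R) * mesh by rewrite /node; ring.
  by rewrite mulrA mulrAC freq_mesh; ring.
under eq_bigr do rewrite e.
rewrite -mulr_sumr.
suff -> : \sum_(k < D) w ^+ k = 0 by rewrite mulr0.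
have w1 : w - 1 != 0.
  rewrite -normc_eq0 normc_cis_sub1 mulf_eq0 negb_or pnatr_eq0/= normr_eq0.
  have s0 (a b : nat) : (a < D)%N -> (b < a)%N ->
      0 < sin (pi *+ 2 * (a%:R - b%:R) / D%:R / 2) :> R.
    move=> aD ba; apply: sin_gt0_pi.
    have -> : pi *+ 2 * (a%:R - b%:R) / D%:R / 2 = pi * ((a - b)%N%:R / D%:R) :> R.
      by rewrite natrB ?(ltnW ba)// -mulr_natr; field; rewrite gt_eqF.
    apply/andP; split; first by rewrite mulr_gt0 ?pi_gt0// divr_gt0// ltr0n subn_gt0.
    rewrite gtr_pMr ?pi_gt0// ltr_pdivrMr// mul1r ltr_nat.
    by rewrite (leq_ltn_trans (leq_subr _ _)).
  case: (ltngtP n i) ni => // ni _; last by rewrite gt_eqF// s0.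
  have -> : pi *+ 2 * (n%:R - i%:R) / D%:R / 2 = - (pi *+ 2 * (i%:R - n%:R) / D%:R / 2) :> R by ring.
  by rewrite sinN oppr_eq0 gt_eqF// s0.
apply: (mulfI w1); rewrite mulr0 -subrX1.
have -> : w ^+ D = 1.
  rewrite /w -cisM divfK ?gt_eqF//.
  have -> : pi *+ 2 * (n%:R - i%:R) = pi *+ 2 * n%:R - pi *+ 2 * i%:R :> R by ring.
  by rewrite cisD cisN !cis_2pi_nat invr1 mulr1.
by rewrite subrr.
Qed.

Let MD : (M <= D)%N.
Proof. by rewrite /M /D /E; have := muln_gt0 r L; rewrite r0 L0/=; nia. Qed.

Lemma trig_poly0_node n : (n < D)%N -> trig_poly 0 (node n) = (n < M)%N%:R.
Proof.
move=> nD; rewrite /trig_poly.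
transitivity ((D%:R^-1 : R)%:C * \sum_(i < M) \sum_(k < D) cis (freq k * (node n - node i))).
  rewrite exchange_big/= mulr_sumr; apply: eq_bigr => k _.
  rewrite /weight_coef expr0 mulr1 /box_coef -mulrA mulr_suml; congr (_ * _).
  by apply: eq_bigr => i _; rewrite -cisD; congr cis; ring.
have Dc : (D%:R^-1 : R)%:C * D%:R = 1.
  by rewrite -(rmorph_nat (real_complex R)) -rmorphM/= mulVf ?gt_eqF// rmorph1.
case: ltnP => nM; last first.
  rewrite big1 ?mulr0// => i _; apply: sum_freq_eq0 => //.
    exact: leq_trans MD.
  by rewrite gtn_eqF// (leq_trans _ nM).
rewrite (bigD1 (Ordinal nM))//= [X in _ + X]big1 => [|i ni]; last first.
  apply: sum_freq_eq0 => //; first exact: leq_trans MD.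
  by apply: contra ni => /eqP e; apply/eqP/val_inj; rewrite /= e.
rewrite addr0 (eq_bigr (fun=> 1)) => [|k _]; last by rewrite subrr mulr0 cis0.
by rewrite sumr_const card_ord Dc.
Qed.

Lemma trig_polyS rho v :
  trig_poly rho.+1 v = (L%:R^-1 : R)%:C * \sum_(l < L) trig_poly rho (v - l%:R * mesh).
Proof.
rewrite /trig_poly exchange_big/= mulr_sumr; apply: eq_bigr => k _.
rewrite -mulr_sumr /weight_coef exprSr /avg_coef.
have -> : \sum_(l < L) cis (freq k * (v - l%:R * mesh)) =
    (\sum_(l < L) cis (- (freq k * (l%:R * mesh)))) * cis (freq k * v).
  by rewrite mulr_suml; apply: eq_bigr => l _; rewrite -cisD; congr cis; ring.
by move: (\sum_(l < L) _) (box_coef k) => S b; move: (_ ^+ rho) => a; ring.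
Qed.

(** Each average looks at most L - 1 nodes to the left: the range of exact ones loses L - 1 nodes at
    its left end, and the zeros begin L - 1 nodes later. Indices stay nonnegative, so the periodic
    continuation never interferes. *)
Lemma trig_poly_node rho n : (n < D)%N ->
  ((rho * L.-1 <= n < M)%N -> trig_poly rho (node n) = 1) /\
  ((M + rho * L.-1 <= n)%N -> trig_poly rho (node n) = 0).
Proof.
have Lc : (L%:R^-1 : R)%:C * L%:R = 1.
  by rewrite -(rmorph_nat (real_complex R)) -rmorphM/= mulVf ?gt_eqF// rmorph1.
elim: rho n => [|rho IH] n nD.
  rewrite trig_poly0_node// mul0n addn0 leq0n/=.
  by split=> [->//|]; rewrite leqNgt => /negbTE ->.
have nodeB (l : 'I_L) : (l <= n)%N -> node n - l%:R * mesh = node (n - l).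
  by move=> ln; rewrite /node natrB//; ring.
have lL (l : 'I_L) : (l <= L.-1)%N by rewrite -ltnS prednK.
split=> [/andP[n1 n2]|n1]; rewrite trig_polyS.
  rewrite (eq_bigr (fun=> 1)) => [|l _]; first by rewrite sumr_const card_ord Lc.
  have ll := lL l; have ln : (l <= n)%N by rewrite (leq_trans ll)// (leq_trans _ n1)// mulSn leq_addr.
  rewrite nodeB//; apply: (IH (n - l)%N _).1; first by rewrite (leq_ltn_trans (leq_subr _ _)).
  by apply/andP; split; [rewrite mulSn in n1; move: n1 ll; generalize (rho * L.-1)%N; lia|rewrite (leq_ltn_trans (leq_subr _ _))].
rewrite big1 ?mulr0// => l _; have ll := lL l.
have ln : (l <= n)%N.
  by rewrite (leq_trans ll)// (leq_trans _ n1)// mulSn addnCA leq_addr.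
rewrite nodeB//; apply: (IH (n - l)%N _).2; first by rewrite (leq_ltn_trans (leq_subr _ _)).
rewrite mulSn in n1; move: n1 ll; generalize (rho * L.-1)%N M; lia.
Qed.

Lemma normc_box_coef_le k : normc (box_coef k) <= 1.
Proof.
rewrite /box_coef normcM normcR ger0_norm ?invr_ge0//.
rewrite mulrC ler_pdivrMr// mul1r (le_trans (normc_sum _ _ _))//.
rewrite (eq_bigr (fun=> 1)) => [|i _]; last exact: normc_cis.
by rewrite sumr_const card_ord ler_nat.
Qed.

Lemma normc_avg_coef_le1 k : normc (avg_coef k) <= 1.
Proof.
rewrite /avg_coef normcM normcR ger0_norm ?invr_ge0//.
rewrite mulrC ler_pdivrMr// mul1r (le_trans (normc_sum _ _ _))//.
rewrite (eq_bigr (fun=> 1)) => [|i _]; last exact: normc_cis.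
by rewrite sumr_const card_ord.
Qed.

(** A geometric sum is at most 2 / |z - 1|, and |z - 1| >= |k - E| / D; dividing by L gives 2 D / (L
    |k - E|) with D = 512 r L. The bound is free of L, which will be as large as q^4. *)
Lemma normc_avg_coef_le (k : 'I_D) : k != E :> nat ->
  normc (avg_coef k) <= 1024 * r%:R / `|k%:R - E%:R|.
Proof.
move=> kE; set kap := k%:R - E%:R : R.
have kap0 : 0 < `|kap| by rewrite normr_gt0 subr_eq0 eqr_nat.
have kapE : `|kap| <= E%:R.
  rewrite ler_norml /kap; have : (k : nat)%:R <= D%:R :> R by rewrite ler_nat ltnW.
  by rewrite /D natrD => h; apply/andP; split; [have : 0 <= (k : nat)%:R :> R by []; lra|lra].
pose z := cis (- (freq k * mesh)).
have e (l : nat) : cis (- (freq k * (l%:R * mesh))) = z ^+ l.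
  by rewrite /z -cisM; congr cis; ring.
rewrite /avg_coef; under eq_bigr do rewrite e.
have hz : `|kap| / D%:R <= normc (z - 1).
  rewrite normc_cis_sub1 freq_mesh -/kap.
  have -> : - (pi *+ 2 * kap / D%:R) / 2 = - (pi * kap / D%:R) :> R.
    by rewrite -mulr_natr; field; rewrite gt_eqF.
  rewrite sinN normrN.
  have p2 := @pi_ge2 R; have p0 := @pi_gt0 R.
  have hs t : 0 <= t <= pi / 2 -> t / 4 <= sin t :> R by exact: sin_ge_quarter.
  have hn : `|sin (pi * kap / D%:R)| = `|sin (pi * `|kap| / D%:R)|.
    have [k0|k0] := leP 0 kap; first by rewrite (ger0_norm k0).
    by rewrite (ltr0_norm k0) mulrN mulNr sinN normrN.
  rewrite hn.
  have h1 : pi * `|kap| / D%:R / 4 <= sin (pi * `|kap| / D%:R).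
    apply: hs; rewrite divr_ge0 ?mulr_ge0 ?(ltW p0)//=.
    rewrite ler_pdivrMr// /D natrD; have -> : pi / 2 * (E%:R + E%:R) = pi * E%:R :> R by lra.
    by rewrite ler_wpM2l ?(ltW p0).
  have h2 := ler_norm (sin (pi * `|kap| / D%:R)).
  have h3 : 2 * (`|kap| / D%:R) <= pi * (`|kap| / D%:R).
    by rewrite ler_wpM2r// divr_ge0// ltW.
  rewrite mulrA in h3; lra.
have z1 : 0 < normc (z - 1) by rewrite (lt_le_trans _ hz)// divr_gt0.
have hs : normc (\sum_(l < L) z ^+ l) <= 2 / normc (z - 1).
  rewrite ler_pdivlMr// mulrC -normcM -subrX1 (le_trans (le_normcB _ _))//.
  by rewrite normcX normc_cis expr1n normc1.
rewrite normcM normcR ger0_norm ?invr_ge0//.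
apply: (@le_trans _ _ (L%:R^-1 * (2 / (`|kap| / D%:R)))).
  rewrite ler_wpM2l ?invr_ge0// (le_trans hs)// ler_wpM2l// lef_pV2 ?posrE ?divr_gt0//.
rewrite DE le_eqVlt; apply/orP; left; apply/eqP; field.
by rewrite !gt_eqF.
Qed.

Lemma sum_dist_le (f : nat -> R) : (forall n, 0 <= f n) ->
  \sum_(k < D) (if (k == E :> nat) then 0 else f `|k - E|%N) <= 2 * \sum_(n < D | (0 < n)%N) f n.
Proof.
move=> f0; rewrite [leLHS]big_split_ord/= mulr_natl mulr2n.
have hE : \sum_(n < E.+1 | (0 < n)%N) f n <= \sum_(n < D | (0 < n)%N) f n.
  apply: (@ler_sum_ord_sub R E.+1 D (fun n => 0 < n)%N (fun n => 0 < n)%N f f) => // p pE p0; split => //.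
  by rewrite (leq_trans pE)// /D -addn1 leq_add2l.
apply: lerD; apply: le_trans hE.
  rewrite [leRHS]big_mkcond big_ord_recl/= add0r (reindex_inj rev_ord_inj)/=.
  apply: ler_sum => i _; rewrite ltn_eqF; last by rewrite ltn_subrL E0.
  rewrite distnEr ?leq_subr// subKn//.
rewrite [leRHS]big_mkcond big_ord_recr/= E0; apply: ler_wpDr => //.
apply: ler_sum => i _; case: posnP => [->|i0]; first by rewrite addn0 eqxx.
by rewrite gtn_eqF ?distnEl ?leq_addr// ?addKn// -[X in (X < _)%N]addn0 ltn_add2l.
Qed.

(** With r = N + 2 averages the coefficients decay like |k - E|^(- N - 2), so the N-th moment is
    dominated by a sum of inverse squares on both sides of frequency 0. The term k = E gives the
    1. *)
Lemma weight_coef_sum_le N : (N + 2 = r)%N ->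
  \sum_(k < D) normc (weight_coef r k) * (1 + `|(k : nat)%:R - E%:R|) ^+ N
  <= 1 + 4 * ((1024 * r%:R) ^+ r * 2 ^+ N).
Proof.
move=> Nr; have havg := normc_avg_coef_le.
have c0 : 0 <= 1024 * r%:R :> R := mulr_ge0 (ler0n _ _) (ler0n _ _).
move: (1024 * r%:R) c0 havg => c c0 havg.
pose B : R := c ^+ r * 2 ^+ N.
have B0 : 0 <= B by apply: mulr_ge0; apply: exprn_ge0.
apply: (@le_trans _ _ (\sum_(k < D) ((if (k == E :> nat) then 1 else 0)
   + (if (k == E :> nat) then 0 else B * ((`|k - E|%N%:R : R) ^+ 2)^-1)))).
  apply: ler_sum => k _; case: eqP => [->|/eqP kE].
    rewrite subrr normr0 addr0 expr1n mulr1 ?addr0 /weight_coef normcM normcX.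
    rewrite -[leRHS]mulr1; apply: ler_pM; rewrite ?normc_ge0 ?exprn_ge0 ?normc_ge0 ?normc_box_coef_le//.
    by rewrite exprn_ile1 ?normc_ge0 ?normc_avg_coef_le1.
  rewrite add0r; have -> : (`|k - E|%N%:R : R) = `|(k : nat)%:R - E%:R|.
    case: (leqP k E) => h; first by rewrite distnEr// natrB// distrC ger0_norm// subr_ge0 ler_nat.
    by rewrite distnEl 1?ltnW// natrB 1?ltnW// ger0_norm// subr_ge0 ler_nat ltnW.
  have h1 := havg _ kE.
  have x1 : 1 <= `|(k : nat)%:R - E%:R| :> R.
    case: (ltngtP k E) kE => // h _.
      by rewrite distrC -natrB ?(ltnW h)// ger0_norm// ler1n subn_gt0.
    by rewrite -natrB ?(ltnW h)// ger0_norm// ler1n subn_gt0.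
  set x := `|_ - _| in x1 h1 *; have x0 : 0 < x by rewrite (lt_le_trans ltr01).
  rewrite /weight_coef normcM normcX.
  apply: (@le_trans _ _ ((c / x) ^+ r * (2 * x) ^+ N)).
    apply: ler_pM; rewrite ?mulr_ge0 ?exprn_ge0 ?normc_ge0 ?addr_ge0 ?(ltW x0)//.
      rewrite -[leRHS]mul1r; apply: ler_pM; rewrite ?normc_ge0 ?exprn_ge0 ?normc_ge0 ?normc_box_coef_le//.
      by rewrite lerXn2r ?nnegrE ?normc_ge0// divr_ge0 ?(ltW x0).
    by rewrite lerXn2r ?nnegrE ?addr_ge0 ?mulr_ge0 ?(ltW x0)//; lra.
  rewrite le_eqVlt; apply/orP; left; apply/eqP.
  have xr : x ^+ r = x ^+ N * x ^+ 2 by rewrite -exprD Nr.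
  have xN : x ^+ N != 0 by rewrite expf_neq0// gt_eqF.
  rewrite /B !exprMn exprVn xr; move: (x ^+ N) xN (c ^+ r) (2 ^+ N) => y y0 a b.
  by field; rewrite y0 gt_eqF.
rewrite big_split/=; apply: lerD.
  have hk : (E < D)%N by rewrite /D -[X in (X < _)%N]addn0 ltn_add2l.
  rewrite (bigD1 (Ordinal hk))//= eqxx big1 ?addr0// => k kE.
  by rewrite ifF//; apply/negbTE; apply: contra kE => /eqP kE; apply/eqP/val_inj.
apply: (le_trans (sum_dist_le (f := fun n => B * (n%:R ^+ 2)^-1) _)) => [n|].
  by rewrite mulr_ge0 ?invr_ge0 ?sqr_ge0.
rewrite -mulr_sumr; have := sum_inv_sqr_le R D; rewrite -/B; nra.
Qed.

(** Over one mesh step the phase of index k moves by at most 2 pi |k - E| / D <= 8 |k - E| / D, and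
    the moment bound with N >= 1 sums this. *)
Lemma trig_poly_lip N v v' : (0 < N)%N -> (N + 2 = r)%N -> `|v - v'| <= mesh ->
  normc (trig_poly r v - trig_poly r v')
  <= 8 * (1 + 4 * ((1024 * r%:R) ^+ r * 2 ^+ N)) / D%:R.
Proof.
move=> N0 Nr vv; rewrite /trig_poly -sumrB.
apply: (le_trans (normc_sum _ _ _)).
have h := weight_coef_sum_le Nr.
apply: (@le_trans _ _ (8 / D%:R * \sum_(k < D) normc (weight_coef r k) * (1 + `|(k : nat)%:R - E%:R|) ^+ N)); last first.
  by rewrite mulrAC ler_wpM2r ?invr_ge0// ler_wpM2l.
rewrite mulr_sumr; apply: ler_sum => k _.
rewrite -mulrBr normcM mulrCA ler_wpM2l ?normc_ge0//.
apply: (le_trans (cis_lip _ _)); rewrite -mulrBr normrM.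
apply: (@le_trans _ _ (`|freq k| * mesh)); first by rewrite ler_wpM2l.
have m0 : 0 <= mesh by rewrite /mesh divr_ge0 ?(ltW X0)// !mulr_ge0.
rewrite -{1}(ger0_norm m0) -normrM freq_mesh normrM normfV (ger0_norm (ltW D0')).
rewrite mulrAC ler_wpM2r ?invr_ge0//.
set x := `|_ - _|; have x0 : 0 <= x by rewrite /x.
have p2 := @pihalf_lt2 R; have p0 := @pi_gt0 R.
rewrite normrM -/x (ger0_norm (_ : 0 <= pi *+ 2)); last by rewrite -mulr_natr; lra.
apply: (@le_trans _ _ (8 * x)); first by rewrite ler_wpM2r// -mulr_natr; lra.
rewrite ler_wpM2l//; apply: (@le_trans _ _ (1 + x)); first by lra.
by rewrite -[leLHS]expr1 ler_weXn2l// lerDl.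
Qed.

(** The exact values 1 and 0 are imposed outside the transition because the cutoff is used on the
    whole line: the trigonometric polynomial is known to take them only at nodes, and it is
    periodic. *)
Definition cutoff v : C :=
  if v <= - (X / 2) then 1 else if v < - (X / 4) then trig_poly r v else 0.

Lemma cmeas_trig_poly rho : cmeas (trig_poly rho).
Proof.
apply: cmeas_sum => k _; apply: cmeasM; first exact: cmeas_cst.
apply: (cmeas_ext (f := fun v => cexp ((0 +i* freq k) * v%:C))); last exact: cmeas_cexp.
move=> v; rewrite /cis; congr cexp.
by apply/eqP; rewrite eq_complex/=; apply/andP; split; apply/eqP; ring.
Qed.

Lemma cmeas_cutoff : cmeas cutoff.
Proof.
apply: cmeas_if; [|exact: cmeas_cst|apply: cmeas_if; [|exact: cmeas_trig_poly|exact: cmeas_cst]].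
  by apply: measurable_fun_ler; [exact: measurable_id|exact: measurable_cst].
by apply: measurable_fun_ltr; [exact: measurable_id|exact: measurable_cst].
Qed.

Lemma normc_trig_poly_le v N : (N + 2 = r)%N ->
  normc (trig_poly r v) <= 1 + 4 * ((1024 * r%:R) ^+ r * 2 ^+ N).
Proof.
move=> Nr; apply: le_trans (weight_coef_sum_le Nr); apply: (le_trans (normc_sum _ _ _)).
apply: ler_sum => k _; rewrite normcM normc_cis; apply: ler_wpM2l; first exact: normc_ge0.
by rewrite exprn_ege1// lerDl.
Qed.

Lemma node_floor v : - (32 * X) <= v <= 32 * X ->
  exists n, [/\ (n < D)%N, `|v - node n| <= mesh & n%:R <= v / mesh + E%:R < n.+1%:R].
Proof.
case/andP=> v1 v2; pose y := v / mesh + E%:R.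
have m0 : 0 < mesh by rewrite /mesh divr_gt0 ?mulr_gt0.
have mX : 32 * X = 128 * r%:R * L%:R * mesh.
  by rewrite /mesh; field; rewrite !gt_eqF.
have rL0 : 0 < r%:R * L%:R :> R by rewrite mulr_gt0.
have EE : E%:R = 256 * r%:R * L%:R :> R by rewrite /E !natrM.
have a1 : - (128 * r%:R * L%:R) <= v / mesh.
  by rewrite ler_pdivlMr// mulNr -mX.
have a2 : v / mesh <= 128 * r%:R * L%:R.
  by rewrite ler_pdivrMr// -mX.
have y0 : 0 <= y by rewrite /y EE; lra.
have /andP[n1 n2] := truncn_itv y0.
exists (Num.truncn y); split.
- by rewrite -(ltr_nat R) (le_lt_trans n1)// /y DE EE; lra.
- have -> : v - node (Num.truncn y) = (y - (Num.truncn y)%:R) * mesh.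
    by rewrite /node /y; field; rewrite gt_eqF.
  rewrite ger0_norm; last by rewrite mulr_ge0 ?(ltW m0)// subr_ge0.
  by rewrite ger_pMl//; move: n2; rewrite -(@natr1 _ (Num.truncn y)); lra.
- by rewrite n1 n2.
Qed.

(** Outside the transition the polynomial takes the imposed value at the node just below v, and v is
    within one mesh step of that node. *)
Lemma cutoff_approx N v : (0 < N)%N -> (N + 2 = r)%N -> - (32 * X) <= v <= 32 * X ->
  normc (cutoff v - trig_poly r v) <= 8 * (1 + 4 * ((1024 * r%:R) ^+ r * 2 ^+ N)) / D%:R.
Proof.
move=> N0 Nr hv.
have [n [nD vn /andP[n1 n2]]] := node_floor hv.
have vn' : `|node n - v| <= mesh by rewrite distrC.
have lip := trig_poly_lip N0 Nr vn'.
have m0 : 0 < mesh by rewrite /mesh divr_gt0 ?mulr_gt0.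
have rL0 : 0 < r%:R * L%:R :> R by rewrite mulr_gt0.
have EE : E%:R = 256 * r%:R * L%:R :> R by rewrite /E !natrM.
have mX : X = 4 * r%:R * L%:R * mesh by rewrite /mesh; field; rewrite !gt_eqF.
have v0 : v = v / mesh * mesh by rewrite divfK ?gt_eqF.
have B0 : 0 <= normc (cutoff v - trig_poly r v) by exact: normc_ge0.
rewrite /cutoff; have [c1|c1] := leP v (- (X / 2)).
  have h : v / mesh <= - (2 * r%:R * L%:R).
    by rewrite ler_pdivrMr// (le_trans c1)// {1}mX; lra.
  have h' : - (128 * r%:R * L%:R) <= v / mesh.
    case/andP: hv => h' _; rewrite ler_pdivlMr//; apply: le_trans h'; rewrite {1}mX; lra.
  have [g _] := trig_poly_node r nD.
  (* Here 128 r L <= n <= 254 r L, which is inside the range of exact ones. *)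
  rewrite -[X in normc (X - _)]g//; apply/andP; split.
    have : ((128 * r * L)%:R : R) < n.+1%:R by rewrite (le_lt_trans _ n2)// EE !natrM; lra.
    rewrite ltr_nat ltnS; apply: leq_trans.
    apply: (@leq_trans (r * L)); first by rewrite leq_mul2l leq_pred orbT.
    by rewrite -mulnA leq_pmull.
  by rewrite /M addn1 ltnS -(ler_nat R) (le_trans n1)// EE !natrM; lra.
have [c2|c2] := ltP v (- (X / 4)).
  by rewrite subrr normc0; exact: le_trans (normc_ge0 _) lip.
have h : - (r%:R * L%:R) <= v / mesh.
  by rewrite ler_pdivlMr// (le_trans _ c2)// {1}mX; lra.
have [_ g] := trig_poly_node r nD.
rewrite -[X in normc (X - _)]g//.
have : ((255 * r * L)%:R : R) < n.+1%:R by rewrite (le_lt_trans _ n2)// EE !natrM; lra.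
rewrite ltr_nat ltnS; apply: leq_trans.
have e : (r * L.-1 + r = r * L)%N by rewrite -mulnSr prednK.
have mulS (a b : nat) : (a.+1 * b = a * b + b)%N by rewrite mulSn addnC.
rewrite /M -!mulnA (mulS 254%N) -addnA leq_add2l -e addnC leq_add2l.
exact: r0.
Qed.

End TrigCutoff.

Section CutoffExistence.
Variable R : realType.
Local Notation C := R[i].

(** The number of frequencies is left free and may be a power of q; what is bounded is their N-th
    moment in units of 1 / X. Approximation is demanded on [- 32 X, 32 X], beyond which the
    integrands are negligible. *)
Record smooth_weight (N : nat) (X S eps : R) (W : R -> C) : Prop := SmoothWeight {
  sw_meas : cmeas W;
  sw_bound : forall v, normc (W v) <= S;
  sw_approx : exists (D : nat) (w : 'I_D -> C) (kap : 'I_D -> R),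
    \sum_(k < D) normc (w k) * (1 + `|kap k| * X) ^+ N <= S /\
    forall v, - (32 * X) <= v <= 32 * X ->
      normc (W v - \sum_(k < D) w k * cis (kap k * v)) <= eps }.

(* The cutoff is trigonometric interpolation of the indicator of an interval,
   averaged N + 2 times over short shifts: averaging makes the Fourier coefficients decay
   like |k|^(- N - 2), and the interpolant is still exactly 0 or 1 at the nodes
   away from the transition. *)
Lemma smooth_cutoff_exists (N : nat) : (0 < N)%N -> exists2 S : R, 0 <= S &
  forall (X : R) (L : nat), 0 < X -> (0 < L)%N -> exists W : R -> C,
  [/\ smooth_weight N X S (S / L%:R) W, smooth_weight N X S (S / L%:R) (fun v => 1 - W v),
      (forall v, v <= - (X / 2) -> W v = 1) & (forall v, - (X / 4) <= v -> W v = 0)].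
Proof.
move=> N0; have [r Nr] : exists r, (N + 2 = r)%N by exists (N + 2)%N.
have r0 : (0 < r)%N by rewrite -Nr addn2.
have c0 : 0 <= 1024 * r%:R :> R := mulr_ge0 (ler0n _ _) (ler0n _ _).
have [S0 S0E] : exists S0 : R, 1 + 4 * ((1024 * r%:R) ^+ r * 2 ^+ N) = S0 by eexists.
have S01 : 1 <= S0.
  rewrite -S0E lerDl; apply: mulr_ge0; first exact: ler0n.
  by apply: mulr_ge0; apply: exprn_ge0; [exact: c0|exact: ler0n].
(* 8 is the constant of the Lipschitz bound; it also covers the 1 + S0 that 1 - W requires. *)
exists (8 * S0); first by lra.
move=> X L X0 L0; exists (cutoff r L X).
have L0' : 0 < L%:R :> R by rewrite ltr0n.
have sw := @weight_coef_sum_le R r L X r0 L0 X0 N Nr; rewrite S0E in sw.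
have bnd v : normc (cutoff r L X v) <= S0.
  rewrite /cutoff; case: ifP => _; first by rewrite normc1.
  by case: ifP => _; [by have := normc_trig_poly_le r0 L0 X0 v Nr; rewrite S0E|rewrite normc0; lra].
have LD : (L <= period r L)%N.
  rewrite /period /half_period; apply: (@leq_trans (256 * r * L)); last exact: leq_addr.
  by apply: leq_pmull; rewrite muln_gt0 r0.
have app v : - (32 * X) <= v <= 32 * X ->
    normc (cutoff r L X v - trig_poly r L X r v) <= 8 * S0 / L%:R.
  move=> hv; have := cutoff_approx r0 L0 X0 N0 Nr hv; rewrite S0E => h; apply: (le_trans h).
  have D0' : 0 < (period r L)%:R :> R by rewrite ltr0n (leq_trans L0).
  by apply: ler_wpM2l; [lra|rewrite lef_pV2 ?posrE// ler_nat].
have fX (k : nat) : `|freq r L X k| * X <= `|k%:R - (half_period r L)%:R|.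
  rewrite -{2}(ger0_norm (ltW X0)) -normrM /freq.
  have -> : pi *+ 2 * (k%:R - (half_period r L)%:R) / (128 * X) * X =
    (pi / 64) * (k%:R - (half_period r L)%:R) :> R.
    by rewrite -mulr_natr; field; rewrite gt_eqF.
  rewrite normrM; have p0 := @pi_gt0 R; have p2 := @pihalf_lt2 R.
  rewrite -[leRHS]mul1r; apply: ler_wpM2r => //; rewrite ger0_norm; lra.
have sumle : \sum_(k < period r L) normc (weight_coef r L X r k) * (1 + `|freq r L X k| * X) ^+ N <= S0.
  apply: le_trans sw; apply: ler_sum => k _; apply: ler_wpM2l; first exact: normc_ge0.
  rewrite lerXn2r ?nnegrE ?addr_ge0 ?mulr_ge0 ?(ltW X0)// lerD2l; exact: fX.
split.
- split; [exact: cmeas_cutoff|by move=> v; apply: (le_trans (bnd v)); lra|].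
  exists (period r L), (fun k => weight_coef r L X r k), (fun k => freq r L X k).
  by split; [apply: (le_trans sumle); lra|exact: app].
- split.
  + by apply: cmeasB; [exact: cmeas_cst|exact: cmeas_cutoff].
  + by move=> v; apply: (le_trans (le_normcB _ _)); rewrite normc1; have := bnd v; lra.
  (* For 1 - W the frequency 0 with coefficient 1 is added at index [ord0], and the other
     coefficients change sign. *)
  + exists (period r L).+1, (fun k => oapp (fun j : 'I_(period r L) => - weight_coef r L X r j) 1 (unlift ord0 k)),
      (fun k => oapp (fun j : 'I_(period r L) => freq r L X j) 0 (unlift ord0 k)).
    split.
      rewrite big_ord_recl unlift_none/= normr0 mul0r addr0 expr1n mulr1 normc1.
      have -> : \sum_(i < period r L) normc (oapp (fun j : 'I_(period r L) => - weight_coef r L X r j) 1 (unlift ord0 (lift ord0 i)))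
          * (1 + `|oapp (fun j : 'I_(period r L) => freq r L X j) 0 (unlift ord0 (lift ord0 i))| * X) ^+ N =
         \sum_(k < period r L) normc (weight_coef r L X r k) * (1 + `|freq r L X k| * X) ^+ N.
        by apply: eq_bigr => i _; rewrite liftK/= normcN.
      by lra.
    move=> v hv; apply: le_trans (app v hv).
    rewrite big_ord_recl unlift_none/= mul0r cis0 mulr1.
    have -> : \sum_(i < period r L) oapp (fun j : 'I_(period r L) => - weight_coef r L X r j) 1 (unlift ord0 (lift ord0 i))
      * cis (oapp (fun j : 'I_(period r L) => freq r L X j) 0 (unlift ord0 (lift ord0 i)) * v) = - trig_poly r L X r v.
      by rewrite /trig_poly -sumrN; apply: eq_bigr => i _; rewrite liftK/= mulNr.
    by rewrite normc_subC le_eqVlt; apply/orP; left; apply/eqP; congr normc; ring.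
- by move=> v hv; rewrite /cutoff hv.
- move=> v hv; rewrite /cutoff (ltNge v) hv ifF//; apply/negbTE; rewrite -ltNge.
  by apply: lt_le_trans hv; rewrite ltrN2; lra.
Qed.

End CutoffExistence.

(** * Mellin integrals against the cutoff *)

Section Kernel.
Variable R : realType.
Local Notation C := R[i].
Implicit Types (f g F W : R -> C) (s : C) (l u v X S : R).

Definition ccont f := continuous (fun v => complex.Re (f v)) /\
  continuous (fun v => complex.Im (f v)).

Lemma ccont_cmeas f : ccont f -> cmeas f.
Proof. by case=> c1 c2; split; exact: continuous_measurable_fun. Qed.

Lemma ccontM f g : ccont f -> ccont g -> ccont (fun v => f v * g v).
Proof.
have cM (h k : R -> R) : continuous h -> continuous k -> continuous (fun v => h v * k v).
  by move=> ch ck v; apply: (@continuousM _ R^o h k); [exact: ch|exact: ck].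
move=> [f1 f2] [g1 g2]; split.
- rewrite (_ : (fun v => _) = (fun v => complex.Re (f v) * complex.Re (g v) - complex.Im (f v) * complex.Im (g v))); last first.
    by apply/funext => v; case: (f v) => a b; case: (g v).
  by move=> v; apply: (@continuousB _ R^o _ (fun v => complex.Re (f v) * complex.Re (g v)) (fun v => complex.Im (f v) * complex.Im (g v))); apply: cM.
- rewrite (_ : (fun v => _) = (fun v => complex.Re (f v) * complex.Im (g v) + complex.Im (f v) * complex.Re (g v))); last first.
    by apply/funext => v; case: (f v) => a b; case: (g v).
  by move=> v; apply: (@continuousD _ R^o _ (fun v => complex.Re (f v) * complex.Im (g v)) (fun v => complex.Im (f v) * complex.Re (g v))); apply: cM.
Qed.

Lemma continuous_mull (k : R) : continuous (fun v : R => k * v).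
Proof.
by move=> v; apply: (@continuousM _ R^o (fun=> k) id); [exact: cst_continuous|exact: cvg_id].
Qed.

Lemma ccont_cexp s : ccont (fun v => cexp (s * v%:C)).
Proof.
case: s => x y.
have e v : cexp ((x +i* y) * v%:C) = (expR (x * v) * cos (y * v)) +i* (expR (x * v) * sin (y * v)).
  rewrite /cexp /=; apply/eqP; rewrite eq_complex/=; apply/andP.
  by rewrite !mulr0 subr0 add0r !mul0r subr0 addr0 !eqxx.
have ce v : {for v, continuous (fun v : R => expR (x * v))}.
  by apply: continuous_comp; [exact: continuous_mull|exact: continuous_expR].
split.
- rewrite (_ : (fun v => _) = (fun v => expR (x * v) * cos (y * v))); last by apply/funext => v; rewrite e.
  move=> v; apply: (@continuousM _ R^o (fun v => expR (x * v)) (fun v => cos (y * v))); first exact: ce.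
  by apply: continuous_comp; [exact: continuous_mull|exact: continuous_cos].
- rewrite (_ : (fun v => _) = (fun v => expR (x * v) * sin (y * v))); last by apply/funext => v; rewrite e.
  move=> v; apply: (@continuousM _ R^o (fun v => expR (x * v)) (fun v => sin (y * v))); first exact: ce.
  by apply: continuous_comp; [exact: continuous_mull|exact: continuous_sin].
Qed.

Lemma ccont_shift f l : ccont f -> ccont (fun v => f (v + l)).
Proof.
have cl : continuous (fun v : R => v + l).
  by move=> v; apply: (@continuousD _ R^o _ id (fun=> l)); [exact: cvg_id|exact: cst_continuous].
have sh (h : R -> R) : continuous h -> continuous (fun v => h (v + l)).
  by move=> ch v; apply: (@continuous_comp _ _ _ (fun v => v + l) h); [exact: cl|exact: ch].
by case=> c1 c2; split; [exact: (sh _ c1)|exact: (sh _ c2)].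
Qed.

Lemma normc_cexpM s v : normc (cexp (s * v%:C)) = expR (complex.Re s * v).
Proof. by rewrite normc_cexp; case: s => a b /=; rewrite mulr0 subr0. Qed.

Lemma expR_logistic_le sigma v : 3/8 <= sigma <= 5/8 ->
  expR (sigma * v) / (1 + expR v) <= expR (- (3/8 * `|v|)).
Proof.
case/andP=> s1 s2; have ev := expR_gt0 v; rewrite ler_pdivrMr; last by lra.
rewrite mulrDr mulr1 -expRD; have [v0|v0] := leP 0 v.
  apply: ler_wpDl; first exact: expR_ge0.
  rewrite ler_expR ger0_norm//; nra.
apply: ler_wpDr; first exact: expR_ge0.
rewrite ler_expR ltr0_norm//; nra.
Qed.

Lemma weight_shift_le l v : weight (v + l) <= expR (`|l| / 8) * weight v.
Proof.
rewrite /weight -expRD ler_expR.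
have := ler_normB (v + l) l; rewrite addrK; lra.
Qed.

(** Satisfied by exp(- e^v), by exp(- e^v / 2) and by 1 / (e^v - i) and its conjugate; against e^(s
    v) with 3/8 <= Re s <= 5/8 it gives decay at rate 3/8 in both directions. *)
Definition logistic_bound F := forall v, normc (F v) <= 2 / (1 + expR v).

Lemma logistic_integrand_le F s l v : logistic_bound F -> 3/8 <= complex.Re s <= 5/8 ->
  normc (cexp (s * v%:C) * F (v + l)) <=
  2 * expR (- (complex.Re s * l)) * expR (- (3/8 * `|v + l|)).
Proof.
move=> hF hs; rewrite normcM normc_cexpM.
have -> : complex.Re s * v = - (complex.Re s * l) + complex.Re s * (v + l) by ring.
have h := expR_logistic_le (v + l) hs; have h' := hF (v + l).
rewrite expRD; have := expR_ge0 (- (complex.Re s * l)); have := expR_ge0 (complex.Re s * (v + l)).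
move: h h'; move: (expR (- (complex.Re s * l))) (expR (complex.Re s * (v + l))) (1 + expR (v + l))
  (expR (- (3/8 * `|v + l|))) (normc _) => z x y e n h h' x0 z0.
apply: (@le_trans _ _ (z * x * (2 / y))); first by apply: ler_wpM2l => //; exact: mulr_ge0.
have -> : z * x * (2 / y) = 2 * z * (x / y) by ring.
by apply: ler_wpM2l => //; rewrite mulr_ge0.
Qed.

(* An exponential e^(i k v) in place of W only shifts s, and translating v by l
   then gives the dependence on l exactly. *)
Lemma kernel_approx (N : nat) S X W F s : 1 <= X -> 0 <= S ->
  smooth_weight N X S (S * expR (- (4 * X))) W -> ccont F -> logistic_bound F ->
  3/8 <= complex.Re s <= 5/8 ->
  exists (D : nat) (h : 'I_D -> C) (kap : 'I_D -> R),
    \sum_(k < D) normc (h k) * (1 + `|kap k| * X) ^+ N <= 4 * S * weight_mass R /\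
    forall l, - 3 <= l <= X ->
      normc (cexp (s * l%:C) * cint (fun v => cexp (s * v%:C) * F (v + l) * W v)
        - \sum_(k < D) h k * cis (- (kap k * l))) <= 8 * S * weight_mass R * expR (- (4 * X)).
Proof.
move=> X1 S0 [mW bW [D [w [kap [sw aw]]]]] cF hF hs.
have wm0 := weight_mass_ge0 R.
pose g k v := cexp ((s + 0 +i* kap k) * v%:C) * F v.
pose P v := \sum_(k < D) w k * cis (kap k * v).
have cisE k v : cexp ((s + 0 +i* kap k) * v%:C) = cexp (s * v%:C) * cis (kap k * v).
  rewrite mulrDl cexpD /cis; congr (_ * cexp _).
  by apply/eqP; rewrite eq_complex/=; apply/andP; split; apply/eqP; ring.
have le3 u : expR (- (3/8 * `|u|)) <= weight u.
  by rewrite /weight ler_expR; have := normr_ge0 u; lra.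
have dF k : dominated 2 (g k).
  move=> v; rewrite /g cisE mulrAC normcM normc_cis mulr1.
  have := logistic_integrand_le 0 v hF hs; rewrite addr0 mulr0 oppr0 expR0 mulr1 => h.
  by apply: (le_trans h); rewrite ler_pM2l.
have cg k : ccont (g k) by apply: ccontM => //; exact: ccont_cexp.
exists D, (fun k => w k * cint (g k)), kap; split.
  apply: (@le_trans _ _ (4 * weight_mass R * \sum_(k < D) normc (w k) * (1 + `|kap k| * X) ^+ N)); last first.
    have -> : 4 * S * weight_mass R = 4 * weight_mass R * S by ring.
    by apply: ler_wpM2l => //; rewrite mulr_ge0.
  rewrite mulr_sumr; apply: ler_sum => k _; rewrite normcM.
  have h := cint_norm_le0 (ccont_cmeas (cg k)) (dF k).
  rewrite -mulrA mulrCA; apply: ler_wpM2r.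
    by rewrite mulr_ge0 ?normc_ge0 ?exprn_ge0 ?addr_ge0 ?mulr_ge0//; lra.
  by apply: (le_trans h); lra.
move=> l /andP[l1 l2].
pose G v := cexp (s * v%:C) * F (v + l).
have cG : ccont G by apply: ccontM; [exact: ccont_cexp|exact: ccont_shift].
pose e := expR (- (complex.Re s * l)).
have e0 : 0 <= e by exact: expR_ge0.
have bG v : normc (G v) <= 2 * e * expR (- (3/8 * `|v + l|)) by exact: logistic_integrand_le.
have dG : dominated (2 * e * expR (`|l| / 8)) G.
  move=> v; apply: (le_trans (bG v)); rewrite -(mulrA (2 * e)).
  apply: ler_wpM2l; first by rewrite mulr_ge0.
  exact: le_trans (le3 _) (weight_shift_le l v).
have mG := ccont_cmeas cG.
have sumE : \sum_(k < D) w k * cint (g k) * cis (- (kap k * l)) =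
    cexp (s * l%:C) * cint (fun v => G v * P v).
  have mk k : cmeas (fun v => g k (v + l)) by apply: ccont_cmeas; exact: ccont_shift.
  have dk k : dominated (2 * expR (`|l| / 8)) (fun v => g k (v + l)).
    move=> v; apply: (le_trans (dF k _)); rewrite -mulrA; apply: ler_wpM2l => //.
    exact: weight_shift_le.
  have -> : cint (fun v => G v * P v) =
      cint (fun v => \sum_(k < D) w k * cexp (- ((s + 0 +i* kap k) * l%:C)) * g k (v + l)).
    apply: eq_cint => v; rewrite /P mulr_sumr; apply: eq_bigr => k _.
    have key : cexp (- ((s + 0 +i* kap k) * l%:C)) * cexp ((s + 0 +i* kap k) * (v + l)%:C) =
        cexp (s * v%:C) * cis (kap k * v).
      by rewrite -cisE -cexpD; congr cexp; rewrite rmorphD/=; ring.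
    transitivity (w k * (cexp (s * v%:C) * cis (kap k * v)) * F (v + l)); first by rewrite /G; ring.
    by rewrite -key /g; ring.
  rewrite (cint_sum (B := fun k => normc (w k * cexp (- ((s + 0 +i* kap k) * l%:C))) * (2 * expR (`|l| / 8)))).
  - rewrite mulr_sumr; apply: eq_bigr => k _.
    rewrite (cintZ _ (mk k) (dk k)) (cint_shift l (cg k).1 (cg k).2 (dF k)).
    rewrite cexpN cisE cisN; have := cexp_neq0 (s * l%:C).
    have : cis (kap k * l) != 0 by rewrite -normc_gt0 normc_cis.
    move: (cexp _) (cis _) (cint _) => a b c b0 a0; field.
    by rewrite a0 b0.
  - by move=> k; apply: cmeasM; [exact: cmeas_cst|exact: mk].
  - by move=> k; exact: dominatedZ (dk k).
have mP : cmeas P.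
  apply: cmeas_sum => k _; apply: cmeasM; first exact: cmeas_cst.
  apply: (cmeas_ext (f := fun v => cexp ((0 +i* kap k) * v%:C))); last exact: cmeas_cexp.
  move=> v; rewrite /cis; congr cexp.
  by apply/eqP; rewrite eq_complex/=; apply/andP; split; apply/eqP; ring.
have bP v : normc (P v) <= S.
  apply: le_trans sw; apply: (le_trans (normc_sum _ _ _)); apply: ler_sum => k _.
  rewrite normcM normc_cis; apply: ler_wpM2l; first exact: normc_ge0.
  by rewrite exprn_ege1// lerDl mulr_ge0//; lra.
have dGM Q : (forall v, normc (Q v) <= S) -> dominated (S * (2 * e * expR (`|l| / 8))) (fun v => G v * Q v).
  move=> bQ v; rewrite normcM mulrC -mulrA; apply: ler_pM; rewrite ?normc_ge0//; exact: dG.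
rewrite sumE -mulrBr -(cintB (cmeasM mG mW) (cmeasM mG mP) (dGM _ bW) (dGM _ bP)).
rewrite normcM normc_cexpM.
have ee : expR (complex.Re s * l) * e = 1 by rewrite /e -expRD subrr expR0.
have h : normc (cint (fun v => G v * W v - G v * P v)) <=
    2 * (4 * S * expR (- (4 * X)) * e) * weight_mass R.
  apply: (@cint_norm_le _ _ l).
    by apply: cmeasB; exact: cmeasM.
  move=> v; rewrite -mulrBr normcM.
  have key : normc (W v - P v) * expR (- (3/8 * `|v + l|)) <= 2 * S * expR (- (4 * X)) * weight (v + l).
    have w0 := weight_ge0 (v + l); have x0 := expR_ge0 (- (4 * X)).
    (* Inside, W is close to P. Outside, |v + l| >= 16 X, and the decay rate 3/8 exceeds the rate
       1/8 of [weight] by 1/4, which yields exp(- 4 X) from the kernel alone. *)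
    have [hv|hv] := boolP (- (32 * X) <= v <= 32 * X).
      apply: (@le_trans _ _ (S * expR (- (4 * X)) * weight (v + l))).
        by apply: ler_pM; rewrite ?normc_ge0 ?expR_ge0//; exact: aw.
      rewrite -!mulrA ler_peMl//; last lra.
      by rewrite !mulr_ge0.
    rewrite -(mulrA (2 * S)); apply: ler_pM; rewrite ?normc_ge0 ?expR_ge0//.
      apply: (le_trans (le_normcB _ _)); have := bW v; have := bP v; lra.
    rewrite /weight -expRD ler_expR.
    have : 16 * X <= `|v + l|.
      move: hv; rewrite negb_and -!ltNge => /orP[hv|hv].
        by rewrite ler_normr; apply/orP; right; lra.
      by rewrite ler_normr; apply/orP; left; lra.
    lra.
  apply: (@le_trans _ _ (2 * e * (normc (W v - P v) * expR (- (3/8 * `|v + l|))))).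
    rewrite mulrCA mulrC; apply: ler_wpM2l; first exact: normc_ge0.
    exact: bG.
  have -> : 4 * S * expR (- (4 * X)) * e * weight (v + l) =
    2 * e * (2 * S * expR (- (4 * X)) * weight (v + l)) by ring.
  by apply: ler_wpM2l => //; rewrite mulr_ge0.
apply: (@le_trans _ _ (expR (complex.Re s * l) * (2 * (4 * S * expR (- (4 * X)) * e) * weight_mass R))).
  by apply: ler_wpM2l => //; exact: expR_ge0.
rewrite le_eqVlt; apply/orP; left; apply/eqP.
transitivity (8 * S * weight_mass R * expR (- (4 * X)) * (expR (complex.Re s * l) * e)); first by ring.
by rewrite ee mulr1.
Qed.

End Kernel.

(** * The integral representation of L(s, chi) *)

Section GammaFactor.
Variable R : realType.
Local Notation C := R[i].
Implicit Types (F : R -> C) (s alpha : C) (l u v : R).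

Lemma Re_half : complex.Re (2^-1 : C) = 2^-1.
Proof.
have -> : (2^-1 : C) = (2^-1 : R)%:C by rewrite fmorphV/= rmorph_nat.
by [].
Qed.

Lemma Re_half_add alpha : normc alpha <= 1/8 -> 3/8 <= complex.Re (2^-1 + alpha) <= 5/8.
Proof.
move=> h; have := Re_le_normc alpha; rewrite ler_norml => /andP[a1 a2].
have -> : complex.Re (2^-1 + alpha) = 2^-1 + complex.Re alpha.
  by rewrite -Re_half; case: (2^-1 : C) => a b; case: alpha {h a1 a2}.
by apply/andP; split; lra.
Qed.

Definition exp_kernel v : C := (expR (- expR v))%:C.

Lemma ccont_exp_kernel : ccont exp_kernel.
Proof.
split; last exact: cst_continuous.
move=> v; apply: (@continuous_comp _ _ _ (fun v => - expR v) expR); last exact: continuous_expR.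
by apply: (@continuousN _ R^o); exact: continuous_expR.
Qed.

Lemma expRN_le u : 0 <= u -> expR (- u) <= (1 + u)^-1.
Proof.
move=> u0; rewrite expRN lef_pV2 ?posrE ?expR_gt0//; last lra.
exact: expR_ge1Dx.
Qed.

Lemma logistic_exp_kernel : logistic_bound exp_kernel.
Proof.
move=> v; rewrite normcR ger0_norm ?expR_ge0//.
have e0 := expR_ge0 v; apply: (le_trans (expRN_le e0)).
by apply: ler_peMl; [rewrite invr_ge0; lra|rewrite ler1n].
Qed.

Lemma logistic_dominated F s : logistic_bound F -> 3/8 <= complex.Re s <= 5/8 ->
  dominated 2 (fun v => cexp (s * v%:C) * F v).
Proof.
move=> hF hs v; have := logistic_integrand_le 0 v hF hs.
rewrite addr0 mulr0 oppr0 expR0 mulr1 => h; apply: (le_trans h).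
rewrite ler_pM2l// /weight ler_expR; have := normr_ge0 v; lra.
Qed.

Lemma cint_logistic_shift F s l : ccont F -> logistic_bound F -> 3/8 <= complex.Re s <= 5/8 ->
  cint (fun v => cexp (s * v%:C) * F (v + l)) =
  cexp (- s * l%:C) * cint (fun v => cexp (s * v%:C) * F v).
Proof.
move=> cF hF hs; have dF := logistic_dominated hF hs.
have c : ccont (fun v => cexp (s * v%:C) * F v) by apply: ccontM => //; exact: ccont_cexp.
rewrite -(cint_shift l c.1 c.2 dF) -(cintZ (B := 2 * expR (`|l| / 8))).
- apply: eq_cint => v; rewrite mulrA -cexpD; congr (cexp _ * _).
  by rewrite rmorphD/=; ring.
- exact: ccont_cmeas (ccont_shift l c).
- move=> v; apply: (le_trans (dF _)); rewrite -mulrA ler_pM2l//; exact: weight_shift_le.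
Qed.

(** Euler's integral for Gamma(s) after the substitution x = e^v. *)
Definition gamma_factor s : C := cint (fun v => cexp (s * v%:C) * exp_kernel v).

(** The integrand is the positive function exp(v / 2 - e^v), which is at least exp(- e) on
    [0, 1]. *)
Lemma gamma_factor_half_gt0 : 0 < complex.Re (gamma_factor 2^-1).
Proof.
have hs : 3/8 <= complex.Re (2^-1 : C) <= 5/8 by rewrite Re_half; lra.
have c : ccont (fun v => cexp (2^-1 * v%:C) * exp_kernel v).
  by apply: ccontM; [exact: ccont_cexp|exact: ccont_exp_kernel].
have [i1 _] := integrable_dominated (ccont_cmeas c) (logistic_dominated logistic_exp_kernel hs).
have e : (fun v => complex.Re (cexp (2^-1 * v%:C) * exp_kernel v)) = (fun v => expR (v / 2 - expR v)).
  apply/funext => v; have -> : (2^-1 * v%:C : C) = (v / 2)%:C.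
    by rewrite rmorphM/= fmorphV/= rmorph_nat mulrC.
  by rewrite cexpR /exp_kernel -rmorphM/= -expRD.
rewrite /gamma_factor /cint/= e; rewrite e in i1.
rewrite /Rintegral.
have mh : measurable_fun setT (fun v : R => (expR (v / 2 - expR v))%:E).
  by case/integrableP: i1.
pose D : set R := [set` `[0, 1]].
have mD : measurable (D : set (measurableTypeR R)) by exact: measurable_itv.
have hv (v : R) : 0 <= v <= 1 -> - expR 1 <= v / 2 - expR v.
  case/andP=> v0 v1; have h : expR v <= expR 1 by rewrite ler_expR.
  lra.
have hge : ((expR (- expR 1))%:E <= \int[@lebesgue_measure R]_v (expR (v / 2 - expR v))%:E)%E.
  have h1 : (\int[@lebesgue_measure R]_(v in D) (expR (v / 2 - expR v))%:E <=
      \int[@lebesgue_measure R]_v (expR (v / 2 - expR v))%:E)%E.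
    by apply: ge0_subset_integral => // v _; rewrite lee_fin expR_ge0.
  apply: le_trans h1.
  have h2 : (\int[@lebesgue_measure R]_(v in D) (cst (expR (- expR 1))%:E v) = (expR (- expR 1))%:E)%E.
    have muD : (@lebesgue_measure R D = 1)%E.
      by rewrite /D lebesgue_measure_itv/= lte_fin ltr01 oppr0 adde0.
    by rewrite (integral_cst _ mD) -[RHS]mule1; congr (_ * _)%E; exact: muD.
  rewrite -[leLHS]h2; apply: ge0_le_integral.
  all: try exact: mD.
  all: try by move=> v _; rewrite lee_fin expR_ge0.
  all: try exact: measurable_cst.
  all: try by apply: measurable_funS mh.
  move=> v Dv; rewrite lee_fin ler_expR; apply: hv.
  by move: Dv; rewrite /D /= in_itv.
apply: (@lt_le_trans _ _ (expR (- expR 1))); first exact: expR_gt0.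
rewrite -lee_fin fineK// integrable_fin_num//.
Qed.

Lemma normc_cexp_sub1_le_exp (z : C) : normc (cexp z - 1) <= 4 * normc z * expR (normc z).
Proof.
have n0 := normc_ge0 z; have e1 := expR_ge1Dx (normc z).
have [h|h] := leP (normc z) (1/2).
  apply: (le_trans (normc_cexp_sub1_le h)); rewrite ler_peMr//; [by rewrite mulr_ge0|lra].
apply: (le_trans (le_normcB _ _)); rewrite normc1 normc_cexp.
have : expR (complex.Re z) <= expR (normc z).
  by rewrite ler_expR (le_trans (ler_norm _))// Re_le_normc.
nra.
Qed.

(** Continuity at 1/2 with an explicit modulus. Since alpha << 1 / ln q tends to 0, this suffices
    for dividing by the gamma factor. *)
Lemma gamma_factor_lower : exists c d : R, [/\ 0 < c, 0 < d, d <= 1/8 &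
  forall alpha, normc alpha <= d -> c <= normc (gamma_factor (2^-1 + alpha))].
Proof.
have g0 := gamma_factor_half_gt0; set g := complex.Re _ in g0.
have w0 := weight_mass_ge0 R; set wm := weight_mass R in w0.
have hs : 3/8 <= complex.Re (2^-1 : C) <= 5/8 by rewrite Re_half; lra.
(* The perturbation is at most 128 d wm <= g / 4. The 1/16 keeps exp(d |v|) within the spare decay,
   and [wm + 1] avoids a division by 0. *)
pose d := Num.min (1/16) (g / (512 * (wm + 1))).
have d0 : 0 < d.
  rewrite lt_min; apply/andP; split; first lra.
  by apply: divr_gt0; [exact: g0|lra].
have d1 : d <= 1/16 by rewrite ge_min lexx.
exists (g / 2), d; split => //; [lra|lra|move=> alpha ha].
have hsa := @Re_half_add alpha.
have {}hsa : 3/8 <= complex.Re (2^-1 + alpha) <= 5/8 by apply: hsa; lra.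
pose f v := cexp (2^-1 * v%:C) * exp_kernel v.
have cf s : cmeas (fun v => cexp (s * v%:C) * exp_kernel v).
  by apply: ccont_cmeas; apply: ccontM; [exact: ccont_cexp|exact: ccont_exp_kernel].
have h : normc (gamma_factor (2^-1 + alpha) - gamma_factor 2^-1) <= 2 * (64 * d) * wm.
  rewrite /gamma_factor -(cintB (cf _) (cf _) (logistic_dominated logistic_exp_kernel hsa) (logistic_dominated logistic_exp_kernel hs)).
  apply: cint_norm_le0; first by apply: cmeasB; exact: cf.
  move=> v; have -> : cexp ((2^-1 + alpha) * v%:C) * exp_kernel v - cexp (2^-1 * v%:C) * exp_kernel v =
      cexp (2^-1 * v%:C) * exp_kernel v * (cexp (alpha * v%:C) - 1).
    rewrite mulrDl cexpD; move: (cexp _) (cexp _) (exp_kernel v) => x y z; ring.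
  rewrite normcM.
  have b := logistic_integrand_le 0 v logistic_exp_kernel hs.
  rewrite addr0 mulr0 oppr0 expR0 mulr1 in b.
  have b' := normc_cexp_sub1_le_exp (alpha * v%:C).
  have n0 := normr_ge0 v.
  have nv : normc (alpha * v%:C) <= d * `|v| by rewrite normcM normcR ler_wpM2r.
  have b2 : normc (cexp (alpha * v%:C) - 1) <= 4 * (d * `|v|) * expR (d * `|v|).
    apply: (le_trans b'); apply: ler_pM; rewrite ?mulr_ge0 ?normc_ge0 ?expR_ge0//.
      by rewrite ler_pM2l.
    by rewrite ler_expR.
  apply: (le_trans (ler_pM (normc_ge0 _) (normc_ge0 _) b b2)).
  have v8 : `|v| <= 8 * expR (`|v| / 8) by have := expR_ge1Dx (`|v| / 8); lra.
  have e1 : expR (- (3 / 8 * `|v|)) * expR (`|v| / 8) * expR (d * `|v|) <= weight v.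
    rewrite -!expRD /weight ler_expR; nra.
  have p0 := expR_ge0 (- (3 / 8 * `|v|)); have q0 := expR_ge0 (d * `|v|).
  have e2 : expR (- (3 / 8 * `|v|)) * `|v| * expR (d * `|v|) <= 8 * weight v.
    apply: (@le_trans _ _ (8 * (expR (- (3 / 8 * `|v|)) * expR (`|v| / 8) * expR (d * `|v|)))); last by rewrite ler_pM2l.
    have -> : 8 * (expR (- (3 / 8 * `|v|)) * expR (`|v| / 8) * expR (d * `|v|)) =
      expR (- (3 / 8 * `|v|)) * (8 * expR (`|v| / 8)) * expR (d * `|v|) by ring.
    by apply: ler_wpM2r => //; apply: ler_wpM2l.
  have -> : 2 * expR (- (3 / 8 * `|v|)) * (4 * (d * `|v|) * expR (d * `|v|)) =
    8 * d * (expR (- (3 / 8 * `|v|)) * `|v| * expR (d * `|v|)) by ring.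
  have -> : 64 * d * weight v = 8 * d * (8 * weight v) by ring.
  by rewrite ler_wpM2l// mulr_ge0//; lra.
have hd : 2 * (64 * d) * wm <= g / 2.
  have : d <= g / (512 * (wm + 1)) by rewrite ge_min lexx orbT.
  rewrite ler_pdivlMr; last lra.
  nra.
have hg : g <= normc (gamma_factor 2^-1) by apply: le_trans (Re_le_normc _); exact: ler_norm.
have := normc_triangle (gamma_factor 2^-1) (gamma_factor 2^-1 - gamma_factor (2^-1 + alpha)).
rewrite subKr -(normc_subC (gamma_factor (2^-1 + alpha))); lra.
Qed.

End GammaFactor.

(** * The generating function of a character *)

Section LFormula.
Variables (R : realType) (q : nat).
Hypothesis q_prime : prime q.
Local Notation C := R[i].
Implicit Types (chi : nat -> C) (s : C) (u v : R).

Let q0 : (0 < q)%N := prime_gt0 q_prime.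
Let q0' : 0 < q%:R :> R. Proof. by rewrite ltr0n. Qed.
Let q1' : 1 <= q%:R :> R. Proof. by rewrite ler1n. Qed.

Definition expc u : C := (expR (- u))%:C.

Lemma normc_expc u : normc (expc u) = expR (- u).
Proof. by rewrite normcR ger0_norm// expR_ge0. Qed.

Lemma expcX u n : expc u ^+ n = expc (n%:R * u).
Proof. by rewrite /expc -rmorphXn/= -expRM_natl mulrN. Qed.

Lemma normc_1subX u : 0 < u -> normc (1 - expc u ^+ q) = 1 - expR (- (q%:R * u)).
Proof.
move=> u0; rewrite expcX /expc -rmorphB/= normcR ger0_norm//.
by rewrite subr_ge0 -[leRHS]expR0 ler_expR oppr_le0 mulr_ge0// ltW.
Qed.

Lemma one_subX_gt0 u : 0 < u -> 0 < 1 - expR (- (q%:R * u)).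
Proof. by move=> u0; rewrite subr_gt0 -[ltRHS]expR0 ltr_expR oppr_lt0 mulr_gt0. Qed.

(** The series of chi(n) exp(- n u) over all n, summed by periodicity. *)
Definition char_kernel chi u : C := (\sum_(r < q) chi r * expc u ^+ r) / (1 - expc u ^+ q).

(** The denominator vanishes to first order at u = 0, and so does the numerator, since the values of
    a nonprincipal character sum to 0. For u > 1 the vanishing of chi(0) supplies the factor exp(-
    u). *)
Lemma normc_char_kernel_le chi u : dirichlet_character q chi -> chi <> principal_character R q ->
  0 < u -> normc (char_kernel chi u) <= 2 * q%:R / (1 + u).
Proof.
move=> hc np u0; have d0 := one_subX_gt0 u0.
rewrite /char_kernel normcM normcV normc_1subX// ler_pdivrMr// .
have sumq (F : 'I_q -> R) B : (forall r, F r <= B) -> \sum_(r < q) F r <= q%:R * B.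
  move=> h; apply: (le_trans (ler_sum _ (fun r _ => h r))).
  by rewrite sumr_const card_ord mulr_natl.
have c1 (r : 'I_q) : normc (chi r) <= 1 by exact: (normc_char_le1 q_prime).
have [u1|u1] := leP u 1.
  apply: (@le_trans _ _ (q%:R * (1 - expR (- (q%:R * u))))).
    have -> : \sum_(r < q) chi r * expc u ^+ r = \sum_(r < q) chi r * (expc u ^+ r - 1).
      apply/eqP; rewrite -subr_eq0 -sumrB; apply/eqP.
      rewrite -[RHS](char_sum0 q_prime hc np); apply: eq_bigr => r _; ring.
    apply: (le_trans (normc_sum _ _ _)).
    apply: sumq => r.
    rewrite normcM -[leRHS]mul1r; apply: ler_pM; rewrite ?normc_ge0// normc_subC expcX /expc.
    have e1 : expR (- (r%:R * u)) <= 1.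
      by rewrite -[leRHS]expR0 ler_expR oppr_le0 mulr_ge0// (ltW u0).
    have -> : 1 - (expR (- (r%:R * u)))%:C = (1 - expR (- (r%:R * u)))%:C :> C by rewrite rmorphB.
    rewrite normcR ger0_norm ?subr_ge0// lerD2l lerN2 ler_expR lerN2 ler_pM2r//.
    by rewrite ler_nat ltnW.
  rewrite ler_wpM2r ?(ltW d0)// ler_pdivlMr; last lra.
  by rewrite mulrC; apply: ler_wpM2r; [exact: ltW|lra].
apply: (@le_trans _ _ (q%:R * expR (- u))).
  apply: (le_trans (normc_sum _ _ _)).
  apply: sumq => r.
  rewrite normcM normcX normc_expc; case: (posnP r) => [->|r0].
    by rewrite (char_eq0 q_prime hc)// normc0 mul0r expR_ge0.
  rewrite -[leRHS]mul1r; apply: ler_pM; rewrite ?normc_ge0 ?exprn_ge0 ?expR_ge0//.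
  rewrite -(prednK r0) exprS ler_piMr ?expR_ge0// exprn_ile1 ?expR_ge0//.
  by rewrite -[leRHS]expR0 ler_expR oppr_le0 ltW.
have e2 : expR (- (q%:R * u)) <= 1/2.
  have h : 1 <= q%:R * u by apply: mulr_ege1; [exact: q1'|exact: ltW].
  have h0 : 0 <= q%:R * u by lra.
  by apply: (le_trans (expRN_le h0)); rewrite div1r lef_pV2 ?posrE; lra.
have e3 := expRN_le (ltW u0).
have -> : 2 * q%:R / (1 + u) * (1 - expR (- (q%:R * u))) =
  q%:R * ((1 + u)^-1 * (2 * (1 - expR (- (q%:R * u))))) by ring.
apply: ler_wpM2l; first exact: ltW.
apply: (le_trans e3); apply: ler_peMr; first by rewrite invr_ge0; lra.
lra.
Qed.

(** A finite geometric series over k periods, exact with an explicit remainder; this avoids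
    interchanging an infinite sum with the integral. *)
Lemma sum_char_kernel chi u k : dirichlet_character q chi -> 0 < u ->
  \sum_(n < q * k) chi n * expc u ^+ n = char_kernel chi u * (1 - expc u ^+ (q * k)).
Proof.
move=> hc u0; rewrite /char_kernel.
have d0 : 1 - expc u ^+ q != 0 by rewrite -normc_eq0 normc_1subX// gt_eqF ?one_subX_gt0.
set P := \sum_(r < q) _.
elim: k => [|k IH]; first by rewrite muln0 big_ord0 expr0 subrr mulr0.
have -> : (q * k.+1 = q * k + q)%N by rewrite mulnS addnC.
rewrite big_split_ord/= IH.
have -> : \sum_(i < q) chi (q * k + i)%N * expc u ^+ (q * k + i) = expc u ^+ (q * k) * P.
  rewrite /P mulr_sumr; apply: eq_bigr => i _.
  by rewrite addnC mulnC char_add_mul// exprD; ring.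
rewrite exprD; move: (expc u ^+ q) (expc u ^+ (q * k)) d0 => a b d0.
by field.
Qed.

End LFormula.

Section DirichletLIntegral.
Variables (R : realType) (q : nat).
Hypothesis q_prime : prime q.
Local Notation C := R[i].
Implicit Types (chi : nat -> C) (s : C) (u v : R).

Let q0 : (0 < q)%N := prime_gt0 q_prime.
Let q0' : 0 < q%:R :> R. Proof. by rewrite ltr0n. Qed.

Lemma cmeas_char_kernel chi : cmeas (fun v => char_kernel q chi (expR v)).
Proof.
have mE (n : nat) : cmeas (fun v => expc (expR v) ^+ n).
  apply: (cmeas_ext (f := fun v => (expR (- (n%:R * expR v)))%:C)).
    by move=> v; rewrite expcX.
  apply: cmeas_real; apply: continuous_measurable_fun => v.
  apply: (@continuous_comp _ _ _ (fun v => - (n%:R * expR v)) expR); last exact: continuous_expR.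
  apply: (@continuousN _ R^o); apply: (@continuousM _ R^o (fun=> n%:R) expR); [exact: cst_continuous|exact: continuous_expR].
rewrite /char_kernel; apply: cmeasM.
  by apply: cmeas_sum => r _; apply: cmeasM; [exact: cmeas_cst|exact: mE].
apply: (cmeas_inv (f := fun v => 1 - expc (expR v) ^+ q)).
  by move=> v; rewrite -normc_eq0 normc_1subX ?expR_gt0// gt_eqF// (one_subX_gt0 q_prime)// expR_gt0.
by apply: cmeasB; [exact: cmeas_cst|exact: mE].
Qed.

Lemma dominated_char_kernel chi s : dirichlet_character q chi ->
  chi <> principal_character R q -> 3/8 <= complex.Re s <= 5/8 ->
  dominated (2 * q%:R) (fun v => cexp (s * v%:C) * char_kernel q chi (expR v)).
Proof.
move=> hc np hs v; rewrite normcM normc_cexpM.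
have h := normc_char_kernel_le q_prime hc np (expR_gt0 v).
apply: (@le_trans _ _ (expR (complex.Re s * v) * (2 * q%:R / (1 + expR v)))).
  by apply: ler_wpM2l; first exact: expR_ge0.
have -> : expR (complex.Re s * v) * (2 * q%:R / (1 + expR v)) =
  2 * q%:R * (expR (complex.Re s * v) / (1 + expR v)) by ring.
apply: ler_wpM2l; first by rewrite mulr_ge0// ltW.
apply: (le_trans (expR_logistic_le v hs)); rewrite /weight ler_expR.
have := normr_ge0 v; lra.
Qed.

Definition char_integral s chi : C := cint (fun v => cexp (s * v%:C) * char_kernel q chi (expR v)).

Lemma expc_exp_kernel n v : (0 < n)%N -> expc (expR v) ^+ n = exp_kernel (v + ln n%:R).
Proof.
by move=> n0; rewrite expcX /expc /exp_kernel expRD lnK ?posrE ?ltr0n// mulrC.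
Qed.

Lemma gamma_mul_dirichlet_power s n : (0 < n)%N -> 3/8 <= complex.Re s <= 5/8 ->
  gamma_factor s * dirichlet_power s n = cint (fun v => cexp (s * v%:C) * expc (expR v) ^+ n).
Proof.
move=> n0 hs; rewrite mulrC /dirichlet_power /gamma_factor.
rewrite -(cint_logistic_shift _ (@ccont_exp_kernel R) (@logistic_exp_kernel R) hs).
by apply: eq_cint => v; rewrite expc_exp_kernel.
Qed.

(** The error is the integral of e^(s v) K(e^v) exp(- q k e^v). With K bounded by 2 q, translating
    by ln(q k) extracts (q k)^(- Re s), which tends to 0. *)
Lemma partial_sum_approx s chi k : dirichlet_character q chi ->
  chi <> principal_character R q -> 3/8 <= complex.Re s <= 5/8 -> (0 < k)%N ->
  normc (gamma_factor s * \sum_(n < q * k) chi n * dirichlet_power s n - char_integral s chi)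
  <= 8 * q%:R * weight_mass R * expR (- (complex.Re s * ln (q * k)%:R)).
Proof.
move=> hc np hs k0.
have qk0 : (0 < q * k)%N by rewrite muln_gt0 q0.
have mK := cmeas_char_kernel chi; have dK := dominated_char_kernel hc np hs.
have mE (n : nat) : cmeas (fun v => cexp (s * v%:C) * expc (expR v) ^+ n).
  apply: cmeasM; first exact: cmeas_cexp.
  case: (posnP n) => [->|n0]; first exact: cmeas_cst.
  apply: (cmeas_ext (f := fun v => exp_kernel (v + ln n%:R))).
    by move=> v; rewrite expc_exp_kernel.
  by apply: ccont_cmeas; apply: ccont_shift; exact: ccont_exp_kernel.
have bE (n : nat) v : (0 < n)%N -> normc (cexp (s * v%:C) * expc (expR v) ^+ n)
    <= 2 * expR (- (complex.Re s * ln n%:R)) * expR (- (3/8 * `|v + ln n%:R|)).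
  by move=> n0; rewrite expc_exp_kernel//; exact: logistic_integrand_le (@logistic_exp_kernel R) hs.
have le3 u : expR (- (3/8 * `|u|)) <= weight u.
  by rewrite /weight ler_expR; have := normr_ge0 u; lra.
pose B (n : nat) := 2 * expR (- (complex.Re s * ln n%:R)) * expR (`|ln n%:R| / 8) : R.
have dE (n : nat) : (0 < n)%N -> dominated (B n) (fun v => cexp (s * v%:C) * expc (expR v) ^+ n).
  move=> n0 v; apply: (le_trans (bE _ _ n0)); rewrite /B -(mulrA (2 * _)).
  apply: ler_wpM2l; first by rewrite mulr_ge0 ?expR_ge0.
  exact: le_trans (le3 _) (weight_shift_le _ v).
have chi0 : chi 0%N = 0 by exact: (char_eq0 q_prime hc).
have dchi (n : nat) : dominated (normc (chi n) * B n) (fun v => chi n * (cexp (s * v%:C) * expc (expR v) ^+ n)).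
  case: (posnP n) => [->|n0]; last exact: dominatedZ (dE _ n0).
  by move=> v; rewrite chi0 mul0r normc0 !mul0r.
have e1 : gamma_factor s * \sum_(n < q * k) chi n * dirichlet_power s n =
    cint (fun v => cexp (s * v%:C) * char_kernel q chi (expR v) * (1 - expc (expR v) ^+ (q * k))).
  rewrite mulr_sumr.
  transitivity (\sum_(n < q * k) cint (fun v => chi n * (cexp (s * v%:C) * expc (expR v) ^+ n))).
    apply: eq_bigr => n _; case: (posnP n) => [->|n0].
      rewrite chi0 mul0r mulr0 (eq_cint (g := fun=> 0)) ?cint0// => v; exact: mul0r.
    by rewrite (cintZ _ (mE n) (dE _ n0)) -gamma_mul_dirichlet_power//; ring.
  rewrite -(cint_sum (B := fun n : 'I_(q * k) => normc (chi n) * B n)) => [|n|n]; last 2 first.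
  - by apply: cmeasM; [exact: cmeas_cst|exact: mE].
  - exact: dchi.
  apply: eq_cint => v.
  rewrite -mulrA -(sum_char_kernel q_prime k hc (expR_gt0 v)) mulr_sumr.
  by apply: eq_bigr => n _; rewrite mulrCA.
set f := fun v => cexp (s * v%:C) * char_kernel q chi (expR v).
have mf : cmeas f by apply: cmeasM; [exact: cmeas_cexp|].
pose a : R := ln (q * k)%:R.
have mEq : cmeas (fun v : R => expc (expR v) ^+ (q * k)).
  apply: (cmeas_ext (f := fun v => exp_kernel (v + a))).
    by move=> v; rewrite expc_exp_kernel.
  by apply: ccont_cmeas; apply: ccont_shift; exact: ccont_exp_kernel.
have nEq v : normc (1 - expc (expR v) ^+ (q * k)) <= 1.
  have x0 := expR_ge0 (- ((q * k)%:R * expR v)).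
  have x1 : expR (- ((q * k)%:R * expR v)) <= 1.
    by rewrite -[leRHS]expR0 ler_expR oppr_le0 mulr_ge0// expR_ge0.
  by rewrite expcX /expc -rmorphB/= normcR ger0_norm; lra.
have mf1 : cmeas (fun v => f v * (1 - expc (expR v) ^+ (q * k))).
  by apply: cmeasM => //; apply: cmeasB => //; exact: cmeas_cst.
have df1 : dominated (2 * q%:R) (fun v => f v * (1 - expc (expR v) ^+ (q * k))).
  move=> v; rewrite normcM; apply: le_trans (dK v); rewrite -[leRHS]mulr1.
  by apply: ler_wpM2l; first exact: normc_ge0.
rewrite e1 /char_integral -/f -(cintB mf1 mf df1 dK).
apply: (@le_trans _ _ (2 * (4 * q%:R * expR (- (complex.Re s * a))) * weight_mass R)); last first.
  by rewrite le_eqVlt; apply/orP; left; apply/eqP; rewrite /a; ring.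
apply: (cint_norm_le (a := a)); first exact: cmeasB.
move=> v.
have -> : f v * (1 - expc (expR v) ^+ (q * k)) - f v =
    - (cexp (s * v%:C) * expc (expR v) ^+ (q * k) * char_kernel q chi (expR v)) by rewrite /f; ring.
rewrite normcN normcM.
have h1 := bE _ v qk0; rewrite -/a in h1.
have h2 := normc_char_kernel_le q_prime hc np (expR_gt0 v).
have h2' : normc (char_kernel q chi (expR v)) <= 2 * q%:R.
  apply: (le_trans h2); rewrite ler_pdivrMr; last by have := expR_gt0 v; lra.
  by rewrite ler_peMr ?mulr_ge0 ?(ltW q0')// lerDl expR_ge0.
apply: (le_trans (ler_pM (normc_ge0 _) (normc_ge0 _) h1 h2')).
have -> : 2 * expR (- (complex.Re s * a)) * expR (- (3 / 8 * `|v + a|)) * (2 * q%:R) =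
  4 * q%:R * expR (- (complex.Re s * a)) * expR (- (3 / 8 * `|v + a|)) by ring.
by apply: ler_wpM2l => //; rewrite !mulr_ge0 ?expR_ge0// ltW.
Qed.

Lemma partial_sum_tail s chi k r : dirichlet_character q chi ->
  0 <= complex.Re s -> (0 < k)%N -> (r < q)%N ->
  normc (\sum_(i < r) chi (q * k + i)%N * dirichlet_power s (q * k + i)) <=
  q%:R * expR (- (complex.Re s * ln (q * k)%:R)).
Proof.
move=> hc hs k0 rq; apply: (le_trans (normc_sum _ _ _)).
have qk0 : (0 < q * k)%N by rewrite muln_gt0 q0.
apply: (@le_trans _ _ (\sum_(i < r) expR (- (complex.Re s * ln (q * k)%:R)))).
  apply: ler_sum => i _; rewrite normcM normc_dirichlet_power -[leRHS]mul1r.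
  apply: ler_pM; rewrite ?normc_ge0 ?expR_ge0 ?(normc_char_le1 q_prime)//.
  rewrite ler_expR mulNr lerN2; apply: ler_wpM2l => //.
  by apply: ler_ln_nat => //; exact: leq_addr.
rewrite sumr_const card_ord -[leLHS]mulr_natl ler_wpM2r ?expR_ge0// ler_nat; exact: ltnW.
Qed.

(** Whole periods are compared with the integral, and an incomplete last period has fewer than q
    small terms. The estimate proves convergence of the series, so the [lim] in [dirichlet_L] is a
    genuine limit and no default value. *)
Lemma gamma_dirichlet_L s chi : dirichlet_character q chi ->
  chi <> principal_character R q -> 3/8 <= complex.Re s <= 5/8 -> gamma_factor s != 0 ->
  gamma_factor s * dirichlet_L s chi = char_integral s chi.
Proof.
move=> hc np hs g0; set g := gamma_factor s in g0 *; set G := char_integral s chi.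
have s0 : 3/8 <= complex.Re s by case/andP: hs.
pose c0 : R := 8 * q%:R * weight_mass R + normc g * q%:R.
have c0_ge0 : 0 <= c0.
  by rewrite addr_ge0 ?mulr_ge0 ?normc_ge0 ?weight_mass_ge0// ltW.
have bound N : (q <= N.+1)%N ->
    normc (g * (\sum_(1 <= n < N.+1) chi n * dirichlet_power s n) - G) <=
    c0 * expR (- (3/8 * ln (q * (N.+1 %/ q))%:R)).
  move=> qN; have k0 : (0 < N.+1 %/ q)%N by rewrite divn_gt0.
  set k := (N.+1 %/ q)%N in k0 *.
  have -> : \sum_(1 <= n < N.+1) chi n * dirichlet_power s n =
      \sum_(n < q * k) chi n * dirichlet_power s n +
      \sum_(i < N.+1 %% q) chi (q * k + i)%N * dirichlet_power s (q * k + i).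
    transitivity (\sum_(n < q * k + N.+1 %% q) chi n * dirichlet_power s n); last by rewrite big_split_ord.
    rewrite /k mulnC -divn_eq -(big_mkord xpredT (fun n => chi n * dirichlet_power s n)).
    by rewrite (big_ltn (ltn0Sn N)) (char_eq0 q_prime hc)// mul0r add0r.
  have rq : (N.+1 %% q < q)%N by rewrite ltn_mod.
  have h1 := partial_sum_approx hc np hs k0.
  have h2 := partial_sum_tail hc (le_trans (_ : 0 <= 3/8) s0) k0 rq.
  have {}h2 := h2 ltac:(lra).
  have le38 : expR (- (complex.Re s * ln (q * k)%:R)) <= expR (- (3/8 * ln (q * k)%:R)).
    rewrite ler_expR lerN2; apply: ler_wpM2r => //; exact: ln_nat_ge0.
  rewrite mulrDr addrAC; apply: (le_trans (le_normcD _ _)); rewrite normcM /c0 mulrDl.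
  apply: lerD.
    apply: (le_trans h1); apply: ler_wpM2l => //.
    by rewrite !mulr_ge0 ?weight_mass_ge0// ltW.
  rewrite -[leRHS]mulrA; apply: ler_wpM2l; first exact: normc_ge0.
  by apply: (le_trans h2); apply: ler_wpM2l => //; exact: ltW.
have cv : (fun N : nat => \sum_(1 <= n < N.+1) chi n * dirichlet_power s n : C^o) @ \oo --> (G / g : C^o).
  (* A positive element of R[i] has imaginary part 0, so only its real part [e1] remains. *)
  apply/cvgrPdist_le => e; case: e => e1 e2; rewrite ltcE/= => /andP[/eqP -> e0].
  have ng0 : 0 < normc g by rewrite normc_gt0.
  (* Chosen so that T^(-3/8) = e1 |g| / (c0 + 1), which turns the bound into at most e1 |g|. *)
  pose T : R := expR (8/3 * ln ((c0 + 1) / (e1 * normc g))).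
  have T0 : 0 < T by exact: expR_gt0.
  exists (q * (Num.truncn T + 1))%N => // N /= hN.
  have qN : (q <= N.+1)%N by rewrite (leq_trans _ (leqW hN))// leq_pmulr// addn1.
  have hk : (Num.truncn T + 1 <= N.+1 %/ q)%N by rewrite leq_divRL// mulnC; exact: leqW.
  have hT : T <= (q * (N.+1 %/ q))%:R.
    have /andP[_ h] := truncn_itv (ltW T0).
    apply: (le_trans (ltW h)); rewrite ler_nat -addn1; apply: (leq_trans hk).
    by rewrite leq_pmull.
  have -> : `|G / g - \sum_(1 <= n < N.+1) chi n * dirichlet_power s n| =
    (normc (G / g - \sum_(1 <= n < N.+1) chi n * dirichlet_power s n))%:C by exact: normrcE.
  change ((normc (G / g - \sum_(1 <= n < N.+1) chi n * dirichlet_power s n))%:C <= e1%:C); rewrite lecR.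
  rewrite -(ler_pM2l ng0) -normcM mulrBr mulrCA divff// mulr1 normc_subC.
  apply: (le_trans (bound N qN)).
  have e3 : expR (- (3/8 * ln (q * (N.+1 %/ q))%:R)) <= (e1 * normc g) / (c0 + 1).
    have p0 : 0 < (c0 + 1) / (e1 * normc g) by rewrite divr_gt0 ?mulr_gt0//; lra.
    have -> : e1 * normc g / (c0 + 1) = expR (- ln ((c0 + 1) / (e1 * normc g))).
      by rewrite expRN lnK ?posrE// invf_div.
    rewrite ler_expR lerN2.
    have hl : ln T <= ln (q * (N.+1 %/ q))%:R by rewrite ler_ln ?posrE// (lt_le_trans T0 hT).
    rewrite /T expRK in hl; lra.
  apply: (@le_trans _ _ (c0 * ((e1 * normc g) / (c0 + 1)))); first by apply: ler_wpM2l.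
  rewrite mulrCA [leRHS]mulrC ler_piMr ?mulr_ge0 ?(ltW e0) ?(ltW ng0)//.
  by rewrite ler_pdivrMr; lra.
rewrite /dirichlet_L (cvg_lim (@norm_hausdorff _ _) cv) mulrCA divff// mulr1//.
Qed.

End DirichletLIntegral.

(** * Mean squares of mollified character sums *)

Section ConvolutionProducts.
Variable A : comNzRingType.
Implicit Types (f g psi : nat -> A) (xs : nat -> nat -> A).

Lemma iconvD xs g1 g2 k n :
  iconv xs (fun m => g1 m + g2 m) k n = iconv xs g1 k n + iconv xs g2 k n.
Proof.
elim: k n => [|k IH] n //=; rewrite /conv -big_split/=; apply: eq_bigr => d _.
by rewrite IH mulrDr.
Qed.

Lemma iconv_sum xs (I : finType) (h : I -> A) (g : I -> nat -> A) k n :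
  iconv xs (fun m => \sum_i h i * g i m) k n = \sum_i h i * iconv xs (g i) k n.
Proof.
elim: k n => [|k IH] n //=; rewrite /conv.
rewrite (eq_bigr (fun d => \sum_i xs k d * (h i * iconv xs (g i) k (n %/ d)%N))) => [|d _]; last first.
  by rewrite IH mulr_sumr.
rewrite exchange_big/=; apply: eq_bigr => i _; rewrite mulr_sumr.
by apply: eq_bigr => d _; rewrite mulrCA.
Qed.

(** Multiply out and collect a b = n. By [supp] no product of indices from the supports reaches N,
    so cutting all three sums at N loses nothing. *)
Lemma conv_series f g psi N : (forall m n, psi (m * n)%N = psi m * psi n) ->
  (forall a b, f a * g b != 0 -> (0 < a * b < N)%N) ->
  (\sum_(a < N) f a * psi a) * (\sum_(b < N) g b * psi b) = \sum_(n < N) conv f g n * psi n.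
Proof.
move=> mul supp; rewrite mulr_suml.
under eq_bigr do rewrite mulr_sumr.
transitivity (\sum_(a < N) \sum_(b < N) \sum_(n < N | (0 < n)%N)
    (if (a * b == n)%N then f a * g b * psi n else 0)).
  apply: eq_bigr => a _; apply: eq_bigr => b _.
  have [e|ne] := eqVneq (f a * g b) 0.
    rewrite big1 => [|n _]; last by rewrite e mul0r if_same.
    by rewrite mulrACA e mul0r.
  have /andP[ab0 abN] := supp _ _ ne.
  rewrite (bigD1 (Ordinal abN))//= eqxx [X in _ + X]big1 => [|n /andP[_ nab]]; last first.
    by rewrite ifF//; apply/negbTE; apply: contra nab => /eqP e; apply/eqP/val_inj; rewrite /= e.
  by rewrite addr0 mul mulrACA.
under eq_bigr do rewrite exchange_big/=.
rewrite exchange_big/= [RHS](bigID (fun n : 'I_N => (0 < n)%N))/=.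
(* [divisors 0] consists of 1 alone, so the value at 0 is f(1) g(0), which [supp] forces to
   vanish. *)
rewrite [X in _ = _ + X]big1 ?addr0 => [|n]; last first.
  rewrite -eqn0Ngt => /eqP ->; have -> : conv f g 0 = f 1%N * g 0%N by rewrite /conv big_seq1.
  by have [->|/supp] := eqVneq (f 1%N * g 0%N) 0; rewrite ?mul0r.
apply: eq_bigr => n n0; rewrite /conv (@big_divisors _ _ N) ?n0 ?ltn_ord// mulr_suml.
rewrite [RHS]big_mkcond/=; apply: eq_bigr => a _.
case: ifP => an; last first.
  rewrite big1// => b _; rewrite ifF//; apply/negP => /eqP e.
  by move: an; rewrite -e dvdn_mulr.
have a0 : (0 < a)%N by rewrite (dvdn_gt0 n0 an).
have naN : (n %/ a < N)%N by rewrite (leq_ltn_trans (leq_div _ _)).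
rewrite (bigD1 (Ordinal naN))//= mulnC divnK// eqxx [X in _ + X]big1 ?addr0// => b nb.
rewrite ifF//; apply/negP => /eqP e; move/eqP: nb; apply; apply/val_inj => /=.
by rewrite -e mulKn.
Qed.

End ConvolutionProducts.

Section MollifiedMeanSquare.
Variable R : realType.
Local Notation C := R[i].
Implicit Types (xs : nat -> nat -> C) (g f : nat -> C).

(** Cauchy-Schwarz with weights [a], as nonnegativity of a weighted variance. *)
Lemma sum_mul_sqr_le (I : finType) (a b : I -> R) : (forall i, 0 <= a i) ->
  (\sum_i a i * b i) ^+ 2 <= (\sum_i a i) * \sum_i a i * b i ^+ 2.
Proof.
move=> a0; set s := \sum_i a i; set t := \sum_i a i * b i; set u := \sum_i _ * _.
have s0 : 0 <= s by apply: sumr_ge0.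
have [s1|s1] := eqVneq s 0.
  have a1 i : a i = 0 by apply/eqP; move/eqP: s1; rewrite psumr_eq0// => /allP /(_ i (mem_index_enum _)).
  by rewrite /t big1 ?expr0n ?s1 ?mul0r// => i _; rewrite a1 mul0r.
have sp : 0 < s by rewrite lt_def s1.
have : 0 <= \sum_i a i * (s * b i - t) ^+ 2 by apply: sumr_ge0 => i _; rewrite mulr_ge0 ?sqr_ge0.
have -> : \sum_i a i * (s * b i - t) ^+ 2 = s * (s * u - t ^+ 2).
  have e i : a i * (s * b i - t) ^+ 2 = s ^+ 2 * (a i * b i ^+ 2) - 2 * s * t * (a i * b i) + t ^+ 2 * a i by ring.
  under eq_bigr do rewrite e.
  by rewrite big_split/= sumrB -!mulr_sumr -/s -/t -/u; ring.
by rewrite pmulr_rge0// subr_ge0.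
Qed.

Lemma sum_divisors_support (x : nat -> C) (T : R) n : (0 < n)%N -> 1 <= T ->
  (forall a, normc (x a) <= 1) -> (forall a, x a != 0 -> (0 < a)%N /\ a%:R <= T) ->
  \sum_(d <- divisors n) normc (x d) <= T.
Proof.
move=> n0 T1 x1 xs; have T0 : 0 <= T by lra.
rewrite (@big_divisors _ _ n.+1) ?n0//=.
pose B := (Num.truncn T).+1.
have /andP[tT Tt] := truncn_itv T0.
have h (a : nat) : normc (x a) <= ((0 < a < B)%N : nat)%:R.
  have [e|ne] := eqVneq (x a) 0; first by rewrite e normc0.
  have [a0 aT] := xs _ ne; have aB : (a < B)%N by rewrite -(ltr_nat R) (le_lt_trans aT).
  by rewrite a0 aB; exact: x1.
apply: (@le_trans _ _ (\sum_(d < n.+1 | (0 < d < B)%N) 1)).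
  rewrite big_mkcond [leRHS]big_mkcond; apply: ler_sum => d _ /=; have := h d.
  by case: (0 < d < B)%N; case: ifP => // _ _; rewrite ler01.
apply: le_trans tT.
apply: (@le_trans _ _ (\sum_(d < B | (0 < d)%N) (1 : R))).
  apply: (@ler_sum_ord_sub R n.+1 B (fun d => 0 < d < B)%N (fun d => 0 < d)%N (fun=> 1) (fun=> 1)) => //.
  by move=> d _ /andP[d0 dB]; split.
by rewrite big_mkcond big_ord_recl/= add0r sumr_const card_ord.
Qed.

Lemma normc_conv_le (x g : nat -> C) (T V : R) n : (0 < n)%N -> 1 <= T ->
  (forall a, normc (x a) <= 1) -> (forall a, x a != 0 -> (0 < a)%N /\ a%:R <= T) ->
  (forall m, (0 < m <= n)%N -> normc (g m) <= V) -> normc (conv x g n) <= T * V.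
Proof.
move=> n0 T1 x1 xs gV; apply: (le_trans (normc_sum _ _ _)).
have V0 : 0 <= V by apply: le_trans (gV 1%N _); rewrite ?normc_ge0// n0.
apply: (@le_trans _ _ (\sum_(d <- divisors n) normc (x d) * V)); last first.
  by rewrite -mulr_suml; apply: ler_wpM2r => //; exact: sum_divisors_support.
rewrite big_seq_cond [leRHS]big_seq_cond; apply: ler_sum => d /andP[dn _].
rewrite -dvdn_divisors// in dn; rewrite normcM; apply: ler_wpM2l; first exact: normc_ge0.
by apply: gV; rewrite divn_gt0 ?(dvdn_gt0 n0 dn)// (dvdn_leq n0 dn) leq_div.
Qed.

Variables (q k : nat) (x : nat -> nat -> C) (T : nat -> R) (V : R).
Hypothesis q_prime : prime q.
Hypothesis T1 : forall i, 1 <= T i.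
Hypothesis x1 : forall i a, normc (x i a) <= 1.
Hypothesis xT : forall i a, x i a != 0 -> (0 < a)%N /\ a%:R <= T i.
Hypothesis TV : \prod_(i < k) T i <= V.

Let prodT_ge1 j : 1 <= \prod_(i < j) T i.
Proof. by elim/big_ind: _ => // u v u1 v1; exact: mulr_ege1. Qed.

Let prodT_le j : (j <= k)%N -> \prod_(i < j) T i <= V.
Proof.
move=> jk; apply: le_trans TV; rewrite -(subnKC jk) big_split_ord/= ler_peMr//.
  by rewrite (le_trans _ (prodT_ge1 j)).
by elim/big_ind: _ => // u v u1 v1; exact: mulr_ege1.
Qed.

Let V1 : 1 <= V. Proof. exact: le_trans (prodT_ge1 k) TV. Qed.

(** At most T_i divisors of n lie in the support of the i-th factor, so each convolution costs a
    factor T_i. Meant for error terms, which are small enough to afford the length V of the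
    mollifier. *)
Lemma normc_iconv_le g (U : R) n : (0 < n)%N ->
  (forall m, (0 < m <= n)%N -> normc (g m) <= U) -> normc (iconv x g k n) <= V * U.
Proof.
move=> n0 gU; have U0 : 0 <= U by apply: le_trans (gU 1%N _); rewrite ?normc_ge0// n0.
suff h m : (0 < m <= n)%N -> normc (iconv x g k m) <= (\prod_(i < k) T i) * U.
  by apply: (le_trans (h n _)); rewrite ?n0 ?leqnn//; apply: ler_wpM2r.
elim: k m => [|j IH] m /andP[m0 mn] /=; first by rewrite big_ord0 mul1r gU// m0.
rewrite big_ord_recr/= (mulrC _ (T j)) -mulrA; apply: (normc_conv_le m0 (T1 j) (x1 j)).
- by move=> a; exact: xT.
- by move=> l /andP[l0 lm]; apply: IH; rewrite l0 (leq_trans lm).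
Qed.

Lemma iconv_support g j n : iconv x g j n != 0 ->
  exists a b, [/\ n = (a * b)%N, (0 < a)%N, a%:R <= \prod_(i < j) T i & g b != 0].
Proof.
elim: j n => [|j IH] n /= h; first by exists 1%N, n; rewrite mul1n big_ord0.
have [d dn] : exists2 d, d \in divisors n & x j d * iconv x g j (n %/ d) != 0.
  apply/hasP; apply: contraR h; rewrite -all_predC => /allP h.
  by rewrite /conv big_seq big1// => d /h /= /negPn /eqP.
rewrite mulf_eq0 negb_or => /andP[/xT[d0 dT] /IH [a [b [e a0 aT gb]]]].
have nd : (n = d * (n %/ d))%N.
  case: (posnP n) dn => [->|n0]; first by rewrite div0n muln0.
  by rewrite -dvdn_divisors// => dn; rewrite mulnC divnK.
exists (d * a)%N, b; split => //; first by rewrite -mulnA -e.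
  by rewrite muln_gt0 d0.
by rewrite big_ord_recr/= natrM mulrC; apply: ler_pM.
Qed.

(** V bounds the length of the product of the [x i] and Y that of [g], so V Y <= N keeps every
    product of indices below N at each stage. *)
Lemma iconv_series g (psi : nat -> C) N (Y : R) :
  (forall m n, psi (m * n)%N = psi m * psi n) ->
  (forall b, g b != 0 -> (0 < b)%N /\ b%:R < Y) -> V * Y <= N%:R ->
  (\prod_(i < k) \sum_(a < N) x i a * psi a) * (\sum_(b < N) g b * psi b) =
  \sum_(n < N) iconv x g k n * psi n.
Proof.
move=> mul gs VY; have V0 : 0 < V by have := V1; lra.
suff h j : (j <= k)%N -> (\prod_(i < j) \sum_(a < N) x i a * psi a) * (\sum_(b < N) g b * psi b) =
  \sum_(n < N) iconv x g j n * psi n by exact: h.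
elim: j => [|j IH] jk; first by rewrite big_ord0 mul1r.
rewrite big_ord_recr/= mulrAC IH ?(ltnW jk)// mulrC; apply: conv_series => // a m.
rewrite mulf_eq0 negb_or => /andP[/xT[a0 aT] /iconv_support [c [b [-> c0 cT /gs[b0 bY]]]]].
rewrite !muln_gt0 a0 c0 b0/= -(ltr_nat R); apply: lt_le_trans VY.
have cV : a%:R * c%:R <= V.
  apply: le_trans (prodT_le jk); rewrite big_ord_recr/= mulrC; exact: ler_pM.
rewrite !natrM mulrA; apply: (@le_lt_trans _ _ (V * b%:R)); first by rewrite ler_wpM2r.
by rewrite ltr_pM2l.
Qed.

(** n^(-1/2) is attached to the character, so that a completely multiplicative function is split off
    and only the plain coefficients are convolved. *)
Definition twist_weight chi (n : nat) : C := ((Num.sqrt n%:R)^-1 : R)%:C * chi n.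

Lemma twist_weightM (chi : nat -> C) m n : (forall m n, chi (m * n)%N = chi m * chi n) ->
  twist_weight chi (m * n) = twist_weight chi m * twist_weight chi n.
Proof.
move=> mul; rewrite /twist_weight mul natrM sqrtrM// invfM rmorphM/=; ring.
Qed.

Definition short_product chi : C := \prod_(i < k) \sum_(a < q) x i a * twist_weight chi a.

Lemma normc_short_product_le chi : dirichlet_character q chi -> normc (short_product chi) <= V.
Proof.
move=> hc; apply: le_trans TV; rewrite /short_product normc_prod; apply: ler_prod => i _.
rewrite normc_ge0/=; apply: (le_trans (normc_sum _ _ _)).
have T0 : 0 <= T i by have := T1 i; lra.
have /andP[tT Tt] := truncn_itv T0.
apply: (@le_trans _ _ (\sum_(a < q | (0 < a < (Num.truncn (T i)).+1)%N) 1)).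
  rewrite [leRHS]big_mkcond; apply: ler_sum => a _ /=.
  have [e|ne] := eqVneq (x i a) 0.
    by rewrite e mul0r normc0; case: ifP.
  have [a0 aT] := xT ne; have aB : (a < (Num.truncn (T i)).+1)%N by rewrite -(ltr_nat R) (le_lt_trans aT).
  rewrite a0 aB /twist_weight !normcM normcR.
  have s1 : `|(Num.sqrt a%:R)^-1| <= 1 :> R.
    rewrite ger0_norm ?invr_ge0 ?sqrtr_ge0// invf_le1 ?sqrtr_gt0 ?ltr0n//.
    by rewrite -[leLHS]sqrtr1 ler_wsqrtr// ler1n.
  have c1 := normc_char_le1 q_prime a hc.
  rewrite -[leRHS]mulr1; apply: ler_pM; rewrite ?mulr_ge0 ?normc_ge0//.
  by rewrite -[leRHS]mulr1; apply: ler_pM; rewrite ?normc_ge0.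
apply: le_trans tT.
apply: (@le_trans _ _ (\sum_(d < (Num.truncn (T i)).+1 | (0 < d)%N) (1 : R))).
  apply: (@ler_sum_ord_sub R q (Num.truncn (T i)).+1 (fun d => 0 < d < (Num.truncn (T i)).+1)%N (fun d => 0 < d)%N (fun=> 1) (fun=> 1)) => //.
  by move=> d _ /andP[d0 dB]; split.
by rewrite big_mkcond big_ord_recl/= add0r sumr_const card_ord.
Qed.

Variable S : seq (nat -> C).
Hypothesis S_uniq : uniq S.
Hypothesis S_char : forall chi, chi \in S -> dirichlet_character q chi.

Let q0 : 0 < q%:R :> R. Proof. by rewrite ltr0n prime_gt0. Qed.

(** The short product is bounded by V and the rest by Bessel: coefficients below q^(-1/2) / V
    contribute at most q. *)
Lemma small_mean_square (e : nat -> C) (E : R) : 0 <= E -> V ^+ 2 * E ^+ 2 * q%:R <= 1 ->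
  (forall m, (0 < m < q)%N -> normc (e m) <= E) ->
  \sum_(chi <- S) normc (\sum_(m < q) e m * chi m) ^+ 2 * normc (short_product chi) ^+ 2 <= q%:R.
Proof.
move=> E0 hE he; have V0 : 0 <= V by have := V1; lra.
apply: (@le_trans _ _ (\sum_(chi <- S) normc (\sum_(m < q) e m * chi m) ^+ 2 * V ^+ 2)).
  rewrite big_seq [leRHS]big_seq; apply: ler_sum => chi cS; apply: ler_wpM2l; first exact: sqr_ge0.
  by rewrite lerXn2r ?nnegrE ?normc_ge0//; apply: normc_short_product_le; exact: S_char.
rewrite -mulr_suml; have h := char_bessel q_prime e S_uniq S_char.
apply: (@le_trans _ _ (q%:R * (q%:R * E ^+ 2) * V ^+ 2)); last first.
  have -> : q%:R * (q%:R * E ^+ 2) * V ^+ 2 = q%:R * (V ^+ 2 * E ^+ 2 * q%:R) by ring.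
  by rewrite ler_piMr// ltW.
apply: ler_wpM2r; first exact: sqr_ge0.
apply: (le_trans h); apply: ler_pM; rewrite ?ler_nat ?leq_pred//.
  by apply: sumr_ge0 => n _; exact: sqr_ge0.
apply: (@le_trans _ _ (\sum_(n < q) E ^+ 2)); last by rewrite sumr_const card_ord mulr_natl.
rewrite big_mkcond; apply: ler_sum => n _; case: ifP => n0; last exact: sqr_ge0.
by rewrite lerXn2r ?nnegrE ?normc_ge0// he// n0 ltn_ord.
Qed.

(** The diagonal estimate. The part of [f] below Y times the mollifier has length below q, so Bessel
    leaves the squares of the convolved coefficients, which weighted Cauchy-Schwarz reduces to the
    mean squares H of single powers n^(-z). The part beyond Y is an error. *)
Lemma mollified_mean_square (D : nat) (h z : 'I_D -> C) (H : 'I_D -> R) (f : nat -> C) (E Y : R) (N : nat) :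
  (forall j, \sum_(n < q | (0 < n)%N) normc (iconv x (dirichlet_power (z j)) k n) ^+ 2 / n%:R <= H j) ->
  0 <= E -> V ^+ 2 * E ^+ 2 * q%:R <= 1 -> V * Y <= q%:R -> (N <= q)%N ->
  (forall m, (0 < m < q)%N ->
     normc ((Num.sqrt m%:R)%:C * f m - \sum_j h j * dirichlet_power (z j) m) <= E) ->
  (forall m, (m < q)%N -> Y <= m%:R -> normc (f m) <= E) ->
  (forall m : nat, m%:R < Y -> (m < N)%N) ->
  \sum_(chi <- S) normc (\sum_(m < N) f m * chi m) ^+ 2 * normc (short_product chi) ^+ 2
  <= q%:R * (4 * ((\sum_j normc (h j)) * \sum_j normc (h j) * H j) + 34).
Proof.
move=> hH E0 hE VY Nq hf fE YN; have V0 : 0 < V by have := V1; lra.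
pose inY (m : nat) := (0 < m)%N && (m%:R < Y).
pose f1 m : C := if inY m then f m else 0.
pose f2 m : C := if inY m || (N <= m)%N then 0 else f m.
pose g m : C := if inY m then (Num.sqrt m%:R)%:C * f m else 0.
have chi0 chi : chi \in S -> chi 0%N = 0 by move=> /S_char hc; exact: (char_eq0 q_prime hc).
have split_sum chi : chi \in S -> \sum_(m < N) f m * chi m =
    \sum_(m < q) f1 m * chi m + \sum_(m < q) f2 m * chi m.
  move=> cS; rewrite -big_split/= (big_ord_widen q (fun m => f m * chi m) Nq) big_mkcond/=.
  apply: eq_bigr => m _; rewrite /f1 /f2 ltnNge; case: (leqP N m) => Nm /=.
    have -> : inY m = false by apply/negP => /andP[_ /YN]; rewrite ltnNge Nm.
    by rewrite !mul0r addr0.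
  by rewrite orbF; case: ifP; rewrite !mul0r ?addr0 ?add0r.
have f2E m : (0 < m < q)%N -> normc (f2 m) <= E.
  move=> /andP[m0 mq]; rewrite /f2; case: ifP => [_|]; first by rewrite normc0.
  move/negbT; rewrite negb_or /inY m0/= -leNgt => /andP[Ym _]; exact: fE.
have P2 := small_mean_square E0 hE f2E.
have P1 : \sum_(chi <- S) normc (\sum_(m < q) f1 m * chi m) ^+ 2 * normc (short_product chi) ^+ 2
    <= q%:R * (2 * ((\sum_j normc (h j)) * \sum_j normc (h j) * H j) + 16).
  have e1 chi : chi \in S -> normc (\sum_(m < q) f1 m * chi m) ^+ 2 * normc (short_product chi) ^+ 2
      = normc (\sum_(n < q) (iconv x g k n * ((Num.sqrt n%:R)^-1 : R)%:C) * chi n) ^+ 2.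
    move=> cS; rewrite -exprMn -normcM mulrC; congr (normc _ ^+ 2).
    have -> : \sum_(m < q) f1 m * chi m = \sum_(m < q) g m * twist_weight chi m.
      apply: eq_bigr => m _; rewrite /f1 /g; case: ifP; rewrite ?mul0r// => /andP[m0 _].
      have s0 : Num.sqrt m%:R != 0 :> R by rewrite gt_eqF// sqrtr_gt0 ltr0n.
      have : (Num.sqrt m%:R)%:C * ((Num.sqrt m%:R)^-1 : R)%:C = 1 :> C by rewrite -rmorphM/= divff// rmorph1.
      rewrite /twist_weight; move: (_%:C) (_%:C) => a b ab.
      by rewrite mulrACA ab mul1r.
    have [_ mul _] := S_char cS.
    rewrite /short_product (iconv_series (Y := Y)) => [||b|//]; last 2 first.
    - by move=> m n; exact: twist_weightM.
    - by rewrite /g; case: ifP => [/andP[b0 bY] _|]; [split|rewrite eqxx].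
    by apply: eq_bigr => n _; rewrite /twist_weight mulrA.
  rewrite big_seq (eq_bigr _ e1) -big_seq.
  apply: (le_trans (char_bessel q_prime (fun n => iconv x g k n * ((Num.sqrt n%:R)^-1 : R)%:C) S_uniq S_char)).
  have Ssum0 : 0 <= \sum_j normc (h j) by apply: sumr_ge0 => j _; exact: normc_ge0.
  apply: ler_pM; rewrite ?ler_nat ?leq_pred//.
    by apply: sumr_ge0 => n _; exact: sqr_ge0.
  (* [g] is cut off at Y but the combination of powers is not. The difference is still small for all
     m < q: beyond Y both sqrt(m) f(m) and its approximation are tiny. So the mean squares of the
     uncut n^(-z) can be used. *)
  pose e m : C := g m - \sum_j h j * dirichlet_power (z j) m.
  have gE m : g m = \sum_j h j * dirichlet_power (z j) m + e m by rewrite /e addrC subrK.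
  have sq1 (m : nat) : (0 < m)%N -> 1 <= Num.sqrt m%:R :> R.
    by move=> m0; rewrite -[leLHS]sqrtr1 ler_wsqrtr// ler1n.
  have eb m : (0 < m < q)%N -> normc (e m) <= 2 * Num.sqrt m%:R * E.
    move=> /andP[m0 mq]; have s1 := sq1 m m0.
    have hm := hf m; rewrite m0 mq in hm; have {}hm := hm isT.
    have hE' : E <= Num.sqrt m%:R * E by apply: ler_peMl.
    rewrite /e /g /inY m0/=; case: ltP => [_|Ym]; first by lra.
    have := fE m mq Ym => fm.
    have -> : 0 - \sum_j h j * dirichlet_power (z j) m =
      ((Num.sqrt m%:R)%:C * f m - \sum_j h j * dirichlet_power (z j) m) - (Num.sqrt m%:R)%:C * f m by ring.
    apply: (le_trans (le_normcB _ _)); rewrite normcM normcR ger0_norm ?sqrtr_ge0//.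
    have : Num.sqrt m%:R * normc (f m) <= Num.sqrt m%:R * E by apply: ler_wpM2l => //; rewrite sqrtr_ge0.
    lra.
  have termle (n : 'I_q) : (0 < n)%N ->
      normc (iconv x g k n * ((Num.sqrt n%:R)^-1 : R)%:C) ^+ 2 <=
      2 * ((\sum_j normc (h j)) * \sum_j normc (h j) * (normc (iconv x (dirichlet_power (z j)) k n) ^+ 2 / n%:R))
      + 8 * (V ^+ 2 * E ^+ 2).
    move=> n0; have n0' : 0 < n%:R :> R by rewrite ltr0n.
    have -> : iconv x g k n = \sum_j h j * iconv x (dirichlet_power (z j)) k n + iconv x e k n.
      by rewrite -iconv_sum -iconvD; congr (iconv x _ k n); apply/funext => m; exact: gE.
    rewrite normcM exprMn normcR real_normK ?num_real// exprVn sqr_sqrtr ?ler0n//.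
    have c1 := sqr_normc_le2 (\sum_j h j * iconv x (dirichlet_power (z j)) k n) (iconv x e k n).
    have c2 : normc (\sum_j h j * iconv x (dirichlet_power (z j)) k n) ^+ 2 <=
        (\sum_j normc (h j)) * \sum_j normc (h j) * normc (iconv x (dirichlet_power (z j)) k n) ^+ 2.
      apply: le_trans (sum_mul_sqr_le (fun j => normc (iconv x (dirichlet_power (z j)) k n)) (fun j => normc_ge0 (h j))).
      rewrite lerXn2r ?nnegrE ?normc_ge0//.
        by apply: sumr_ge0 => j _; rewrite mulr_ge0 ?normc_ge0.
      apply: (le_trans (normc_sum _ _ _)); apply: ler_sum => j _; by rewrite normcM.
    have c3 : normc (iconv x e k n) <= V * (2 * Num.sqrt n%:R * E).
      apply: normc_iconv_le => // m /andP[m0 mn].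
      apply: (le_trans (eb m _)); first by rewrite m0 (leq_ltn_trans mn).
      by apply: ler_wpM2r => //; rewrite ler_pM2l// ler_wsqrtr// ler_nat.
    have c4 : normc (iconv x e k n) ^+ 2 <= 4 * (V ^+ 2 * E ^+ 2) * n%:R.
      apply: (@le_trans _ _ ((V * (2 * Num.sqrt n%:R * E)) ^+ 2)).
        by rewrite lerXn2r ?nnegrE ?normc_ge0 ?mulr_ge0 ?sqrtr_ge0// ltW.
      rewrite !exprMn sqr_sqrtr ?ler0n//; lra.
    rewrite -ler_pdivlMr ?invr_gt0// invrK.
    have -> : \sum_j normc (h j) * (normc (iconv x (dirichlet_power (z j)) k n) ^+ 2 / n%:R) =
        (\sum_j normc (h j) * normc (iconv x (dirichlet_power (z j)) k n) ^+ 2) / n%:R.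
      by rewrite mulr_suml; apply: eq_bigr => j _; rewrite mulrA.
    have alg (a b c : R) : (2 * (a * (b / n%:R)) + c) * n%:R = 2 * (a * b) + c * n%:R.
      by field; rewrite gt_eqF.
    rewrite alg; lra.
  apply: (@le_trans _ _ (\sum_(n < q | (0 < n)%N) (2 * ((\sum_j normc (h j)) * \sum_j normc (h j) * (normc (iconv x (dirichlet_power (z j)) k n) ^+ 2 / n%:R))
      + 8 * (V ^+ 2 * E ^+ 2)))); first by apply: ler_sum => n n0; exact: termle.
  rewrite big_split/=; apply: lerD.
    rewrite -mulr_sumr ler_pM2l// -mulr_sumr; apply: ler_wpM2l => //.
    rewrite exchange_big/=; apply: ler_sum => j _; rewrite -mulr_sumr.
    by apply: ler_wpM2l; [exact: normc_ge0|exact: hH].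
  apply: (@le_trans _ _ (\sum_(n < q) 8 * (V ^+ 2 * E ^+ 2))).
    rewrite big_mkcond; apply: ler_sum => n _; case: ifP => // _.
    by rewrite mulr_ge0// mulr_ge0// sqr_ge0.
  rewrite sumr_const card_ord -[leLHS]mulr_natl; move: hE; lra.
(* 34 = 2 * 16 + 2 * 1, from doubling both parts. *)
apply: (@le_trans _ _ (2 * (\sum_(chi <- S) normc (\sum_(m < q) f1 m * chi m) ^+ 2 * normc (short_product chi) ^+ 2)
   + 2 * (\sum_(chi <- S) normc (\sum_(m < q) f2 m * chi m) ^+ 2 * normc (short_product chi) ^+ 2))).
  rewrite !mulr_sumr -big_split/= big_seq [leRHS]big_seq; apply: ler_sum => chi cS.
  rewrite split_sum//; have w0 := sqr_ge0 (normc (short_product chi)).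
  have := ler_wpM2r w0 (sqr_normc_le2 (\sum_(m < q) f1 m * chi m) (\sum_(m < q) f2 m * chi m)).
  by rewrite mulrDl -!mulrA.
move: P1 P2; lra.
Qed.

End MollifiedMeanSquare.

(** * The mollifier as a short product *)

Section MollifierCoefficients.
Variable R : realType.
Local Notation C := R[i].
Implicit Types (c eta Y : R) (q i j n a : nat).

Lemma le_exp_big_Omega Y n : (0 < n)%N ->
  (forall p, prime p -> (p %| n)%N -> p%:R <= Y) -> n%:R <= Y ^+ big_Omega n.
Proof.
move=> n0 hY; have nN : (0 < n < n.+1)%N by rewrite n0/=.
rewrite (natr_prod_logn R nN) (exp_big_Omega _ nN); apply: ler_prod => p pp.
rewrite exprn_ge0//=; case: (posnP (logn p n)) => [->//|l0].
by rewrite lerXn2r ?nnegrE// ?(le_trans (ler0n _ p))// hY//; move: l0; rewrite logn_gt0 mem_primes => /and3P[].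
Qed.

Lemma nu_le1 n : nu R n <= 1.
Proof.
rewrite /nu; apply: prodr_ile1 => p _; rewrite invr_ge0 ler0n/=.
by rewrite invf_le1 ?ltr0n ?fact_gt0// ler1n fact_gt0.
Qed.

Lemma normc_block_coef_le1 pi (l : nat -> nat) i a : normc (block_coef R pi l i a)%:C <= 1.
Proof.
rewrite normcR /block_coef; case: ifP => _; last by rewrite normr0 ler01.
by rewrite normrM norm_liouville mul1r ger0_norm ?nu_ge0// nu_le1.
Qed.

Lemma block_coef_supportP c eta q i a :
  reflect (mollifier_support c eta q i a)
    ((prime_block c eta q i).-nat a && (big_Omega a <= ell eta q i)%N).
Proof.
apply: (iffP andP) => [[h1 h2]|[a0 h1 h2]]; last first.
  by split => //; apply/(pnatP _ a0).
have a0 : (0 < a)%N by case/andP: h1.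
by split => // p pp pd; exact: (elimT (pnatP _ a0) h1).
Qed.

(** Bounds every integer with at most l_i prime factors, all of them up to q^theta_i. *)
Definition block_bound eta q i : R := ((q%:R : R) `^ theta eta q i) ^+ ell eta q i.

Lemma block_bound_ge1 eta q i : 0 < eta -> 1 < ln (q%:R : R) -> 1 <= block_bound eta q i.
Proof.
by move=> e0 l1; apply: exprn_ege1; exact/ltW/(powR_gt1_ln l1)/(theta_gt0 i e0 l1).
Qed.

Lemma mollifier_support_le c eta q i a : 0 < eta -> 1 < ln (q%:R : R) ->
  mollifier_support c eta q i a -> (0 < a)%N /\ a%:R <= block_bound eta q i.
Proof.
move=> e0 l1 [a0 h1 h2]; split => //.
have Y1 := ltW (powR_gt1_ln l1 (theta_gt0 i e0 l1)).
apply: (@le_trans _ _ (((q%:R : R) `^ theta eta q i) ^+ big_Omega a)).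
  by apply: le_exp_big_Omega => // p pp pa; have /andP[] := h1 p pp pa.
exact: ler_weXn2l.
Qed.

Lemma block_coef_le c eta q i a : 0 < eta -> 1 < ln (q%:R : R) ->
  (block_coef R (prime_block c eta q) (ell eta q) i a)%:C != 0 ->
  (0 < a)%N /\ a%:R <= block_bound eta q i.
Proof.
move=> e0 l1; rewrite /block_coef; case: ifP => [/block_coef_supportP h _|]; last by rewrite eqxx.
exact: mollifier_support_le h.
Qed.

(** [mollifier_factor] is a sum over a set of integers; [block_bound] makes this set finite and
    places it below q, so the sum becomes one over a range, as the convolution estimates require. *)
Lemma mollifier_factor_short c eta q i (chi : nat -> C) : 0 < eta -> 1 < ln (q%:R : R) ->
  block_bound eta q i < q%:R ->
  mollifier_factor c eta q i chi =
  \sum_(a < q) (block_coef R (prime_block c eta q) (ell eta q) i a)%:C * twist_weight chi a.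
Proof.
move=> e0 l1 bq; rewrite /mollifier_factor.
pose P a := (prime_block c eta q i).-nat a && (big_Omega a <= ell eta q i)%N.
rewrite (fsbigE [seq a <- index_iota 0 q | P a]).
- rewrite big_filter_cond big_mkord big_mkcond; apply: eq_bigr => a _.
  rewrite /block_coef -/(P a); case: (boolP (P a)) => /= Pa; last by rewrite mul0r.
  rewrite mem_set; last exact/block_coef_supportP.
  by rewrite /twist_weight mulrA -rmorphM.
- by rewrite filter_uniq// iota_uniq.
- by move=> a /=; rewrite mem_filter => /andP[/block_coef_supportP].
- move=> a sa; rewrite mem_filter mem_index_iota/= negb_and => /orP[|].
    by move/negP; case; exact/block_coef_supportP.
  have [_ ab] := mollifier_support_le e0 l1 sa.
  by rewrite -leqNgt -(ler_nat R) leNgt (le_lt_trans ab bq).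
Qed.

(** l_i theta_i <= 2 theta_i^(1/4), and these grow by the factor e^(1/4) >= 5/4 at each step, so the
    sum is at most 2 theta_J^(1/4) / (1 - 4/5). *)
Lemma sum_ell_theta_le eta q J : 0 < eta -> 1 < ln (q%:R : R) ->
  \sum_(i < J.+1) (ell eta q i)%:R * theta eta q i <= 10 * theta eta q J `^ (1 / 4).
Proof.
move=> e0 l1.
have term i : (ell eta q i)%:R * theta eta q i <= 2 * theta eta q i `^ (1 / 4).
  have t0 := theta_gt0 i e0 l1.
  have -> : theta eta q i `^ (1 / 4) = theta eta q i `^ (- (3 / 4)) * theta eta q i.
    rewrite -[X in _ = _ * X](powRr1 (ltW t0)) -powRD; last by rewrite (gt_eqF t0) implybT.
    by congr (_ `^ _); lra.
  rewrite mulrA; apply: ler_wpM2r; first exact: ltW.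
  rewrite /ell natrM; apply: ler_wpM2l => //.
  by have /andP[] := truncn_itv (powR_ge0 (theta eta q i) (- (3 / 4))).
elim: J => [|J IH].
  rewrite big_ord_recr big_ord0 /= add0r; apply: (le_trans (term 0%N)).
  by have := powR_ge0 (theta eta q 0) (1 / 4); lra.
rewrite big_ord_recr/=; have h := term J.+1.
have e : theta eta q J `^ (1 / 4) <= 4 / 5 * theta eta q J.+1 `^ (1 / 4).
  have -> : theta eta q J.+1 = expR 1 * theta eta q J by rewrite -addn1 theta_add.
  rewrite powRM ?expR_ge0 ?(ltW (theta_gt0 J e0 l1))//.
  have -> : expR 1 `^ (1 / 4) = expR (1 / 4) :> R by rewrite /powR gt_eqF ?expR_gt0// expRK mulr1.
  rewrite mulrA; apply: ler_peMl; first exact: powR_ge0.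
  have := expR_ge1Dx (1 / 4 : R); lra.
apply: le_trans (lerD IH h) _; move: e.
move: (theta eta q J `^ _) (theta eta q J.+1 `^ _) => u v; lra.
Qed.

Lemma prod_block_bound_le eta q J (d : R) : 0 < eta -> 1 < ln (q%:R : R) ->
  10 * theta eta q J `^ (1 / 4) <= d ->
  \prod_(i < J.+1) block_bound eta q i <= expR (d * ln q%:R).
Proof.
move=> e0 l1 hd; have q0 : 0 < (q%:R : R) by have := ln_gt1_gt1 l1; lra.
have e i : block_bound eta q i = expR ((ell eta q i)%:R * theta eta q i * ln q%:R).
  by rewrite /block_bound /powR gt_eqF// -expRM_natl mulrA.
under eq_bigr do rewrite e.
rewrite -expR_sum -mulr_suml ler_expR; apply: ler_wpM2r; first lra.
exact: le_trans (sum_ell_theta_le J e0 l1) hd.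
Qed.

Lemma mollifier_short_product c eta q J (chi : nat -> C) (d : R) : 0 < eta -> 1 < ln (q%:R : R) ->
  10 * theta eta q J `^ (1 / 4) <= d -> d < 1 ->
  mollifier c eta q J chi =
  short_product q J.+1 (fun i a => (block_coef R (prime_block c eta q) (ell eta q) i a)%:C) chi.
Proof.
move=> e0 l1 hd d1; have q0 : 0 < (q%:R : R) by have := ln_gt1_gt1 l1; lra.
rewrite /mollifier /short_product; apply: eq_bigr => i _; apply: mollifier_factor_short => //.
have h := prod_block_bound_le e0 l1 hd.
apply: (@le_lt_trans _ _ (expR (d * ln q%:R))).
  apply: le_trans h; rewrite (bigD1 i)//= ler_peMr//.
    by have := block_bound_ge1 i e0 l1; lra.
  by elim/big_ind: _ => // [u v u1 v1|j _]; [exact: mulr_ege1|exact: block_bound_ge1].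
by rewrite -[ltRHS]lnK ?posrE// ltr_expR gtr_pMl//; lra.
Qed.

End MollifierCoefficients.

(** * The dual sum *)

Section InverseExponential.
Variable R : realType.
Local Notation C := R[i].
Implicit Types (u y x : R).

Lemma norm_sin_sub_le y : `|y| <= 1/2 -> `|sin y - y| <= y ^+ 2.
Proof.
wlog y0 : y / 0 <= y.
  move=> h; have [/h//|y0] := leP 0 y.
  have e : sin (- y) - - y = - (sin y - y) by rewrite sinN; ring.
  by have := h (- y); rewrite e !normrN sqrrN oppr_ge0 (ltW y0) => /(_ isT).
rewrite (ger0_norm y0) => y1.
have [c c_itv] : exists2 c, c \in `[0, y]%R & sin y - sin 0 = cos c * (y - 0).
  by apply: MVT_segment => //; apply: continuous_subspaceT; exact: continuous_sin.
rewrite sin0 !subr0 => e; move: c_itv; rewrite in_itv/= => /andP[c0 cy].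
rewrite distrC ger0_norm; last by rewrite subr_ge0 sin_le_id.
rewrite e; have := cosE_sin_half c => e2.
have s0 : 0 <= sin (c / 2) by have := @sin_ge_quarter R (c/2); have := @pi_ge2 R; lra.
have s1 : sin (c / 2) <= c / 2 by apply: sin_le_id; lra.
have : sin (c / 2) ^+ 2 <= (c / 2) ^+ 2 by rewrite lerXn2r ?nnegrE//; lra.
have : c ^+ 2 <= y ^+ 2 by rewrite lerXn2r ?nnegrE//.
have : 0 <= c ^+ 2 by exact: sqr_ge0.
rewrite !expr2; nra.
Qed.

Lemma normc_cis_sub1_sub_le y : `|y| <= 1/2 -> normc (cis y - 1 - (0 +i* y)) <= 2 * y ^+ 2.
Proof.
move=> y1; apply: (le_trans (normc_le_ReIm _)).
have -> : complex.Re (cis y - 1 - (0 +i* y)) = - (1 - cos y).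
  by rewrite /cis /cexp /= expR0; ring.
have -> : complex.Im (cis y - 1 - (0 +i* y)) = sin y - y.
  by rewrite /cis /cexp /= expR0; ring.
have s0 : 0 <= 2 * sin (y / 2) ^+ 2 by apply: mulr_ge0 => //; exact: sqr_ge0.
rewrite normrN cosE_sin_half (ger0_norm s0).
have h := norm_sin_sub_le y1; have h2 := norm_sin_le (y / 2).
have h3 : sin (y / 2) ^+ 2 <= (y / 2) ^+ 2.
  by rewrite -(real_normK (num_real (sin _))) -(real_normK (num_real (y/2))) lerXn2r ?nnegrE.
have -> : 2 * y ^+ 2 = 2 * (y / 2) ^+ 2 + (3/2) * y ^+ 2 by field.
have := sqr_ge0 y; lra.
Qed.

Lemma complexRI (a b : R) : a +i* b = a%:C + (0 +i* b) :> C.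
Proof. by apply/eqP; rewrite eq_complex/= addr0 add0r !eqxx. Qed.

(* With w = u - i y this compares 1 / (1 - e^(-w)) with 1 / w. *)
Lemma inv_one_sub_exp_approx u y : 0 < u <= 1 -> `|y| <= pi ->
  normc ((1 - expc u * cis y)^-1 - (u +i* - y)^-1) <= 256.
Proof.
case/andP=> u0 u1 yp; set w := u +i* - y; set D := 1 - expc u * cis y.
have w0 : 0 < normc w.
  rewrite normc_gt0; apply/negP => /eqP/(congr1 (@complex.Re R)) /= e.
  by rewrite e ltxx in u0.
(* |D|^2 = (1 - x)^2 + 4 x sin(y/2)^2 with x = exp(- u) >= 1/4, and |sin(y/2)| >= |y| / 8 because
   |y| <= pi. *)
have Dw : normc w / 8 <= normc D.
  rewrite -(@ler_sqr _ (normc w / 8)) ?nnegrE ?divr_ge0 ?normc_ge0//.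
  rewrite exprMn exprVn normc_sqr normc_sqr.
  have -> : complex.Re D = 1 - expR (- u) * cos y by rewrite /D /cis /expc /cexp /= expR0; ring.
  have -> : complex.Im D = - (expR (- u) * sin y) by rewrite /D /cis /expc /cexp /= expR0; ring.
  rewrite /=.
  have -> : (1 - expR (- u) * cos y) ^+ 2 + (- (expR (- u) * sin y)) ^+ 2 =
    (1 - expR (- u)) ^+ 2 + 2 * expR (- u) * (1 - cos y) + expR (- u) ^+ 2 * (cos y ^+ 2 + sin y ^+ 2 - 1) by ring.
  rewrite cos2Dsin2 subrr mulr0 addr0 cosE_sin_half.
  set x := expR (- u).
  have x0 : 1/4 <= x.
    have e1 := expR1_le4 R.
    have : (expR 1)^-1 <= x by rewrite -expRN ler_expR; lra.
    have : 4^-1 <= (expR 1)^-1 :> R by rewrite lef_pV2 ?posrE ?expR_gt0.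
    lra.
  have xu : u / 4 <= 1 - x.
    have e2 := expR_ge1Dx u.
    have xe : x * expR u = 1 by rewrite /x -expRD addNr expR0.
    nra.
  have hs : (y / 8) ^+ 2 <= sin (y / 2) ^+ 2.
    have -> : (y / 8) ^+ 2 = (`|y| / 2 / 4) ^+ 2.
      have -> : (`|y| / 2 / 4) ^+ 2 = `|y| ^+ 2 / 64 by field.
      by rewrite real_normK ?num_real//; field.
    have -> : sin (y / 2) ^+ 2 = sin (`|y| / 2) ^+ 2.
      case: (ger0P y) => // y0.
      by rewrite mulNr sinN sqrrN.
    have hq : `|y| / 2 / 4 <= sin (`|y| / 2) by apply: sin_ge_quarter; have := normr_ge0 y; lra.
    have y80 : 0 <= `|y| / 2 / 4 by rewrite !divr_ge0.
    by rewrite lerXn2r ?nnegrE// (le_trans y80 hq).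
  have h1 : (u / 4) ^+ 2 <= (1 - x) ^+ 2 by rewrite lerXn2r ?nnegrE//; lra.
  have s0 : 0 <= sin (y / 2) ^+ 2 by exact: sqr_ge0.
  have h2 : sin (y / 2) ^+ 2 <= 2 * x * (2 * sin (y / 2) ^+ 2).
    have -> : 2 * x * (2 * sin (y / 2) ^+ 2) = (4 * x) * sin (y / 2) ^+ 2 by ring.
    by apply: ler_peMl => //; lra.
  have -> : (u ^+ 2 + (- y) ^+ 2) * (8 ^+ 2)^-1 = (u / 4) ^+ 2 / 4 + (y / 8) ^+ 2 by field.
  have := sqr_ge0 (u / 4); lra.
have D0 : 0 < normc D by apply: lt_le_trans Dw; rewrite divr_gt0.
have invD : normc D^-1 <= 8 / normc w.
  rewrite normcV -[8 / _]invf_div lef_pV2 ?posrE// divr_gt0//.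
(* Away from 0 both inverses are bounded. Near 0 the second order error |w - D| <= 8 |w|^2 is
   divided by |w| |D| >= |w|^2 / 8, which gives 64. *)
have [hw|hw] := leP (normc w) (1/2); last first.
  have iw : (normc w)^-1 <= 2 by rewrite -[2]invrK lef_pV2 ?posrE//; lra.
  by apply: (le_trans (le_normcB _ _)); rewrite (normcV w); lra.
have hu : `|u| <= normc w by exact: (Re_le_normc w).
have hy : `|y| <= normc w by have := Im_le_normc w; rewrite /= normrN.
have -> : D^-1 - w^-1 = (w - D) * D^-1 * w^-1.
  have alg (a b : C) : a != 0 -> b != 0 -> b^-1 - a^-1 = (a - b) * b^-1 * a^-1.
    by move=> a0 b0; field; rewrite a0 b0.
  by apply: alg; rewrite -normc_gt0.
rewrite !normcM (normcV w).
have wD : normc (w - D) <= 8 * normc w ^+ 2.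
  have -> : w - D = ((expR (- u) - 1 - - u)%:C) + (expR (- u))%:C * (cis y - 1 - (0 +i* y))
      + (expR (- u) - 1)%:C * (0 +i* y).
    rewrite /w /D /expc (complexRI u) !rmorphB/= rmorphN/=.
    have -> : (0 +i* - y : C) = - (0 +i* y) by apply/eqP; rewrite eq_complex/= oppr0 !eqxx.
    by rewrite rmorph1; move: (_%:C) (cis y) (0 +i* y) => a b c; ring.
  have hu' : `|- u| <= 1/2 by rewrite normrN; lra.
  have n1 := expR_sub1_sub_le hu'; have n2 := expR_sub1_le hu'.
  have n3 : normc (cis y - 1 - (0 +i* y)) <= 2 * y ^+ 2 by apply: normc_cis_sub1_sub_le; lra.
  have x1 : expR (- u) <= 1 by rewrite -[leRHS]expR0 ler_expR; lra.
  have x0 := expR_ge0 (- u).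
  apply: (le_trans (le_normcD _ _)).
  have m1 : normc ((expR (- u) - 1 - - u)%:C + (expR (- u))%:C * (cis y - 1 - (0 +i* y))) <= 2 * u ^+ 2 + 2 * y ^+ 2.
    apply: (le_trans (le_normcD _ _)); apply: lerD; first by rewrite normcR (le_trans n1)// sqrrN.
    rewrite normcM normcR ger0_norm// -[leRHS]mul1r; apply: ler_pM; rewrite ?normc_ge0//.
  have m2 : normc ((expR (- u) - 1)%:C * (0 +i* y)) <= 2 * `|u| * `|y|.
    rewrite normcM normcR normrN in n2 *; apply: ler_pM; rewrite ?normc_ge0//.
    by rewrite /normc /= expr0n add0r sqrtr_sqr.
  have u2 : u ^+ 2 <= normc w ^+ 2 by rewrite -(real_normK (num_real u)) lerXn2r ?nnegrE ?normc_ge0.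
  have y2 : y ^+ 2 <= normc w ^+ 2 by rewrite -(real_normK (num_real y)) lerXn2r ?nnegrE ?normc_ge0.
  have uy : `|u| * `|y| <= normc w ^+ 2 by rewrite expr2; apply: ler_pM.
  have w2 := sqr_ge0 (normc w); apply: (le_trans (lerD m1 m2)); lra.
apply: (@le_trans _ _ (8 * normc w ^+ 2 * (8 / normc w) * (normc w)^-1)).
  apply: ler_wpM2r; first by rewrite invr_ge0 ltW.
  by apply: ler_pM; rewrite ?normc_ge0.
have -> : 8 * normc w ^+ 2 * (8 / normc w) * (normc w)^-1 = 64 by field; rewrite gt_eqF.
by lra.
Qed.

End InverseExponential.

(** * The two halves of the integral *)

Section PowerSums.
Variables (R : realType) (q N : nat) (K : R).
Local Notation C := R[i].

(* The mollifier is arranged to have length q^(1/64), so that a sum of length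
   cut_length times the mollifier stays below q, and coefficients of size
   error_size contribute O(q) by the trivial bound on the mollifier. *)
Definition error_size : R := expR (- ((1/2 + 1/64) * ln q%:R)).
Definition cut_length : R := expR ((1 - 1/64) * ln q%:R).

(** The common shape of the coefficients of the direct and the dual sum: times sqrt(m) they are
    combinations of m^(-z) with a bounded N-th moment in |z| ln q. N is to dominate the exponent
    with which the mean square of n^(-z) grows. *)
Definition power_sum_approx (S1 : R) (f : nat -> C) : Prop :=
  exists (D : nat) (h z : 'I_D -> C),
  [/\ forall k, `|complex.Re (z k)| <= K / ln q%:R,
      \sum_(k < D) normc (h k) * (1 + normc (z k) * ln q%:R) ^+ N <= S1 &
      forall m, (0 < m < q)%N ->
        normc ((Num.sqrt m%:R)%:C * f m - \sum_k h k * dirichlet_power (z k) m) <= error_size].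

End PowerSums.

Section SmoothedIntegrals.
Variables (R : realType) (q N : nat).
Hypothesis q_prime : prime q.
Local Notation C := R[i].
Local Notation X := (ln (q%:R : R)).
Local Notation wm := (weight_mass R).
Variables (S K : R) (W : R -> C) (alpha : C).
Local Notation s := (2^-1 + alpha : C).
Hypotheses (S0 : 0 <= S) (K0 : 0 <= K) (X1 : 1 <= X).
Hypothesis alphaK : normc alpha <= K / X.
Hypothesis alpha8 : normc alpha <= 1/8.
Hypothesis smW : smooth_weight N X S (S * expR (- (4 * X))) W.
Hypothesis smW' : smooth_weight N X S (S * expR (- (4 * X))) (fun v => 1 - W v).
Hypothesis W1 : forall v : R, v <= - (X / 2) -> W v = 1.
Hypothesis W0 : forall v : R, - (X / 4) <= v -> W v = 0.
Hypothesis largeX : 6 * X <= expR (X / 4).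
Hypothesis largeS : 600 * S * wm * expR (2 * K) <= expR (X / 32).

Let hs : 3/8 <= complex.Re s <= 5/8 := Re_half_add alpha8.
Let wm0 : 0 <= wm := weight_mass_ge0 R.
Let q0 : 0 < q%:R :> R. Proof. by rewrite ltr0n prime_gt0. Qed.
Let eX : expR X = q%:R. Proof. by rewrite lnK ?posrE. Qed.
Let eK1 : 1 <= expR K. Proof. by rewrite -[leLHS]expR0 ler_expR. Qed.

(** By [largeS] a power q^(1/32) absorbs all constants, so each error below has only to beat its
    target by q^(-1/32). *)
Lemma small_error (c Z : R) : 0 <= c -> c <= 512 -> Z <= - (1/32 * X) ->
  c * S * wm * expR (2 * K) * expR Z <= 1.
Proof.
move=> c0 c1 hZ; have e0 := expR_ge0 (2 * K).
have a : c * S * wm * expR (2 * K) <= expR (X / 32).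
  by apply: le_trans largeS; rewrite -!mulrA; apply: ler_wpM2r; [rewrite !mulr_ge0|lra].
apply: (@le_trans _ _ (expR (X / 32) * expR Z)); first by apply: ler_wpM2r => //; exact: expR_ge0.
by rewrite -expRD -[leRHS]expR0 ler_expR; lra.
Qed.

Lemma small_error_le (c c' Z Z' : R) : 0 <= c -> c <= 512 -> 0 <= c' -> c' <= expR (2 * K) ->
  Z - Z' <= - (1/32 * X) -> c' * (c * S * wm * expR Z) <= expR Z'.
Proof.
move=> c0 c1 c0' c1' hZ; have h := small_error c0 c1 hZ.
have -> : expR Z = expR (Z - Z') * expR Z' by rewrite -expRD subrK.
have e' := expR_ge0 Z'; have e'' := expR_ge0 (Z - Z').
have P0 : 0 <= c * S * wm by rewrite !mulr_ge0.
move: h P0 e' e''; move: (c * S * wm) (expR (Z - Z')) (expR Z') => P U e' h P0 e0 U0.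
have -> : c' * (P * (U * e')) = (P * c' * U) * e' by ring.
rewrite -[leRHS]mul1r; apply: ler_wpM2r => //; apply: le_trans h.
by apply: ler_wpM2r => //; apply: ler_wpM2l.
Qed.

(** On the support of W one has v < - X / 4, where the surplus 3/8 - 1/8 of the decay rate over that
    of [weight] is worth exp(- X / 16). *)
Lemma low_dominated (g : R -> C) (G : R) : 0 <= G ->
  (forall v : R, v < - (X / 4) -> normc (g v) <= G) ->
  dominated (G * S * expR (- (X / 16))) (fun v => cexp (s * v%:C) * g v * W v).
Proof.
move=> G0 hg v; have [h|h] := leP (- (X / 4)) v.
  by rewrite W0// mulr0 normc0 !mulr_ge0 ?expR_ge0 ?weight_ge0.
rewrite 2!normcM normc_cexpM.
have e1 : expR (complex.Re s * v) <= expR (- (X / 16)) * weight v.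
  have v0 : v < 0 by move: X1 h; lra.
  rewrite /weight -expRD ler_expR ltr0_norm//.
  case/andP: hs => s1 s2; move: s1 s2; move: (complex.Re _) => sg s1 s2; nra.
have -> : G * S * expR (- (X / 16)) * weight v = (expR (- (X / 16)) * weight v) * G * S by ring.
apply: ler_pM; rewrite ?mulr_ge0 ?normc_ge0 ?expR_ge0//; last by case: smW.
by apply: ler_pM; rewrite ?normc_ge0 ?expR_ge0//; exact: hg.
Qed.

(** Of the two equal factors of [exp_kernel] one ensures integrability, the other provides the
    decay. *)
Definition half_kernel v : C := (expR (- (expR v / 2)))%:C.

Lemma half_kernel_sqr v : exp_kernel v = half_kernel v * half_kernel v.
Proof. by rewrite /exp_kernel /half_kernel -rmorphM/= -expRD; congr (expR _)%:C; lra. Qed.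

Lemma logistic_half_kernel : logistic_bound half_kernel.
Proof.
move=> v; have e0 := expR_ge0 v; rewrite normcR ger0_norm ?expR_ge0//.
have h0 : 0 <= expR v / 2 by lra.
apply: (le_trans (expRN_le h0)).
rewrite -[leRHS]invf_div lef_pV2 ?posrE; lra.
Qed.

(** Where 1 - W is nonzero, v > - X / 2, so v + l > X / 4 and exp(- e^(v + l) / 2) <= exp(- 3 X) by
    [largeX]. The factor [g] will be the constant 1 or the character kernel. *)
Lemma tail_dominated (g : R -> C) (G l : R) : 0 <= G -> 3/4 * X <= l ->
  (forall v, normc (g v) <= G) ->
  forall v, normc (cexp (s * v%:C) * exp_kernel (v + l) * (1 - W v) * g v)
    <= 2 * S * G * expR (- (3 * X)) * weight (v + l).
Proof.
move=> G0 hl hg v; have [h|h] := leP v (- (X / 2)).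
  by rewrite W1// subrr mulr0 mul0r normc0 !mulr_ge0 ?expR_ge0 ?weight_ge0.
have l0 : 0 <= l by move: X1 hl; lra.
rewrite half_kernel_sqr mulrA 3!normcM.
have b := logistic_integrand_le l v logistic_half_kernel hs.
have b1 : normc (cexp (s * v%:C) * half_kernel (v + l)) <= 2 * weight (v + l).
  apply: (le_trans b); rewrite -mulrA; apply: ler_wpM2l => //.
  rewrite -[leRHS]mul1r; apply: ler_pM; rewrite ?expR_ge0//.
    rewrite -[leRHS]expR0 ler_expR oppr_le0 mulr_ge0//; case/andP: hs; lra.
  by rewrite /weight ler_expR; have := normr_ge0 (v + l); lra.
have b2 : normc (half_kernel (v + l)) <= expR (- (3 * X)).
  rewrite normcR ger0_norm ?expR_ge0// ler_expR lerN2.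
  have : expR (X / 4) <= expR (v + l) by rewrite ler_expR; move: X1 hl h; lra.
  move: largeX; lra.
have b3 : normc (1 - W v) <= S by case: smW'.
have -> : 2 * S * G * expR (- (3 * X)) * weight (v + l) =
  2 * weight (v + l) * expR (- (3 * X)) * S * G by ring.
apply: ler_pM; rewrite ?mulr_ge0 ?normc_ge0//.
apply: ler_pM; rewrite ?mulr_ge0 ?normc_ge0//.
by apply: ler_pM; rewrite ?mulr_ge0 ?normc_ge0//.
Qed.

Lemma tail_integral_le (g : R -> C) (G l : R) : cmeas g -> 0 <= G -> 3/4 * X <= l ->
  (forall v, normc (g v) <= G) ->
  normc (cint (fun v => cexp (s * v%:C) * exp_kernel (v + l) * (1 - W v) * g v))
    <= 4 * S * G * wm * expR (- (3 * X)).
Proof.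
move=> mg G0 hl hg.
have h : normc (cint (fun v => cexp (s * v%:C) * exp_kernel (v + l) * (1 - W v) * g v)) <=
    2 * (2 * S * G * expR (- (3 * X))) * wm.
  apply: (cint_norm_le (a := l)); last exact: tail_dominated.
  apply: cmeasM => //; apply: cmeasM; last by case: smW'.
  apply: cmeasM; first exact: cmeas_cexp.
  by apply: ccont_cmeas; apply: ccont_shift; exact: ccont_exp_kernel.
by apply: (le_trans h); rewrite le_eqVlt; apply/orP; left; apply/eqP; ring.
Qed.

Definition smooth_coef (m : nat) : C :=
  cint (fun v => cexp (s * v%:C) * exp_kernel (v + ln m%:R) * (1 - W v)).

Lemma smooth_coef_small (m : nat) : cut_length R q <= m%:R -> normc (smooth_coef m) <= error_size R q.
Proof.
move=> hm; have m0 : 0 < m%:R :> R by apply: lt_le_trans hm; exact: expR_gt0.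
have hl : 3/4 * X <= ln m%:R.
  apply: (@le_trans _ _ ((1 - 1/64) * X)); first by move: X1; lra.
  by rewrite -(expRK ((1 - 1/64) * X)) ler_ln ?posrE ?expR_gt0.
have := @tail_integral_le (fun=> 1) 1 _ (cmeas_cst _) ler01 hl.
rewrite (eq_cint (g := fun v => cexp (s * v%:C) * exp_kernel (v + ln m%:R) * (1 - W v))); last first.
  by move=> v; rewrite mulr1.
move=> h; apply: (le_trans (h _)); first by move=> v; rewrite normc1.
rewrite mulr1 -[leLHS]mul1r; apply: (small_error_le (ler0n _ 4) _ ler01).
- by rewrite ler_nat.
- by rewrite -[leLHS]expR0 ler_expR mulr_ge0.
- by clear h; move: X1; lra.
Qed.

Lemma normc_cexp_alpha l : `|l| <= X -> normc (cexp (alpha * l%:C)) <= expR K.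
Proof.
move=> hl; rewrite normc_cexpM ler_expR; apply: (le_trans (ler_norm _)).
rewrite normrM; apply: (@le_trans _ _ (K / X * X)); last by rewrite divfK// gt_eqF//; move: X1; lra.
by apply: ler_pM => //; exact: le_trans (Re_le_normc _) alphaK.
Qed.

Lemma frequency_weight_le (kap : R) (z : C) : normc z <= normc alpha + `|kap| ->
  (1 + normc z * X) ^+ N <= (1 + K) ^+ N * (1 + `|kap| * X) ^+ N.
Proof.
move=> hz; have X0 : 0 <= X by move: X1; lra.
rewrite -exprMn; apply: lerXn2r; rewrite ?nnegrE ?mulr_ge0 ?addr_ge0 ?mulr_ge0 ?normc_ge0//.
have a : normc alpha * X <= K by rewrite -ler_pdivlMr//; move: X1; lra.
have b : normc z * X <= (normc alpha + `|kap|) * X by apply: ler_wpM2r.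
have c : 0 <= `|kap| * X by rewrite mulr_ge0.
have d := mulr_ge0 K0 c.
move: (normc z * X) b => zX; rewrite mulrDl => b.
by move: (`|kap| * X) b c d => kX b c d; lra.
Qed.

Definition coef_mass : R := expR K * (1 + K) ^+ N * (4 * S * wm).

(** sqrt(m) = m^s m^(- alpha), and m^s times the coefficient is what [kernel_approx] expands in the
    powers m^(- i kap); hence the exponents alpha + i kap. *)
Lemma smooth_coef_approx : power_sum_approx q N K coef_mass smooth_coef.
Proof.
have [D [h [kap [hsum happ]]]] := kernel_approx X1 S0 smW' (@ccont_exp_kernel R) (@logistic_exp_kernel R) hs.
have zre k : complex.Re (alpha + 0 +i* kap k) = complex.Re alpha.
  by case: (alpha) => a b /=; rewrite addr0.
exists D, h, (fun k => alpha + 0 +i* kap k); split.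
- by move=> k; rewrite zre; exact: le_trans (Re_le_normc _) alphaK.
- apply: (@le_trans _ _ ((1 + K) ^+ N * \sum_(k < D) normc (h k) * (1 + `|kap k| * X) ^+ N)).
    rewrite mulr_sumr; apply: ler_sum => k _; rewrite mulrCA; apply: ler_wpM2l; first exact: normc_ge0.
    apply: frequency_weight_le; apply: (le_trans (le_normcD _ _)); rewrite lerD2l.
    by rewrite /normc /= expr0n add0r sqrtr_sqr.
  rewrite /coef_mass -mulrA -[leLHS]mul1r; apply: ler_pM => //.
    by rewrite mulr_ge0 ?exprn_ge0 ?addr_ge0 ?sumr_ge0// => k _; rewrite mulr_ge0 ?normc_ge0 ?exprn_ge0 ?addr_ge0 ?mulr_ge0//; move: X1; lra.
  by apply: ler_wpM2l; [rewrite exprn_ge0// addr_ge0|].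
move=> m /andP[m0 mq]; set l : R := ln m%:R.
have l0 : 0 <= l by exact: ln_nat_ge0.
have lX : l <= X by apply: ler_ln_nat => //; exact: ltnW.
have hl : - 3 <= l <= X by apply/andP; split => //; move: l0; lra.
have sq : (Num.sqrt m%:R)%:C = cexp (s * l%:C) * cexp (- alpha * l%:C).
  rewrite -cexpD -mulrDl; have -> : s - alpha = 2^-1 by rewrite addrK.
  have -> : (2^-1 * l%:C : C) = (l / 2)%:C by rewrite rmorphM/= fmorphV/= rmorph_nat mulrC.
  rewrite cexpR; congr (_%:C).
  apply/eqP; rewrite -(@eqrXn2 _ 2)// ?sqrtr_ge0 ?expR_ge0// sqr_sqrtr// -expRM_natl.
  by rewrite mulrC divfK// lnK// posrE ltr0n.
have dpE k : dirichlet_power (alpha + 0 +i* kap k) m = cexp (- alpha * l%:C) * cis (- (kap k * l)).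
  rewrite /dirichlet_power -/l opprD mulrDl cexpD; congr (_ * cexp _).
  by apply/eqP; rewrite eq_complex/=; apply/andP; split; apply/eqP; ring.
have -> : (Num.sqrt m%:R)%:C * smooth_coef m - \sum_k h k * dirichlet_power (alpha + 0 +i* kap k) m =
  cexp (- alpha * l%:C) * (cexp (s * l%:C) * cint (fun v => cexp (s * v%:C) * exp_kernel (v + l) * (1 - W v))
    - \sum_k h k * cis (- (kap k * l))).
  rewrite mulrBr mulr_sumr sq /smooth_coef -/l; congr (_ - _); first by ring.
  by apply: eq_bigr => k _; rewrite dpE; ring.
rewrite normcM.
have e1 : normc (cexp (- alpha * l%:C)) <= expR K.
  have -> : - alpha * l%:C = alpha * (- l)%:C by rewrite rmorphN/=; ring.
  by apply: normc_cexp_alpha; rewrite normrN ger0_norm.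
apply: (@le_trans _ _ (expR K * (8 * S * wm * expR (- (4 * X))))).
  by apply: ler_pM; rewrite ?normc_ge0//; exact: happ.
apply: (small_error_le (ler0n _ 8) _ (expR_ge0 K)).
- by rewrite ler_nat.
- by rewrite ler_expR; move: K0; lra.
- by move: X1; lra.
Qed.

Lemma dominated_exp_kernel (m : nat) :
  dominated (2 * expR (- (complex.Re s * ln m%:R)) * expR (`|ln m%:R| / 8))
    (fun v => cexp (s * v%:C) * exp_kernel (v + ln m%:R)).
Proof.
move=> v; apply: (le_trans (logistic_integrand_le (ln m%:R) v (@logistic_exp_kernel R) hs)).
rewrite -(mulrA (2 * _)); apply: ler_wpM2l; first by rewrite mulr_ge0 ?expR_ge0.
apply: le_trans (weight_shift_le (ln m%:R) v).
by rewrite /weight ler_expR; have := normr_ge0 (v + ln m%:R : R); lra.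
Qed.

Lemma cmeas_exp_kernel l : cmeas (fun v => cexp (s * v%:C) * exp_kernel (v + l)).
Proof.
apply: cmeasM; first exact: cmeas_cexp.
by apply: ccont_cmeas; apply: ccont_shift; exact: ccont_exp_kernel.
Qed.

(** One period is enough: K(e^v) is the sum over m < q of chi(m) exp(- m e^v), plus K(e^v) exp(- q
    e^v), and against 1 - W the last term is negligible by the tail estimate with l = ln q. *)
Lemma smooth_part chi : dirichlet_character q chi -> chi <> principal_character R q ->
  normc (cint (fun v => cexp (s * v%:C) * char_kernel q chi (expR v) * (1 - W v))
    - \sum_(m < q) smooth_coef m * chi m) <= 8 * q%:R * S * wm * expR (- (3 * X)).
Proof.
move=> hc np; have q0n : (0 < q)%N := prime_gt0 q_prime.
have chi0 : chi 0%N = 0 by exact: (char_eq0 q_prime hc).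
have mW' : cmeas (fun v => 1 - W v) by case: smW'.
have bW' v : normc (1 - W v) <= S by case: smW'.
pose t (m : nat) v := chi m * (cexp (s * v%:C) * exp_kernel (v + ln m%:R) * (1 - W v)).
pose rest v := cexp (s * v%:C) * exp_kernel (v + X) * (1 - W v) * char_kernel q chi (expR v).
have mK := cmeas_char_kernel q_prime chi.
have bK v : normc (char_kernel q chi (expR v)) <= 2 * q%:R.
  have v0 := expR_ge0 v; apply: (le_trans (normc_char_kernel_le q_prime hc np (expR_gt0 v))).
  rewrite ler_pdivrMr; last lra.
  by apply: ler_peMr; [rewrite mulr_ge0// ltW|rewrite lerDl].
have mt m : cmeas (t m).
  apply: cmeasM; first exact: cmeas_cst.
  by apply: cmeasM => //; exact: cmeas_exp_kernel.
pose B (m : nat) := 2 * expR (- (complex.Re s * ln m%:R)) * expR (`|ln m%:R : R| / 8).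
have d1 (m : nat) : dominated (B m * S) (fun v => cexp (s * v%:C) * exp_kernel (v + ln m%:R) * (1 - W v)).
  move=> v; rewrite normcM; have -> : B m * S * weight v = B m * weight v * S by ring.
  by apply: ler_pM; rewrite ?normc_ge0//; exact: dominated_exp_kernel.
have dt (m : nat) : dominated (normc (chi m) * (B m * S)) (t m) by exact: dominatedZ (d1 m).
have q20 : 0 <= 2 * q%:R :> R by rewrite mulr_ge0// ltW.
have hX : 3/4 * X <= X by move: X1; lra.
have drest : dominated (2 * S * (2 * q%:R) * expR (- (3 * X)) * expR (`|X| / 8)) rest.
  move=> v; apply: (le_trans (tail_dominated q20 hX bK v)).
  rewrite -(mulrA _ (expR (`|X| / 8))); apply: ler_wpM2l; last exact: weight_shift_le.
  by rewrite !mulr_ge0 ?expR_ge0// ltW.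
have mrest : cmeas rest.
  by apply: cmeasM => //; apply: cmeasM => //; exact: cmeas_exp_kernel.
have e1 : cint (fun v => cexp (s * v%:C) * char_kernel q chi (expR v) * (1 - W v)) =
    cint (fun v => \sum_(m < q) t m v) + cint rest.
  have mT : cmeas (fun v => \sum_(m < q) t m v) by apply: cmeas_sum => m _; exact: mt.
  have dT : dominated (\sum_(m < q) normc (chi m) * (B m * S)) (fun v => \sum_(m < q) t m v).
    move=> v; rewrite mulr_suml; apply: (le_trans (normc_sum _ _ _)).
    by apply: ler_sum => m _; exact: dt.
  rewrite -(cintD mT mrest dT drest).
  apply: eq_cint => v; have := sum_char_kernel q_prime 1 hc (expR_gt0 v); rewrite muln1 => e.
  have e2 : \sum_(m < q) t m v = cexp (s * v%:C) * (1 - W v) * \sum_(n < q) chi n * expc (expR v) ^+ n.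
    rewrite mulr_sumr; apply: eq_bigr => m _; rewrite /t; case: (posnP m) => [->|m0].
      by rewrite chi0 !mul0r mulr0.
    by rewrite (expc_exp_kernel _ m0); ring.
  by rewrite e2 e /rest -(expc_exp_kernel _ q0n); ring.
rewrite e1 (cint_sum (B := fun m : 'I_q => normc (chi m) * (B m * S))) => [|m|m]; [|exact: mt|exact: dt].
have -> : \sum_(m < q) cint (t m) = \sum_(m < q) smooth_coef m * chi m.
  apply: eq_bigr => m _; rewrite /t (cintZ _ _ (d1 m)) 1?mulrC//.
  by apply: cmeasM => //; exact: cmeas_exp_kernel.
rewrite addrC addKr; apply: (le_trans (tail_integral_le mK q20 hX bK)).
by rewrite le_eqVlt; apply/orP; left; apply/eqP; ring.
Qed.

(** With y = 2 pi m / q this is the kernel that the Gauss sum produces at m. [inv_lin] is its pole,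
    which scales in y and so becomes accessible to [kernel_approx]. *)
Definition inv_exp (y v : R) : C := (1 - expc (expR v) * cis y)^-1.
Definition inv_lin (y v : R) : C := (expR v +i* - y)^-1.

Lemma expR_I_neq0 y v : (expR v +i* y) != 0 :> C.
Proof. by rewrite eq_complex/= negb_and gt_eqF ?expR_gt0. Qed.

Lemma cmeas_inv_lin y : cmeas (inv_lin y).
Proof.
apply: (cmeas_inv (f := fun v => expR v +i* - y)); first by move=> v; exact: expR_I_neq0.
by split => //=; exact: measurable_cst.
Qed.

Lemma cmeas_inv_exp y : cmeas (inv_exp y).
Proof.
apply: (cmeas_inv (f := fun v => 1 - expc (expR v) * cis y)).
  move=> v; rewrite subr_eq0; apply/negP => /eqP e.
  have : normc (expc (expR v) * cis y) = 1 by rewrite -e normc1.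
  rewrite normcM normc_cis mulr1 normc_expc => /eqP; rewrite lt_eqF//.
  by rewrite -[ltRHS]expR0 ltr_expR oppr_lt0 expR_gt0.
apply: cmeasB; first exact: cmeas_cst.
apply: cmeasM; last exact: cmeas_cst.
exact: ccont_cmeas (@ccont_exp_kernel R).
Qed.

Lemma normc_inv_lin_le y v : y != 0 -> normc (inv_lin y v) <= `|y|^-1.
Proof.
move=> y0; rewrite /inv_lin normcV lef_pV2 ?posrE ?normr_gt0 ?normc_gt0 ?expR_I_neq0//.
by rewrite -[leLHS]normrN; exact: (Im_le_normc (expR v +i* - y)).
Qed.

Lemma inv_exp_sub_lin y v : `|y| <= pi -> v < - (X / 4) ->
  normc (inv_exp y v - inv_lin y v) <= 256.
Proof.
move=> yp hv; apply: inv_one_sub_exp_approx => //.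
by rewrite expR_gt0/= -[leRHS]expR0 ler_expR; move: X1 hv; lra.
Qed.

Definition lin_coef y : C := cint (fun v => cexp (s * v%:C) * inv_lin y v * W v).
Definition exp_coef y : C := cint (fun v => cexp (s * v%:C) * inv_exp y v * W v).

Let mW : cmeas W. Proof. by case: smW. Qed.

Lemma cmeas_low g : cmeas g -> cmeas (fun v => cexp (s * v%:C) * g v * W v).
Proof. by move=> mg; apply: cmeasM => //; apply: cmeasM => //; exact: cmeas_cexp. Qed.

Lemma dominated_lin y : y != 0 ->
  dominated (`|y|^-1 * S * expR (- (X / 16))) (fun v => cexp (s * v%:C) * inv_lin y v * W v).
Proof. by move=> y0; apply: low_dominated; [rewrite invr_ge0|move=> v _; exact: normc_inv_lin_le]. Qed.

Lemma dominated_exp y : y != 0 -> `|y| <= pi ->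
  dominated ((256 + `|y|^-1) * S * expR (- (X / 16))) (fun v => cexp (s * v%:C) * inv_exp y v * W v).
Proof.
move=> y0 yp; apply: low_dominated; first by rewrite addr_ge0// invr_ge0.
move=> v hv; rewrite -(subrK (inv_lin y v) (inv_exp y v)).
apply: (le_trans (le_normcD _ _)); apply: lerD; first exact: inv_exp_sub_lin.
exact: normc_inv_lin_le.
Qed.

Lemma lin_coef_le y : y != 0 -> normc (lin_coef y) <= 2 * (`|y|^-1 * S * expR (- (X / 16))) * wm.
Proof. by move=> y0; apply: cint_norm_le0; [exact/cmeas_low/cmeas_inv_lin|exact: dominated_lin]. Qed.

Lemma exp_coef_sub_lin y : y != 0 -> `|y| <= pi ->
  normc (exp_coef y - lin_coef y) <= 2 * (256 * S * expR (- (X / 16))) * wm.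
Proof.
move=> y0 yp; rewrite /exp_coef /lin_coef.
rewrite -(cintB (cmeas_low (cmeas_inv_exp y)) (cmeas_low (cmeas_inv_lin y)) (dominated_exp y0 yp) (dominated_lin y0)).
rewrite (eq_cint (g := fun v => cexp (s * v%:C) * (inv_exp y v - inv_lin y v) * W v)); last by move=> v; ring.
apply: cint_norm_le0.
  by apply: cmeas_low; apply: cmeasB; [exact: cmeas_inv_exp|exact: cmeas_inv_lin].
by apply: low_dominated => // v hv; exact: inv_exp_sub_lin.
Qed.

Lemma ccont_inv_lin y : ccont (inv_lin y).
Proof.
have N0 v : expR v ^+ 2 + (- y) ^+ 2 != 0.
  by rewrite gt_eqF// ltr_wpDr ?sqr_ge0// exprn_gt0// expR_gt0.
have cN : continuous (fun v : R => (expR v ^+ 2 + (- y) ^+ 2)^-1).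
  move=> v; apply: (@continuousV _ _ (fun v => expR v ^+ 2 + (- y) ^+ 2)); first exact: N0.
  apply: (@continuousD _ R^o _ (fun v => expR v ^+ 2) (fun=> (- y) ^+ 2)); last exact: cst_continuous.
  by apply: (@continuousM _ R^o expR expR); exact: continuous_expR.
split.
- move=> v; apply: (@continuousM _ R^o expR (fun v => (expR v ^+ 2 + (- y) ^+ 2)^-1)); [exact: continuous_expR|exact: cN].
- move=> v; apply: (@continuousN _ R^o _ (fun v => (- y) * (expR v ^+ 2 + (- y) ^+ 2)^-1)).
  by apply: (@continuousM _ R^o (fun=> - y) (fun v => (expR v ^+ 2 + (- y) ^+ 2)^-1)); [exact: cst_continuous|exact: cN].
Qed.

Lemma logistic_inv_lin e : `|e| = 1 -> logistic_bound (inv_lin e).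
Proof.
move=> e1 v; have t0 := expR_gt0 v.
have d0 : 0 < (1 + expR v) / 2 by lra.
have n0 : 0 < normc (expR v +i* - e) by rewrite normc_gt0 expR_I_neq0.
rewrite /inv_lin normcV -[leRHS]invf_div lef_pV2 ?posrE//.
rewrite -(@ler_sqr _ ((1 + _) / 2)) ?nnegrE ?normc_ge0 ?(ltW d0)//.
rewrite normc_sqr/= sqrrN -(real_normK (num_real e)) e1.
have := sqr_ge0 (expR v - 1); nra.
Qed.

Definition xi (m : nat) : R := pi *+ 2 * m%:R / q%:R.
(** The sign e distinguishes the residues m and q - m; q^(-1/2) is the inverse modulus of the Gauss
    sum by which the dual sum is divided. *)
Definition dual_coef (e : R) (m : nat) : C := ((Num.sqrt q%:R)^-1 : R)%:C * lin_coef (e * xi m).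

Lemma xi_gt0 m : (0 < m)%N -> 0 < xi m.
Proof. by move=> m0; rewrite /xi divr_gt0// mulr_gt0 ?ltr0n// mulrn_wgt0// pi_gt0. Qed.

Lemma cexp_half_ln (x : R) : 0 < x -> cexp (2^-1 * (ln x)%:C) = (Num.sqrt x)%:C.
Proof.
move=> x0; have -> : (2^-1 * (ln x)%:C : C) = (ln x / 2)%:C by rewrite rmorphM/= fmorphV/= rmorph_nat mulrC.
rewrite cexpR; congr (_%:C); apply/eqP.
rewrite -(@eqrXn2 _ 2)// ?sqrtr_ge0 ?expR_ge0// sqr_sqrtr ?(ltW x0)// -expRM_natl.
by rewrite mulrC divfK// lnK// posrE.
Qed.

Lemma inv_sqrt_q : (Num.sqrt q%:R)^-1 = expR (- (X / 2)) :> R.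
Proof.
rewrite expRN; congr (_^-1); apply/eqP.
rewrite -(@eqrXn2 _ 2)// ?sqrtr_ge0 ?expR_ge0// sqr_sqrtr ?(ltW q0)// -expRM_natl.
by rewrite mulrC divfK// lnK// posrE.
Qed.

(** In this range 1 / xi(m) <= q^(1/64); with q^(-1/16) from the support of W and q^(-1/2) from the
    Gauss sum this makes q^(-1/2 - 3/64), better than [error_size] by q^(-1/32). *)
Lemma dual_coef_small e (m : nat) : `|e| = 1 -> cut_length R q <= m%:R ->
  normc (dual_coef e m) <= error_size R q.
Proof.
move=> e1 hm; have m0' : 0 < m%:R :> R by apply: lt_le_trans hm; exact: expR_gt0.
have m0 : (0 < m)%N by rewrite -(ltr0n R).
have x0 := xi_gt0 m0.
have nx : `|e * xi m| = xi m by rewrite normrM e1 mul1r gtr0_norm.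
have y0 : e * xi m != 0 by rewrite -normr_eq0 nx gt_eqF.
rewrite /dual_coef normcM normcR inv_sqrt_q ger0_norm ?expR_ge0//.
have h := lin_coef_le y0; rewrite nx in h.
have ix : (xi m)^-1 <= expR (1/64 * X).
  have p2 := @pi_ge2 R.
  rewrite -[leRHS]invrK lef_pV2 ?posrE ?invr_gt0 ?expR_gt0// -expRN.
  have -> : expR (- (1/64 * X)) = cut_length R q / q%:R.
    transitivity (expR ((1 - 1/64) * X) / expR X); last by rewrite eX.
    by rewrite -expRN -expRD; congr expR; ring.
  rewrite /xi; apply: ler_wpM2r; first by rewrite invr_ge0 ltW.
  apply: (le_trans hm); apply: ler_peMl; first exact: ltW.
  by rewrite -mulr_natr; move: p2; lra.
apply: (@le_trans _ _ (1 * (2 * S * wm * expR (1/64 * X - X / 16 - X / 2)))).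
  rewrite mul1r !expRD -mulrA.
  apply: (@le_trans _ _ (expR (- (X / 2)) * (2 * (expR (1/64 * X) * S * expR (- (X / 16))) * wm))).
    apply: ler_wpM2l; first exact: expR_ge0.
    apply: (le_trans h); apply: ler_wpM2r => //; rewrite ler_pM2l//.
    by apply: ler_wpM2r; [exact: expR_ge0|apply: ler_wpM2r].
  by rewrite le_eqVlt; apply/orP; left; apply/eqP; ring.
apply: (small_error_le (ler0n _ 2) _ ler01).
- by rewrite ler_nat.
- by rewrite -[leLHS]expR0 ler_expR mulr_ge0.
- by clear h; move: X1; lra.
Qed.

(** The pole scales: 1 / (e^v - i e xi) is 1 / xi times the same function for y = e, translated by l
    = - ln xi(m) = L - ln m. So [kernel_approx] is applied once, to a kernel independent of m, and
    the exponents become - (alpha + i kap). *)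
Lemma dual_coef_approx e : `|e| = 1 -> power_sum_approx q N K coef_mass (dual_coef e).
Proof.
move=> e1.
have [D [h [kap [hsum happ]]]] := kernel_approx X1 S0 smW (@ccont_inv_lin e) (logistic_inv_lin e1) hs.
pose L : R := X - ln (pi *+ 2).
(* The factor independent of m that is left when sqrt(m) q^(-1/2) / xi(m) is combined with the power
   xi(m)^s; bounded by exp(K) as L <= X. *)
pose P : C := cexp (2^-1 * (L - X)%:C) * cexp (alpha * (- L)%:C).
have p2 := @pi_ge2 R; have p4 := @pihalf_lt2 R.
have pp : 0 < pi *+ 2 :> R by rewrite -mulr_natr; lra.
have lnp0 : 0 <= ln (pi *+ 2 : R) by apply: ln_ge0; rewrite -mulr_natr; lra.
have lnp3 : ln (pi *+ 2 : R) <= 3.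
  rewrite -[leRHS]expRK ler_ln ?posrE ?expR_gt0//.
  have h1 := expR_ge1Dx (1 : R).
  have -> : expR 3 = expR 1 * expR 1 * expR 1 :> R by rewrite -!expRD; congr expR; lra.
  have h2 : 4 <= expR 1 * expR 1 :> R by nra.
  by rewrite -mulr_natr; nra.
have X6 : 6 <= expR (X / 4) by move: largeX X1; lra.
have X32 : 3/2 <= X.
  have e14 := expR1_le4 R; rewrite leNgt; apply/negP => hX.
  have : expR (X / 4) <= expR 1 by rewrite ler_expR; lra.
  by move: X6 e14; lra.
have nP : normc P <= expR K.
  rewrite /P normcM -[leRHS]mul1r; apply: ler_pM; rewrite ?normc_ge0//.
    have -> : (2^-1 * (L - X)%:C : C) = ((L - X) / 2)%:C by rewrite [RHS]rmorphM/= fmorphV/= rmorph_nat mulrC.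
    rewrite cexpR normcR ger0_norm ?expR_ge0// -[leRHS]expR0 ler_expR /L; lra.
  by apply: normc_cexp_alpha; rewrite normrN /L ler_norml; apply/andP; split; lra.
have zre k : complex.Re (- (alpha + 0 +i* kap k)) = - complex.Re alpha.
  by case: (alpha) => a b /=; rewrite addr0.
exists D, (fun k => h k * (P * cis (- (kap k * L)))), (fun k => - (alpha + 0 +i* kap k)); split.
- by move=> k; rewrite zre normrN; exact: le_trans (Re_le_normc _) alphaK.
- apply: (@le_trans _ _ (\sum_(k < D) expR K * (normc (h k) * ((1 + K) ^+ N * (1 + `|kap k| * X) ^+ N)))).
    apply: ler_sum => k _; rewrite normcM normcM normc_cis mulr1 -!mulrA mulrCA.
    have X0 : 0 <= X by move: X1; lra.
    apply: ler_pM; rewrite ?mulr_ge0 ?normc_ge0 ?exprn_ge0 ?addr_ge0 ?mulr_ge0 ?normc_ge0//.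
    apply: ler_wpM2l; first exact: normc_ge0.
    apply: frequency_weight_le; rewrite normcN; apply: (le_trans (le_normcD _ _)); rewrite lerD2l.
    by rewrite /normc /= expr0n add0r sqrtr_sqr.
  rewrite -mulr_sumr /coef_mass -mulrA; apply: ler_wpM2l; first exact: expR_ge0.
  under eq_bigr do rewrite mulrCA.
  by rewrite -mulr_sumr; apply: ler_wpM2l => //; rewrite exprn_ge0// addr_ge0.
move=> m /andP[m0 mq]; set lm : R := ln m%:R.
have x0 := xi_gt0 m0; pose l := - ln (xi m).
have m0' : 0 < m%:R :> R by rewrite ltr0n.
have lE : l = L - lm.
  by rewrite /l /xi /L lnM ?posrE ?invr_gt0 ?mulr_gt0// lnM ?posrE// lnV ?posrE// /lm; ring.
have lm0 : 0 <= lm by exact: ln_nat_ge0.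
have lmX : lm <= X by apply: ler_ln_nat => //; exact: ltnW.
(* l may be negative, but since m < q it is at least - ln(2 pi) >= - 3. *)
have hl : - 3 <= l <= X by rewrite lE /L; apply/andP; split; lra.
pose I : C := cint (fun v => cexp (s * v%:C) * inv_lin e (v + l) * W v).
have cl : ccont (fun v => inv_lin e (v + l)) by apply: ccont_shift; exact: ccont_inv_lin.
have ne : e != 0 by rewrite -normr_eq0 e1 oner_eq0.
have dI : dominated (1 * S * expR (- (X / 16))) (fun v => cexp (s * v%:C) * inv_lin e (v + l) * W v).
  apply: low_dominated => // v _; have := normc_inv_lin_le (v + l) ne.
  by rewrite e1 invr1.
have linE : lin_coef (e * xi m) = cexp l%:C * I.
  rewrite /I -(cintZ _ (cmeas_low (ccont_cmeas cl)) dI) /lin_coef; apply: eq_cint => v.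
  suff -> : inv_lin (e * xi m) v = cexp l%:C * inv_lin e (v + l) by ring.
  have -> : cexp l%:C = ((xi m)%:C)^-1 by rewrite cexpR /l expRN lnK ?posrE// fmorphV.
  rewrite /inv_lin -invfM; congr (_^-1).
  rewrite expRD /l expRN lnK ?posrE//; apply/eqP; rewrite eq_complex/=; apply/andP; split; apply/eqP.
    by field; rewrite gt_eqF.
  by ring.
pose J : C := cexp (s * l%:C) * I.
have dpE k : dirichlet_power (- (alpha + 0 +i* kap k)) m = cexp (alpha * lm%:C) * cis (kap k * lm).
  rewrite /dirichlet_power -/lm opprK mulrDl cexpD; congr (_ * cexp _).
  by apply/eqP; rewrite eq_complex/=; apply/andP; split; apply/eqP; ring.
have main : (Num.sqrt m%:R)%:C * dual_coef e m = P * cexp (alpha * lm%:C) * J.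
  have s1 : (Num.sqrt m%:R)%:C = cexp (2^-1 * lm%:C) by rewrite cexp_half_ln.
  have s2 : ((Num.sqrt q%:R)^-1 : R)%:C = cexp (- (2^-1 * X%:C)).
    rewrite inv_sqrt_q -cexpR; congr cexp.
    by rewrite rmorphN/= rmorphM/= fmorphV/= rmorph_nat mulrC.
  have eA : cexp (2^-1 * lm%:C) * cexp (- (2^-1 * X%:C)) * cexp l%:C =
      cexp (2^-1 * (L - X)%:C) * cexp (alpha * (- L)%:C) * cexp (alpha * lm%:C) * cexp (s * l%:C).
    by rewrite -5!cexpD; congr cexp; rewrite lE !(rmorphB, rmorphN)/=; field.
  rewrite /dual_coef linE s1 s2 /P /J.
  transitivity (cexp (2^-1 * lm%:C) * cexp (- (2^-1 * X%:C)) * cexp l%:C * I); first by rewrite !mulrA.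
  by rewrite eA !mulrA.
have -> : (Num.sqrt m%:R)%:C * dual_coef e m - \sum_k h k * (P * cis (- (kap k * L))) * dirichlet_power (- (alpha + 0 +i* kap k)) m =
    P * cexp (alpha * lm%:C) * (J - \sum_k h k * cis (- (kap k * l))).
  rewrite main mulrBr mulr_sumr; congr (_ - _); apply: eq_bigr => k _; rewrite dpE.
  have -> : cis (- (kap k * l)) = cis (- (kap k * L)) * cis (kap k * lm).
    by rewrite -cisD lE; congr cis; ring.
  by ring.
rewrite 2!normcM.
apply: (@le_trans _ _ (expR K * expR K * (8 * S * wm * expR (- (4 * X))))).
  apply: ler_pM; rewrite ?mulr_ge0 ?normc_ge0//; last exact: happ.
  apply: ler_pM; rewrite ?normc_ge0//.
  by apply: normc_cexp_alpha; rewrite ger0_norm.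
rewrite -expRD; apply: (small_error_le (ler0n _ 8) _ (expR_ge0 _)).
- by rewrite ler_nat.
- by rewrite ler_expR; lra.
- by move: X1; lra.
Qed.

End SmoothedIntegrals.

(** * Gauss sums turn the character kernel into its dual *)

Section GaussDuality.
Variables (R : realType) (q : nat).
Hypothesis q_prime : prime q.
Hypothesis q_odd : odd q.
Local Notation C := R[i].
Implicit Types (chi : nat -> C).

Let q0 : (0 < q)%N := prime_gt0 q_prime.

Lemma eeE m : ee R q m = cis (xi R q m). Proof. by []. Qed.

Lemma ee_subq m : (m <= q)%N -> ee R q (q - m) = cis (- xi R q m).
Proof.
move=> mq; apply: (mulIf (cexp_neq0 (0 +i* xi R q m))); transitivity (1 : C).
  by rewrite -[X in _ * X]/(ee R q m) -eeD subnK// eeq.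
by rewrite -[RHS]cisD addNr cis0.
Qed.

(** Pairing m with q - m leaves m <= q / 2, where xi(m) <= pi, as the comparison of [inv_exp] with
    its pole requires. For odd q there is no middle term. *)
Lemma sum_fold_odd (F : nat -> C) : F 0%N = 0 -> F q = 0 ->
  \sum_(m < q) F m = \sum_(m < (q./2).+1) F m + \sum_(m < (q./2).+1) F (q - m)%N.
Proof.
move=> F0 Fq; set h := q./2.
have qE : q = (h.+1 + h)%N by rewrite /h addSn addnn -[LHS]odd_double_half q_odd.
rewrite [in LHS]qE big_split_ord/=; congr (_ + _).
rewrite big_ord_recl/= subn0 Fq add0r (reindex_inj rev_ord_inj)/=; apply: eq_bigr => i _.
congr F; have ih := ltn_ord i; rewrite /bump/= /h in ih *.
by move: qE; rewrite /h; lia.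
Qed.

(** Expand chi(r) in additive characters and sum over r first: the geometric sum (1 - E^q) / (1 -
    e(m/q) E) has the denominator of the kernel as its numerator. The residue q - m contributes
    psi(-1) psi(m), where q - 1 represents -1. *)
Lemma char_kernel_gauss chi v : dirichlet_character q chi -> chi <> principal_character R q ->
  gauss_sum q (conj_character chi) * char_kernel q chi (expR v) =
  \sum_(m < (q./2).+1) conj_character chi m * inv_exp (xi R q m) v +
  conj_character chi q.-1 * \sum_(m < (q./2).+1) conj_character chi m * inv_exp (- xi R q m) v.
Proof.
move=> hc np; set psi := conj_character chi; set E := expc (expR v).
have hpsi : dirichlet_character q psi by exact: conj_char.
have psi0 n : (q %| n)%N -> psi n = 0 by exact: (char_eq0 q_prime hpsi).
have nE : normc E < 1 by rewrite normc_expc -[ltRHS]expR0 ltr_expR oppr_lt0 expR_gt0.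
have d1 : 1 - E ^+ q != 0.
  by rewrite -normc_eq0 normc_1subX ?expR_gt0// gt_eqF// (one_subX_gt0 q_prime)// expR_gt0.
have d2 m : 1 - ee R q m * E != 0.
  rewrite subr_eq0; apply/negP => /eqP e; have : normc (ee R q m * E) = 1 by rewrite -e normc1.
  by rewrite normcM normc_ee mul1r => e1; rewrite e1 ltxx in nE.
have key : gauss_sum q psi * char_kernel q chi (expR v) =
    \sum_(m < q) psi m * (1 - ee R q m * E)^-1.
  rewrite /char_kernel -/E mulrA mulr_sumr.
  have -> : \sum_(r < q) gauss_sum q psi * (chi r * E ^+ r) =
      \sum_(m < q) psi m * ((1 - E ^+ q) / (1 - ee R q m * E)).
    transitivity (\sum_(r < q) \sum_(m < q) psi m * (ee R q m * E) ^+ r).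
      apply: eq_bigr => r _; rewrite mulrA (mulrC (gauss_sum _ _)) (char_gauss q_prime _ hc np) mulr_suml.
      by apply: eq_bigr => m _; rewrite exprMn eeM mulrA.
    rewrite exchange_big/=; apply: eq_bigr => m _; rewrite -mulr_sumr; congr (_ * _).
    apply: (mulIf (d2 m)); rewrite divfK//.
    have := subrX1 (ee R q m * E) q; rewrite exprMn -eeM mulnC eeM eeq// expr1n mul1r => h.
    rewrite mulrC -[1 - ee R q m * E]opprB mulNr -h opprB//.
  rewrite mulr_suml; apply: eq_bigr => m _.
  by rewrite -mulrA; congr (_ * _); rewrite mulrAC divff// mul1r.
rewrite key (sum_fold_odd (F := fun m => psi m * (1 - ee R q m * E)^-1)); last 2 first.
- by rewrite psi0 ?mul0r.
- by rewrite psi0 ?mul0r.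
congr (_ + _).
  by apply: eq_bigr => m _; rewrite /inv_exp eeE mulrC -/E (mulrC E) mulrC.
rewrite mulr_sumr; apply: eq_bigr => m _; have mq : (m <= q)%N.
  have := ltn_ord m; rewrite ltnS => h; apply: (leq_trans h); rewrite -divn2; exact: leq_div.
have -> : psi (q - m)%N = psi q.-1 * psi m.
  have [_ mul _] := hpsi; rewrite -mul -(char_mod _ hpsi) -[RHS](char_mod _ hpsi); congr psi.
  case: (posnP m) => [->|m0]; first by rewrite subn0 muln0 modnn mod0n.
  apply/eqP; rewrite -(eqn_modDr m) subnK// modnn.
  by rewrite addnC -mulSn prednK// modnMr.
by rewrite ee_subq// /inv_exp -/E -mulrA (mulrC (cis _)).
Qed.

End GaussDuality.

(** * Mean square of the whole integral from its two parts *)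

Section IntegralMeanSquare.
Variables (R : realType) (q N : nat).
Hypothesis q_prime : prime q.
Hypothesis q_odd : odd q.
Local Notation C := R[i].
Local Notation X := (ln (q%:R : R)).
Local Notation wm := (weight_mass R).
Variables (S1 K : R) (W : R -> C) (alpha : C).
Local Notation s := (2^-1 + alpha : C).
Hypotheses (S0 : 0 <= S1) (K0 : 0 <= K) (X1 : 1 <= X).
Hypothesis alphaK : normc alpha <= K / X.
Hypothesis alpha8 : normc alpha <= 1/8.
Hypothesis smW : smooth_weight N X S1 (S1 * expR (- (4 * X))) W.
Hypothesis smW' : smooth_weight N X S1 (S1 * expR (- (4 * X))) (fun v => 1 - W v).
Hypothesis W1 : forall v : R, v <= - (X / 2) -> W v = 1.
Hypothesis W0 : forall v : R, - (X / 4) <= v -> W v = 0.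
Hypothesis largeX : 6 * X <= expR (X / 4).
Hypothesis largeX2 : 2 * cut_length R q <= q%:R.
Hypothesis largeS : 600 * S1 * wm * expR (2 * K) <= expR (X / 32).
Variables (w : (nat -> C) -> R) (C1 : R).
Hypothesis w_ge0 : forall chi, 0 <= w chi.
Hypothesis w_conj : forall chi, w (conj_character chi) = w chi.
Hypothesis mean_le : forall (f : nat -> C) (M : nat) (T : seq (nat -> C)), uniq T ->
  (forall chi, chi \in T -> dirichlet_character q chi) ->
  power_sum_approx q N K (coef_mass N S1 K) f ->
  (forall m, (m < q)%N -> cut_length R q <= m%:R -> normc (f m) <= error_size R q) ->
  (M <= q)%N -> (forall m : nat, m%:R < cut_length R q -> (m < M)%N) ->
  \sum_(chi <- T) normc (\sum_(m < M) f m * chi m) ^+ 2 * w chi <= C1 * q%:R.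
Hypothesis small_le : forall (e : nat -> C) (T : seq (nat -> C)), uniq T ->
  (forall chi, chi \in T -> dirichlet_character q chi) ->
  (forall m, (0 < m < q)%N -> normc (e m) <= error_size R q) ->
  \sum_(chi <- T) normc (\sum_(m < q) e m * chi m) ^+ 2 * w chi <= q%:R.

Let wm0 : 0 <= wm := weight_mass_ge0 R.
Let q0 : (0 < q)%N := prime_gt0 q_prime.
Let q0' : 0 < q%:R :> R. Proof. by rewrite ltr0n. Qed.
Let eX : expR X = q%:R. Proof. by rewrite lnK ?posrE. Qed.
Let half := (q./2).+1.
Let hs : 3/8 <= complex.Re s <= 5/8 := Re_half_add alpha8.

Let halfq : (half <= q)%N.
Proof. by rewrite /half -divn2 ltn_Pdiv. Qed.

Let xi_le_pi m : (m < half)%N -> xi R q m <= pi.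
Proof.
move=> mh; rewrite /xi ler_pdivrMr// -(mulr_natr pi 2) -mulrA ler_pM2l ?pi_gt0//.
rewrite -natrM ler_nat mulnC; move: mh; rewrite /half ltnS => mh.
apply: (@leq_trans (q./2 * 2)); first by rewrite leq_mul2r mh orbT.
by rewrite -divn2; exact: leq_trunc_div.
Qed.

Let sgn_xi e m : `|e| = 1 -> (0 < m < half)%N -> e * xi R q m != 0 /\ `|e * xi R q m| <= pi.
Proof.
move=> e1 /andP[m0 mh]; have x0 := xi_gt0 R q_prime m0.
have nx : `|e * xi R q m| = xi R q m by rewrite normrM e1 mul1r gtr0_norm.
by split; [rewrite -normr_eq0 nx gt_eqF|rewrite nx xi_le_pi].
Qed.

(** The error of replacing [inv_exp] by its pole. It has no power structure in m, but its size,
    q^(-1/2 - 1/16) up to constants, suffices for the trivial bound. *)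
Definition dual_error e m : C := if (0 < m < half)%N then
  ((Num.sqrt q%:R)^-1 : R)%:C * (exp_coef W alpha (e * xi R q m) - lin_coef W alpha (e * xi R q m)) else 0.

Lemma dual_error_le e m : `|e| = 1 -> normc (dual_error e m) <= error_size R q.
Proof.
move=> e1; rewrite /dual_error; case: ifP => hm; last by rewrite normc0 expR_ge0.
have [y0 yp] := sgn_xi e1 hm; have h := exp_coef_sub_lin S0 X1 alpha8 smW W0 y0 yp.
rewrite normcM normcR (inv_sqrt_q R q_prime) ger0_norm ?expR_ge0//.
apply: (@le_trans _ _ (1 * (512 * S1 * wm * expR (- (X / 16) - X / 2)))).
  apply: (le_trans (ler_wpM2l (expR_ge0 _) h)).
  by rewrite mul1r expRD le_eqVlt; apply/orP; left; apply/eqP; ring.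
apply: (small_error_le S0 largeS (ler0n _ 512) _ ler01).
- by [].
- by rewrite -[leLHS]expR0 ler_expR mulr_ge0.
- by clear h; move: X1; lra.
Qed.

Lemma exp_coef_split e psi : `|e| = 1 -> psi 0%N = 0 ->
  ((Num.sqrt q%:R)^-1 : R)%:C * (\sum_(m < half) psi m * exp_coef W alpha (e * xi R q m)) =
  \sum_(m < half) dual_coef q W alpha e m * psi m + \sum_(m < q) dual_error e m * psi m.
Proof.
move=> e1 psi0; rewrite mulr_sumr.
have -> : \sum_(m < q) dual_error e m * psi m = \sum_(m < half) dual_error e m * psi m.
  rewrite (big_ord_widen q (fun m => dual_error e m * psi m) halfq) [RHS]big_mkcond/=.
  apply: eq_bigr => m _; case: ifP => // mh; rewrite /dual_error mh andbF mul0r//.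
rewrite -big_split/=; apply: eq_bigr => m _; rewrite /dual_coef /dual_error ltn_ord andbT.
by case: (posnP m) => [->|m0]; [rewrite psi0; ring|ring].
Qed.

Lemma cint_inv_exp_sum e (c : nat -> C) : `|e| = 1 -> c 0%N = 0 ->
  [/\ cmeas (fun v => \sum_(m < half) c m * (cexp (s * v%:C) * inv_exp (e * xi R q m) v * W v)),
     exists B, dominated B (fun v => \sum_(m < half) c m * (cexp (s * v%:C) * inv_exp (e * xi R q m) v * W v)) &
     cint (fun v => \sum_(m < half) c m * (cexp (s * v%:C) * inv_exp (e * xi R q m) v * W v)) =
     \sum_(m < half) c m * exp_coef W alpha (e * xi R q m)].
Proof.
move=> e1 c0.
pose t (m : nat) v := c m * (cexp (s * v%:C) * inv_exp (e * xi R q m) v * W v).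
pose b (m : nat) : R := normc (c m) * ((256 + `|e * xi R q m|^-1) * S1 * expR (- (X / 16))).
have mt0 (m : nat) : cmeas (fun v => cexp (s * v%:C) * inv_exp (e * xi R q m) v * W v).
  exact: (cmeas_low alpha smW (cmeas_inv_exp _)).
have mt (m : nat) : cmeas (t m) by apply: cmeasM; [exact: cmeas_cst|exact: mt0].
have dt (m : 'I_half) : dominated (b m) (t m).
  (* At m = 0, where xi(0) = 0, the integrand with [inv_exp] grows as v tends to minus infinity; the
     coefficient c(0) = 0 removes it. *)
  case: (posnP m) => [m0|m0]; first by move=> v; rewrite /t /b m0 c0 !mul0r normc0 !mul0r.
  have [y0 yp] := sgn_xi e1 (introT andP (conj m0 (ltn_ord m))).
  exact: dominatedZ (dominated_exp S0 X1 alpha8 smW W0 y0 yp).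
split; first by apply: cmeas_sum => m _; exact: mt.
  exists (\sum_(m < half) b m) => v; rewrite mulr_suml; apply: (le_trans (normc_sum _ _ _)).
  by apply: ler_sum => m _; exact: dt.
rewrite (cint_sum (B := fun m : 'I_half => b m)) => [|m|m]; [|exact: mt|exact: dt].
apply: eq_bigr => m _; case: (posnP m) => [m0|m0].
  rewrite /t m0 c0 mul0r (eq_cint (g := fun=> 0)) ?cint0// => v; exact: mul0r.
have [y0 yp] := sgn_xi e1 (introT andP (conj m0 (ltn_ord m))).
by rewrite /t (cintZ _ (mt0 m) (dominated_exp S0 X1 alpha8 smW W0 y0 yp)).
Qed.

Lemma char_integral_low chi : dirichlet_character q chi -> chi <> principal_character R q ->
  gauss_sum q (conj_character chi) * cint (fun v => cexp (s * v%:C) * char_kernel q chi (expR v) * W v) =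
  \sum_(m < half) conj_character chi m * exp_coef W alpha (1 * xi R q m) +
  conj_character chi q.-1 * \sum_(m < half) conj_character chi m * exp_coef W alpha (-1 * xi R q m).
Proof.
move=> hc np; set psi := conj_character chi.
have psi0 : psi 0%N = 0 by apply: (char_eq0 q_prime (conj_char hc)).
have mW : cmeas W by case: smW.
have mK : cmeas (fun v => cexp (s * v%:C) * char_kernel q chi (expR v)).
  by apply: cmeasM; [exact: cmeas_cexp|exact: cmeas_char_kernel].
have dK := dominated_char_kernel q_prime hc np hs.
have dKW : dominated (2 * q%:R * S1) (fun v => cexp (s * v%:C) * char_kernel q chi (expR v) * W v).
  move=> v; rewrite normcM; have -> : 2 * q%:R * S1 * weight v = 2 * q%:R * weight v * S1 by ring.
  by apply: ler_pM; rewrite ?normc_ge0//; case: smW.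
have n1 : `|1| = 1 :> R by rewrite normr1.
have n1' : `|-1| = 1 :> R by rewrite normrN1.
have [m1 [B1 d1] c1] := cint_inv_exp_sum n1 psi0.
have psi0' : (fun m => psi q.-1 * psi m) 0%N = 0 by rewrite /= psi0 mulr0.
have [m2 [B2 d2] c2] := @cint_inv_exp_sum (-1) (fun m => psi q.-1 * psi m) n1' psi0'.
rewrite -(cintZ _ (cmeasM mK mW) dKW).
rewrite mulr_sumr; under [X in _ = _ + X]eq_bigr do rewrite mulrA.
rewrite -c1 -c2 -(cintD m1 m2 d1 d2); apply: eq_cint => v.
transitivity (gauss_sum q psi * char_kernel q chi (expR v) * (cexp (s * v%:C) * W v)); first by ring.
rewrite (char_kernel_gauss q_prime q_odd v hc np) -/psi mulrDl; congr (_ + _).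
  by rewrite mulr_suml; apply: eq_bigr => m _; rewrite mul1r; ring.
rewrite -mulrA mulr_suml mulr_sumr; apply: eq_bigr => m _; rewrite mulN1r; ring.
Qed.

(** The dual sum involves conjugate characters; as [w] is invariant under conjugation, it is a
    weighted sum over the conjugated list. *)
Lemma sum_conj (F : (nat -> C) -> R) (T : seq (nat -> C)) :
  \sum_(chi <- T) F (conj_character chi) * w chi =
  \sum_(psi <- [seq conj_character chi | chi <- T]) F psi * w psi.
Proof. by rewrite big_map; apply: eq_bigr => chi _; rewrite w_conj. Qed.

Lemma weighted_sum_le (I : Type) (T : seq I) (F1 F2 F3 F4 F5 F6 : I -> R) (b1 b2 b3 b4 b5 b6 : R) :
  \sum_(i <- T) F1 i <= b1 -> \sum_(i <- T) F2 i <= b2 -> \sum_(i <- T) F3 i <= b3 ->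
  \sum_(i <- T) F4 i <= b4 -> \sum_(i <- T) F5 i <= b5 -> \sum_(i <- T) F6 i <= b6 ->
  \sum_(i <- T) (4 * F1 i + 4 * F2 i + (8 * F3 i + 8 * F4 i) + (8 * F5 i + 8 * F6 i))
  <= 4 * b1 + 4 * b2 + (8 * b3 + 8 * b4) + (8 * b5 + 8 * b6).
Proof.
move=> h1 h2 h3 h4 h5 h6; rewrite !big_split/= -!mulr_sumr.
by repeat (apply: lerD || apply: ler_wpM2l).
Qed.

(** Squares are split repeatedly by |a + b|^2 <= 2 |a|^2 + 2 |b|^2: 4 for the direct sum and its
    remainder, 8 for the main part and the error of the dual sum with either sign, and 4 + 8 + 8 =
    20. *)
Lemma integral_mean_square (T : seq (nat -> C)) : uniq T ->
  (forall chi, chi \in T -> dirichlet_character q chi /\ chi <> principal_character R q) ->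
  \sum_(chi <- T) normc (char_integral q s chi) ^+ 2 * w chi <= (20 * C1 + 20) * q%:R.
Proof.
move=> uT hT; have hTc chi : chi \in T -> dirichlet_character q chi by move=> /hT[].
pose T' := [seq conj_character chi | chi <- T].
have uT' : uniq T' by rewrite map_inj_uniq//; exact: can_inj (@conj_characterK R).
have hT' psi : psi \in T' -> dirichlet_character q psi.
  by move=> /mapP[chi cT ->]; apply: conj_char; exact: hTc.
have n1 : `|1| = 1 :> R by rewrite normr1.
have n1' : `|-1| = 1 :> R by rewrite normrN1.
pose r : R := 8 * q%:R * S1 * wm * expR (- (3 * X)).
have r0 : 0 <= r by rewrite !mulr_ge0 ?expR_ge0// ltW.
have rE : r <= error_size R q.
  apply: (@le_trans _ _ (1 * (8 * S1 * wm * expR (X - 3 * X)))).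
    by rewrite /r mul1r expRD eX le_eqVlt; apply/orP; left; apply/eqP; ring.
  apply: (small_error_le S0 largeS (ler0n _ 8) _ ler01).
  - by rewrite ler_nat.
  - by rewrite -[leLHS]expR0 ler_expR mulr_ge0.
  - by move: X1; lra.
(* a remainder of modulus r is the character sum with the single coefficient r at m = 1 *)
pose er (m : nat) : C := if m == 1%N then r%:C else 0.
have Pr := small_le (e := er) uT hTc.
have cutM : forall m : nat, m%:R < cut_length R q -> (m < q)%N.
  move=> m hm; rewrite -(ltr_nat R); apply: (lt_le_trans hm).
  by have := expR_ge0 ((1 - 1/64) * X); move: largeX2; rewrite /cut_length; lra.
have cutH : forall m : nat, m%:R < cut_length R q -> (m < half)%N.
  move=> m hm; rewrite /half ltnS -divn2 leq_divRL//.
  by rewrite -(ler_nat R) natrM; move: largeX2; lra.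
have PA := mean_le uT hTc (smooth_coef_approx S0 K0 X1 alphaK alpha8 smW' largeS)
  (fun m _ hm => smooth_coef_small S0 K0 X1 alpha8 smW' W1 largeX largeS hm) (leqnn q) cutM.
have PD (e : R) (e1 : `|e| = 1) := mean_le uT' hT' (dual_coef_approx q_prime S0 K0 X1 alphaK alpha8 smW W0 largeX largeS e1)
  (fun m _ hm => dual_coef_small q_prime S0 K0 X1 alpha8 smW W0 largeS e1 hm) halfq cutH.
have PE (e : R) (e1 : `|e| = 1) := small_le (e := dual_error e) uT' hT' (fun m _ => dual_error_le m e1).
have {}Pr : \sum_(chi <- T) normc (\sum_(m < q) er m * chi m) ^+ 2 * w chi <= q%:R.
  by apply: Pr => m _; rewrite /er; case: ifP => _; rewrite ?normc0 ?expR_ge0// normcR ger0_norm.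
pose A (chi : nat -> C) := normc (\sum_(m < q) smooth_coef W alpha m * chi m) ^+ 2 * w chi.
pose Rr (chi : nat -> C) := normc (\sum_(m < q) er m * chi m) ^+ 2 * w chi.
pose Dd (e : R) (psi : nat -> C) := normc (\sum_(m < half) dual_coef q W alpha e m * psi m) ^+ 2.
pose Ee (e : R) (psi : nat -> C) := normc (\sum_(m < q) dual_error e m * psi m) ^+ 2.
apply: (@le_trans _ _ (\sum_(chi <- T) (4 * A chi + 4 * Rr chi
   + (8 * (Dd 1 (conj_character chi) * w chi) + 8 * (Ee 1 (conj_character chi) * w chi))
   + (8 * (Dd (-1) (conj_character chi) * w chi) + 8 * (Ee (-1) (conj_character chi) * w chi))))); last first.
  have dD e : `|e| = 1 -> \sum_(chi <- T) Dd e (conj_character chi) * w chi <= C1 * q%:R.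
    by move=> e1; rewrite sum_conj; exact: PD.
  have dE e : `|e| = 1 -> \sum_(chi <- T) Ee e (conj_character chi) * w chi <= q%:R.
    by move=> e1; rewrite sum_conj; exact: PE.
  apply: (le_trans (weighted_sum_le PA Pr (dD _ n1) (dE _ n1) (dD _ n1') (dE _ n1'))).
  by rewrite le_eqVlt; apply/orP; left; apply/eqP; ring.
rewrite big_seq [leRHS]big_seq; apply: ler_sum => chi cT.
have [hc np] := hT chi cT; set psi := conj_character chi.
have hpsi : dirichlet_character q psi by exact: conj_char.
have psi0 : psi 0%N = 0 by apply: (char_eq0 q_prime hpsi).
have nppsi : psi <> principal_character R q.
  by move=> e; apply: np; rewrite -(conj_characterK chi) -/psi e conj_principal.
pose GA := cint (fun v => cexp (s * v%:C) * char_kernel q chi (expR v) * (1 - W v)).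
pose GB := cint (fun v => cexp (s * v%:C) * char_kernel q chi (expR v) * W v).
have mW : cmeas W by case: smW.
have mW' : cmeas (fun v => 1 - W v) by case: smW'.
have mK : cmeas (fun v => cexp (s * v%:C) * char_kernel q chi (expR v)).
  by apply: cmeasM; [exact: cmeas_cexp|exact: cmeas_char_kernel].
have dK := dominated_char_kernel q_prime hc np hs.
have dKW Q : (forall v, normc (Q v) <= S1) ->
    dominated (2 * q%:R * S1) (fun v => cexp (s * v%:C) * char_kernel q chi (expR v) * Q v).
  move=> bQ v; rewrite normcM; have -> : 2 * q%:R * S1 * weight v = 2 * q%:R * weight v * S1 by ring.
  by apply: ler_pM; rewrite ?normc_ge0//; exact: dK.
have GE : char_integral q s chi = GA + GB.
  rewrite /GA /GB -(cintD (cmeasM mK mW') (cmeasM mK mW) (dKW _ (sw_bound smW')) (dKW _ (sw_bound smW))).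
  by apply: eq_cint => v; ring.
have hA : normc GA ^+ 2 <= 2 * normc (\sum_(m < q) smooth_coef W alpha m * chi m) ^+ 2
     + 2 * normc (\sum_(m < q) er m * chi m) ^+ 2.
  have h := smooth_part q_prime S0 X1 alpha8 smW' W1 largeX hc np.
  have -> : \sum_(m < q) er m * chi m = r%:C.
    have q1 : (1 < q)%N by exact: prime_gt1.
    rewrite (bigD1 (Ordinal q1))//= (char1 hc) mulr1 big1 ?addr0// => m m1.
    by rewrite /er ifF ?mul0r//; apply/negbTE; apply: contra m1 => /eqP e; apply/eqP/val_inj.
  rewrite -(subrK (\sum_(m < q) smooth_coef W alpha m * chi m) GA) addrC.
  apply: (le_trans (sqr_normc_le2 _ _)); rewrite lerD2l ler_pM2l// normcR (ger0_norm r0).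
  by rewrite lerXn2r ?nnegrE ?normc_ge0.
have tau2 := normc_gauss_sum q_prime hpsi nppsi.
pose Z (e : R) := \sum_(m < half) psi m * exp_coef W alpha (e * xi R q m).
have hZ (e : R) : `|e| = 1 -> q%:R^-1 * normc (Z e) ^+ 2 <= 2 * Dd e psi + 2 * Ee e psi.
  move=> e1; have h := exp_coef_split e1 psi0.
  have := sqr_normc_le2 (\sum_(m < half) dual_coef q W alpha e m * psi m) (\sum_(m < q) dual_error e m * psi m).
  rewrite -h normcM exprMn normcR real_normK ?num_real// exprVn sqr_sqrtr; last exact: ltW.
  by [].
(* Division by the Gauss sum, whose squared modulus is q, together with |psi(q - 1)| <= 1. *)
have hB : normc GB ^+ 2 <= q%:R^-1 * (2 * normc (Z 1) ^+ 2 + 2 * normc (Z (-1)) ^+ 2).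
  rewrite mulrC ler_pdivlMr// -tau2 mulrC -exprMn -normcM char_integral_low//.
  apply: (le_trans (sqr_normc_le2 _ _)); rewrite lerD2l ler_pM2l// lerXn2r ?nnegrE ?normc_ge0//.
  rewrite normcM -[leRHS]mul1r; apply: ler_pM; rewrite ?normc_ge0//.
  exact: (normc_char_le1 q_prime).
have hZ1 := hZ 1 n1; have hZ2 := hZ (-1) n1'.
have tot : normc (char_integral q s chi) ^+ 2 <=
   4 * normc (\sum_(m < q) smooth_coef W alpha m * chi m) ^+ 2 + 4 * normc (\sum_(m < q) er m * chi m) ^+ 2
   + (8 * Dd 1 psi + 8 * Ee 1 psi) + (8 * Dd (-1) psi + 8 * Ee (-1) psi).
  rewrite GE; apply: (le_trans (sqr_normc_le2 _ _)); move: hA hB hZ1 hZ2.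
  move: (normc GA ^+ 2) (normc GB ^+ 2) (normc (Z 1) ^+ 2) (normc (Z (-1)) ^+ 2) (Dd 1 psi) (Ee 1 psi) (Dd (-1) psi) (Ee (-1) psi).
  move: (normc _ ^+ 2) (normc _ ^+ 2) => a1 a2 a3 a4 a5 a6 a7 a8 a9 a10; lra.
apply: (le_trans (ler_wpM2r (w_ge0 chi) tot)); rewrite /A /Rr.
have alg (a b c d e f u : R) : (4 * a + 4 * b + (8 * c + 8 * d) + (8 * e + 8 * f)) * u =
  4 * (a * u) + 4 * (b * u) + (8 * (c * u) + 8 * (d * u)) + (8 * (e * u) + 8 * (f * u)) by ring.
by rewrite alg.
Qed.

End IntegralMeanSquare.

(** * Assembly *)

Section FinalBounds.
Variable R : realType.
Local Notation C := R[i].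

(* A sum with infinite support is 0 by convention, hence the finiteness of the
   set of characters is never needed. *)
Lemma fsbig_norm_le (D : set (nat -> C)) (F : (nat -> C) -> C) (A : R) : 0 <= A ->
  (forall r : seq (nat -> C), uniq r -> (forall chi, chi \in r -> D chi) ->
     \sum_(chi <- r) normc (F chi) <= A) ->
  normc (\sum_(chi \in D) F chi) <= A.
Proof.
move=> A0 h.
have [fin|inf] := pselect (finite_set (D `&` F @^-1` [set~ 0])); last first.
  by rewrite fsbig_dflt// normc0.
apply: (le_trans (normc_sum _ _ _)); apply: h; first exact: finite_support_uniq.
by move=> chi; rewrite in_finite_support// inE => -[].
Qed.

Lemma exp_thresholds (X B : R) : 0 <= B -> 384 + 32 * B <= X ->
  [/\ 1 < X, 6 * X <= expR (X / 4), 2 <= expR (X / 64) & B <= expR (X / 32)].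
Proof.
move=> B0 hX; split; first lra.
- have h := expR_ge1Dx (X / 8).
  have -> : expR (X / 4) = expR (X / 8) * expR (X / 8) by rewrite -expRD; congr expR; lra.
  nra.
- have := expR_ge1Dx (X / 64); lra.
- have := expR_ge1Dx (X / 32); lra.
Qed.

Lemma theta_root_le (a eta : R) (q J : nat) : 0 < eta -> 0 < a -> eta <= expR (- 1) * a ^+ 4 ->
  0 <= theta eta q J -> theta eta q J <= expR 1 * eta -> theta eta q J `^ (1 / 4) <= a.
Proof.
move=> e0 a0 he t0 ht.
have h : theta eta q J <= a ^+ 4.
  apply: (le_trans ht); apply: (@le_trans _ _ (expR 1 * (expR (- 1) * a ^+ 4))).
    by apply: ler_wpM2l => //; exact: expR_ge0.
  by rewrite mulrA -expRD subrr expR0 mul1r.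
have -> : a = (a ^+ 4) `^ (1 / 4).
  have e4 : 4%:R * (1 / 4) = 1 :> R by lra.
  by rewrite -powR_mulrn ?(ltW a0)// -powRrM e4 powRr1// ltW.
by apply: ge0_ler_powR => //; rewrite ?nnegrE ?exprn_ge0 ?(ltW a0).
Qed.

Lemma short_product_conj q k (x : nat -> nat -> R) (chi : nat -> C) :
  short_product q k (fun i a => (x i a)%:C) (conj_character chi) =
  conjc (short_product q k (fun i a => (x i a)%:C) chi).
Proof.
have conjcR (u : R) : conjc u%:C = u%:C by apply/eqP; rewrite eq_complex/= oppr0 !eqxx.
rewrite /short_product; elim: k => [|k IH]; first by rewrite !big_ord0 -[1]/((1 : R)%:C) conjcR.
rewrite !big_ord_recr/= conjcM IH conjc_sum; congr (_ * _); apply: eq_bigr => a _.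
by rewrite /twist_weight !conjcM !conjcR.
Qed.

(** Fixes the constants in their order of dependence: the growth exponent B of the mean square gives
    N, N gives the cutoff bound [Sw], and then the threshold for q is chosen. The last conjunct
    allows the weights of chi and of its conjugate to be identified. *)
Lemma dirichlet_L_mean_square (c0 eta K a : R) : 0 < eta -> 0 < a -> 640 * a <= 1 ->
  eta <= expR (- 1) * a ^+ 4 -> 0 < K ->
  exists (A : R) (Q0 : nat), 0 <= A /\ forall (q J : nat) (alpha : C) (T : seq (nat -> C)),
    prime q -> (Q0 <= q)%N -> eta <= theta eta q J -> theta eta q J <= expR 1 * eta ->
    normc alpha <= K / ln q%:R -> uniq T ->
    (forall chi, chi \in T -> dirichlet_character q chi /\ chi <> principal_character R q) ->
    \sum_(chi <- T) normc (dirichlet_L (2^-1 + alpha) chi) ^+ 2 * normc (mollifier c0 eta q J chi) ^+ 2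
      <= A * q%:R
    /\ forall chi, mollifier c0 eta q J (conj_character chi) = conjc (mollifier c0 eta q J chi).
Proof.
move=> e0 a0 a640 he K0.
have a1 : a <= 1 by lra.
have he1 : eta <= expR (- 1).
  by apply: (le_trans he); rewrite ler_piMr ?expR_ge0// exprn_ile1// ltW.
have [A0 [B [Q1 hMS]]] := block_conv_mean_square c0 e0 he1 (ltW K0).
(* The successor, because the cutoff requires N to be positive. *)
pose N := B.+1.
have [Sw Sw0 hcut] := @smooth_cutoff_exists R N isT.
have [cg [dg [cg0 dg0 dg8 hgam]]] := gamma_factor_lower R.
have wm0 := weight_mass_ge0 R.
pose cm := coef_mass N Sw K.
pose C1 := 4 * (cm * (`|A0| * cm)) + 34.
have cm0 : 0 <= cm by rewrite /cm /coef_mass !mulr_ge0 ?expR_ge0 ?exprn_ge0 ?addr_ge0// ltW.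
have C10 : 0 <= C1.
  have h : 0 <= cm * (`|A0| * cm) by apply: (mulr_ge0 cm0); exact: (mulr_ge0 (normr_ge0 _) cm0).
  by rewrite /C1; lra.
have [Bt BtE] : exists Bt : R, 600 * Sw * weight_mass R * expR (2 * K) = Bt by eexists.
have Bt0 : 0 <= Bt.
  by rewrite -BtE; exact: mulr_ge0 (mulr_ge0 (mulr_ge0 (ler0n _ _) Sw0) wm0) (expR_ge0 _).
pose X0 := 384 + 32 * Bt + K / dg.
exists ((cg ^+ 2)^-1 * (20 * C1 + 20)), (maxn Q1 (maxn 3 (Num.truncn (expR X0)).+1)).
split; first by apply: mulr_ge0; [rewrite invr_ge0 sqr_ge0|lra].
move=> q J alpha T q_prime; rewrite !geq_max => /and3P[qQ1 q3 qX] th1 th2 halpha uT hT.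
have q0 : 0 < q%:R :> R by rewrite ltr0n prime_gt0.
have [X XE] : exists X : R, ln (q%:R : R) = X by eexists.
have Kd0 : 0 <= K / dg by rewrite divr_ge0// ltW.
have XX0 : X0 <= X.
  rewrite -XE -[X0]expRK ler_ln ?posrE ?expR_gt0//.
  have /andP[_ h] := truncn_itv (expR_ge0 X0); apply: (le_trans (ltW h)); by rewrite ler_nat.
have X384 : 384 + 32 * Bt <= X by move: XX0; rewrite /X0; lra.
have [X1 X6 X2 XB] := exp_thresholds Bt0 X384.
have l1 : 1 < ln (q%:R : R) by rewrite XE.
have l1' : 1 <= ln (q%:R : R) by exact: ltW.
have eX : expR X = q%:R by rewrite -XE lnK ?posrE.
have q_odd : odd q by case: (even_prime q_prime) => // q2; move: q3; rewrite q2.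
have alphad : normc alpha <= dg.
  apply: (le_trans halpha); rewrite XE ler_pdivrMr; last lra.
  rewrite mulrC -ler_pdivrMr//; move: XX0; rewrite /X0; lra.
have alpha8 : normc alpha <= 1/8 by exact: le_trans dg8.
have hL : (0 < q ^ 4)%N by rewrite expn_gt0 prime_gt0.
have Xp : 0 < X by lra.
(* Averages over q^4 shifts make the approximation error Sw q^(-4) = Sw exp(- 4 X). *)
have [W [smW smW' W1 W0]] := hcut X (q ^ 4)%N Xp hL.
have epsE : Sw / (q ^ 4)%:R = Sw * expR (- (4 * X)).
  by rewrite natrX -eX -expRM_natl expRN.
rewrite epsE in smW smW'.
(* 10 a <= 1/64 by the assumption on [a]; this yields the mollifier length q^(1/64). *)
have thr : 10 * theta eta q J `^ (1 / 4) <= 1/64.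
  have := theta_root_le e0 a0 he (ltW (theta_gt0 J e0 l1)) th2; lra.
pose xr i n : R := block_coef R (prime_block c0 eta q) (ell eta q) i n.
pose x i n : C := (xr i n)%:C.
have molE chi : mollifier c0 eta q J chi = short_product q J.+1 x chi.
  by apply: mollifier_short_product thr _ => //; lra.
have mol_conj chi : mollifier c0 eta q J (conj_character chi) = conjc (mollifier c0 eta q J chi).
  by rewrite !molE; exact: short_product_conj.
split; last exact: mol_conj.
pose w chi : R := normc (short_product q J.+1 x chi) ^+ 2.
have TV := prod_block_bound_le e0 l1 thr.
have T1 i : 1 <= block_bound eta q i by exact: block_bound_ge1.
have x1 i n : normc (x i n) <= 1 by exact: normc_block_coef_le1.
have xT i n : x i n != 0 -> (0 < n)%N /\ n%:R <= block_bound eta q i by exact: block_coef_le.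
have E0 : 0 <= error_size R q by exact: expR_ge0.
have hE : expR (1/64 * ln q%:R) ^+ 2 * error_size R q ^+ 2 * q%:R <= 1.
  rewrite /error_size XE -eX -!expRM_natl -!expRD -[leRHS]expR0 ler_expR; lra.
have hVY : expR (1/64 * ln q%:R) * cut_length R q <= q%:R.
  rewrite /cut_length XE -eX -expRD ler_expR; lra.
have hY2 : 2 * cut_length R q <= q%:R.
  apply: le_trans hVY; apply: ler_wpM2r; first exact: expR_ge0.
  by rewrite XE mulrC mulrA mulr1.
have meanP (f : nat -> C) (M : nat) (T' : seq (nat -> C)) : uniq T' ->
  (forall chi, chi \in T' -> dirichlet_character q chi) ->
  power_sum_approx q N K cm f ->
  (forall m, (m < q)%N -> cut_length R q <= m%:R -> normc (f m) <= error_size R q) ->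
  (M <= q)%N -> (forall m : nat, m%:R < cut_length R q -> (m < M)%N) ->
  \sum_(chi <- T') normc (\sum_(m < M) f m * chi m) ^+ 2 * w chi <= C1 * q%:R.
  move=> uT' hT' [D [h [z [zre hsum happ]]]] fE Mq YM.
  have hH j : \sum_(n < q | (0 < n)%N) normc (iconv x (dirichlet_power (z j)) J.+1 n) ^+ 2 / n%:R
      <= `|A0| * (1 + normc (z j) * ln q%:R) ^+ N.
    apply: (le_trans (hMS q J (z j) qQ1 th1 th2 (zre j))).
    have z1 : 1 <= 1 + normc (z j) * ln q%:R by rewrite lerDl mulr_ge0 ?normc_ge0// XE ltW.
    apply: (@le_trans _ _ (`|A0| * (1 + normc (z j) * ln q%:R) ^+ B)).
      by apply: ler_wpM2r; [rewrite exprn_ge0//; lra|exact: ler_norm].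
    by apply: ler_wpM2l => //; apply: ler_weXn2l.
  have h1 := mollified_mean_square q_prime T1 x1 xT TV uT' hT' hH E0 hE hVY Mq happ fE YM.
  apply: (le_trans h1); rewrite mulrC; apply: ler_wpM2r; first exact: ltW.
  rewrite /C1 lerD2r ler_pM2l//; apply: ler_pM.
  - by apply: sumr_ge0 => j _; exact: normc_ge0.
  - apply: sumr_ge0 => j _; rewrite !mulr_ge0 ?normc_ge0 ?exprn_ge0 ?addr_ge0 ?mulr_ge0 ?normc_ge0//; by rewrite XE ltW.
  - apply: le_trans hsum; apply: ler_sum => j _; rewrite ler_peMr ?normc_ge0// exprn_ege1// lerDl mulr_ge0 ?normc_ge0//.
    by rewrite XE ltW.
  - under eq_bigr do rewrite mulrCA.
    by rewrite -mulr_sumr; apply: ler_wpM2l.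
have smallP (e : nat -> C) (T' : seq (nat -> C)) : uniq T' ->
  (forall chi, chi \in T' -> dirichlet_character q chi) ->
  (forall m, (0 < m < q)%N -> normc (e m) <= error_size R q) ->
  \sum_(chi <- T') normc (\sum_(m < q) e m * chi m) ^+ 2 * w chi <= q%:R.
  by move=> uT' hT' eE; exact: (small_mean_square q_prime T1 x1 xT TV uT' hT' E0 hE eE).
have w_ge0 chi : 0 <= w chi by exact: sqr_ge0.
have w_conj chi : w (conj_character chi) = w chi.
  by rewrite /w -!molE mol_conj normc_conj.
rewrite -XE in smW smW' W1 W0 X6 XB.
rewrite -BtE in XB.
have main := integral_mean_square q_prime q_odd Sw0 (ltW K0) l1' halpha alpha8 smW smW' W1 W0 X6 hY2 XB
  w_ge0 w_conj meanP smallP uT hT.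
have hs := Re_half_add alpha8.
have gc := hgam alpha alphad.
have g0 : gamma_factor (2^-1 + alpha) != 0 by rewrite -normc_gt0 (lt_le_trans cg0).
rewrite -mulrA; apply: (@le_trans _ _ ((cg ^+ 2)^-1 * \sum_(chi <- T) normc (char_integral q (2^-1 + alpha) chi) ^+ 2 * w chi)); last first.
  by apply: ler_wpM2l; [rewrite invr_ge0 sqr_ge0|exact: main].
rewrite mulr_sumr big_seq [leRHS]big_seq; apply: ler_sum => chi cT.
have [hc np] := hT chi cT.
rewrite molE -/(w chi) [leRHS]mulrA; apply: ler_wpM2r; first exact: w_ge0.
rewrite -(gamma_dirichlet_L q_prime hc np hs g0) normcM exprMn mulrA ler_peMl ?sqr_ge0//.
rewrite mulrC ler_pdivlMr ?exprn_gt0// mul1r lerXn2r ?nnegrE ?normc_ge0// ltW//.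
Qed.

End FinalBounds.

Theorem proposition1p1 (R : realType) :
  exists C0 : R, exists2 eta0 : R, 0 < eta0 &
  forall c0 eta K : R, C0 <= c0 -> 0 < eta -> eta <= eta0 -> 0 < K ->
  exists (A : R) (Q0 : nat),
  forall (q J : nat) (alpha beta : R[i]),
    prime q -> (Q0 <= q)%N ->
    eta <= theta eta q J -> theta eta q J <= expR 1 * eta ->
    `|alpha| <= (K / ln q%:R)%:C -> `|beta| <= (K / ln q%:R)%:C ->
    `| \sum_(chi \in [set chi : nat -> R[i] |
                       primitive_character q chi /\
                       chi <> principal_character R q])
         (dirichlet_L (2^-1 + alpha) chi *
          dirichlet_L (2^-1 + beta) (conj_character chi) *
          `| mollifier c0 eta q J chi | ^+ 2) |
    <= (A * q%:R)%:C.
Proof.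
(* 640 = 10 * 64: theta_J^(1/4) <= a gives mollifier length at most q^(1/64), and eta <= e^(-1) a^4
   ensures this because theta_J <= e eta. *)
pose a : R := 640^-1.
have a0 : 0 < a by rewrite invr_gt0 ltr0n.
have a640 : 640 * a <= 1 by rewrite /a divff// pnatr_eq0.
exists 1, (expR (- 1) * a ^+ 4); first by rewrite mulr_gt0 ?expR_gt0 ?exprn_gt0.
move=> c0 eta K _ e0 he K0.
have [A [Q0 [A0 hA]]] := dirichlet_L_mean_square c0 e0 a0 a640 he K0.
exists A, Q0 => q J alpha beta q_prime qQ th1 th2; rewrite !ler_normcR => halpha hbeta.
apply: fsbig_norm_le; first by rewrite mulr_ge0.
move=> r ur hr.
have hr1 chi : chi \in r -> dirichlet_character q chi /\ chi <> principal_character R q.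
  by move=> /hr[[]].
pose r' := [seq conj_character chi | chi <- r].
have ur' : uniq r' by rewrite map_inj_uniq//; exact: can_inj (@conj_characterK R).
have hr' psi : psi \in r' -> dirichlet_character q psi /\ psi <> principal_character R q.
  move=> /mapP[chi /hr1[hc np] ->]; split; first exact: conj_char.
  by move=> e; apply: np; rewrite -(conj_characterK chi) e conj_principal.
have [h1 mc] := hA q J alpha r q_prime qQ th1 th2 halpha ur hr1.
have [h2 _] := hA q J beta r' q_prime qQ th1 th2 hbeta ur' hr'.
rewrite big_map in h2.
(* Cauchy-Schwarz takes the termwise form |x y| <= (|x|^2 + |y|^2) / 2; the mean square with beta is
   the one over the conjugated list. *)
apply: (@le_trans _ _ (2^-1 * (A * q%:R + A * q%:R))); last by lra.
apply: (le_trans _ (ler_wpM2l _ (lerD h1 h2))); last by rewrite invr_ge0.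
rewrite -big_split/= mulr_sumr; apply: ler_sum => chi _.
rewrite 2!normcM normrcE normcX normcR (ger0_norm (normc_ge0 _)) mc normc_conj.
rewrite -mulrDl mulrA; apply: ler_wpM2r; first exact: sqr_ge0.
by have := sqr_ge0 (normc (dirichlet_L (2^-1 + alpha) chi) - normc (dirichlet_L (2^-1 + beta) (conj_character chi))); nra.
Qed.
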